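(* Let $\Omega=(a,b)$ be a finite interval, $\alpha>0$ and $1\le p<\infty$. Then, for each choice of sign $\pm$, ${}^{\pm}\overline{W}^{\alpha,p}(\Omega)={}^{\pm}W^{\alpha,p}(\Omega)$.
   Context: Fractional integrals on $(a,b)$, for $\sigma>0$: ${}^{-}I^{\sigma}f(x)=\frac{1}{\Gamma(\sigma)}\int_a^x\frac{f(y)}{(x-y)^{1-\sigma}}\,dy$ and ${}^{+}I^{\sigma}f(x)=\frac{1}{\Gamma(\sigma)}\int_x^b\frac{f(y)}{(y-x)^{1-\sigma}}\,dy$. For $n-1<\alpha<n$ ($n\in\mathbb{N}$): ${}^{-}D^{\alpha}\varphi=\frac{d^n}{dx^n}\,{}^{-}I^{n-\alpha}\varphi$ and ${}^{+}D^{\alpha}\varphi=(-1)^n\frac{d^n}{dx^n}\,{}^{+}I^{n-\alpha}\varphi$; for integer $\alpha$, ${}^{\pm}D^{\alpha}$ is the ordinary derivative of order $\alpha$. Weak fractional derivatives: let $[\alpha]$ be the integer part of $\alpha$. For $u\in L^1(\Omega)$, $v\in L^1_{loc}(\Omega)$ is the left (resp. right) weak fractional derivative of $u$, written ${}^{-}\mathcal{D}^{\alpha}u=v$ (resp. ${}^{+}\mathcal{D}^{\alpha}u=v$), if $\int_\Omega v\varphi\,dx=(-1)^{[\alpha]}\int_\Omega u\,{}^{+}D^{\alpha}\varphi\,dx$ (resp. with ${}^{-}D^{\alpha}\varphi$ on the right-hand side) for all $\varphi\in C_0^\infty(\Omega)$. With $m=[\alpha]$, ${}^{\pm}W^{\alpha,p}(\Omega)=\{u\in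 W^{m,p}(\Omega):{}^{\pm}\mathcal{D}^{\alpha}u\in L^p(\Omega)\}$ with norm $\|u\|_{{}^{\pm}W^{\alpha,p}(\Omega)}=\big(\|u\|_{W^{m,p}(\Omega)}^p+\|{}^{\pm}\mathcal{D}^{\alpha}u\|_{L^p(\Omega)}^p\big)^{1/p}$ ($W^{0,p}=L^p$). ${}^{\pm}\overline{W}^{\alpha,p}(\Omega)$ denotes the completion of $C^\infty(\Omega)$ (that is, of those functions in $C^\infty(\Omega)$ having finite norm) in the norm $\|\cdot\|_{{}^{\pm}W^{\alpha,p}(\Omega)}$. *)

(* Defs.v *)
From mathcomp Require Import all_boot all_order all_algebra.
From mathcomp Require Import all_classical all_reals all_analysis.

Set Implicit Arguments.
Unset Strict Implicit.
Unset Printing Implicit Defensive.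
Import Order.TTheory GRing.Theory Num.Theory.
Import numFieldNormedType.Exports.

Local Open Scope classical_set_scope.
Local Open Scope ring_scope.

(* A function on Omega is a total function R -> R of which only the values on
   Omega matter; elements of Lebesgue and Sobolev spaces are such functions up
   to equality almost everywhere on Omega. *)

Inductive side := Left | Right.

Definition other (s : side) : side :=
  match s with Left => Right | Right => Left end.

Section Completion.
Context {R : realType} {V : zmodType}.
Implicit Types (eqv : V -> V -> Prop) (N : V -> \bar R) (S T : set V)
  (u : nat -> V).

Definition norm_cauchy N u : Prop :=
  forall e : R, 0 < e ->
    exists k : nat, forall i j : nat,
      (k <= i)%N -> (k <= j)%N -> (N (u i - u j)%R < e%:E)%E.

Definition norm_cvg N u (w : V) : Prop :=
  (fun k => N (u k - w)) @ \oo --> 0%E.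

(* T, with elements identified along eqv and normed by N, is the completion of
   its subset S for the same N: points of T at distance 0 are the identified
   ones, T is complete, and S is dense in T.  The isometric embedding of S in T
   is the inclusion. *)
Definition is_completion eqv N S T : Prop :=
  [/\ S `<=` T,
      (forall u v : V, T u -> T v -> N (u - v) = 0%E <-> eqv u v),
      (forall u, (forall k, T (u k)) -> norm_cauchy N u ->
         exists2 w : V, T w & norm_cvg N u w)
    & (forall w : V, T w ->
         exists2 u, (forall k, S (u k)) & norm_cvg N u w)].

End Completion.

Section FractionalSobolev.
Context {R : realType}.
Implicit Types (a b alpha sigma p : R) (D : set R) (u v phi f : R -> R).

Local Notation mu := (@lebesgue_measure R).

Definition Gamma (sigma : R) : R :=
  \int[mu]_(t in `]0, +oo[) (t `^ (sigma - 1) * expR (- t)).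

Definition frac_int (s : side) a b sigma f (x : R) : R :=
  (Gamma sigma)^-1 *
  match s with
  | Left => \int[mu]_(y in `]a, x[) (f y / (x - y) `^ (1 - sigma))
  | Right => \int[mu]_(y in `]x, b[) (f y / (y - x) `^ (1 - sigma))
  end.

(* For alpha > 0 not an integer, n - 1 < alpha < n forces n = [alpha] + 1. *)
Definition frac_deriv (s : side) a b alpha phi : R -> R :=
  let m := Num.truncn alpha in
  let n := m.+1 in
  if alpha == m%:R then derive1n m phi
  else match s with
       | Left => derive1n n (frac_int Left a b (n%:R - alpha) phi)
       | Right => fun x =>
           (-1) ^+ n * derive1n n (frac_int Right a b (n%:R - alpha) phi) x
       end.

Definition smooth_on D f : Prop :=
  forall (n : nat) (x : R), D x -> derivable (derive1n n f) x 1.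

(* C_0^oo(D) for open D; the functions are extended by 0 outside D. *)
Definition test_function D phi : Prop :=
  [/\ smooth_on setT phi,
      compact (closure [set x | phi x != 0])
    & closure [set x | phi x != 0] `<=` D].

Definition Lp_norm D p u : \bar R := 'N[mu]_p%:E[EFin \o (u \_ D)].

Definition Lp D p : set (R -> R) := [set u | u \_ D \in Lfun mu p%:E].

Definition is_weak_deriv D (k : nat) u v : Prop :=
  [/\ locally_integrable D u, locally_integrable D v
    & forall phi, test_function D phi ->
        \int[mu]_(x in D) (v x * phi x) =
        (-1) ^+ k * \int[mu]_(x in D) (u x * derive1n k phi x)].

Definition is_weak_frac_deriv (s : side) a b alpha u v : Prop :=
  let D := `]a, b[%classic in
  [/\ Lp D 1 u, locally_integrable D v
    & forall phi, test_function D phi ->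
        \int[mu]_(x in D) (v x * phi x) =
        (-1) ^+ Num.truncn alpha *
        \int[mu]_(x in D) (u x * frac_deriv (other s) a b alpha phi x)].

(* Weak derivatives are unique up to equality almost everywhere; these pick a
   representative, with junk value 0 when there is none. *)
Definition weak_deriv D (k : nat) u : R -> R :=
  xget (cst 0) [set v | is_weak_deriv D k u v].

Definition weak_frac_deriv (s : side) a b alpha u : R -> R :=
  xget (cst 0) [set v | is_weak_frac_deriv s a b alpha u v].

Definition sobolev D (m : nat) p : set (R -> R) :=
  [set u | Lp D p u /\
     forall k : nat, (1 <= k <= m)%N ->
       exists2 v, is_weak_deriv D k u v & Lp D p v].

Definition sobolev_norm D (m : nat) p u : \bar R :=
  ((Lp_norm D p u `^ p +
    \sum_(1 <= k < m.+1) Lp_norm D p (weak_deriv D k u) `^ p) `^ p^-1)%E.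

Definition frac_sobolev (s : side) a b alpha p : set (R -> R) :=
  [set u | sobolev `]a, b[ (Num.truncn alpha) p u /\
     exists2 v, is_weak_frac_deriv s a b alpha u v & Lp `]a, b[ p v].

(* Meaningful on frac_sobolev s a b alpha p only, where the weak derivatives
   exist. *)
Definition frac_sobolev_norm (s : side) a b alpha p u : \bar R :=
  ((sobolev_norm `]a, b[ (Num.truncn alpha) p u `^ p +
    Lp_norm `]a, b[ p (weak_frac_deriv s a b alpha u) `^ p) `^ p^-1)%E.

(* The functions of C^oo(a, b) with finite norm are those for which the weak
   derivatives in the norm exist and are in L^p, i.e. those in the space. *)
Definition smooth_frac_sobolev (s : side) a b alpha p : set (R -> R) :=
  [set f | smooth_on `]a, b[ f] `&` frac_sobolev s a b alpha p.

End FractionalSobolev.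

(* Main.v *)
Require Import Defs.
From HB Require Import structures.
From mathcomp Require Import all_boot all_order all_algebra.
From mathcomp Require Import all_classical all_reals all_analysis.
From mathcomp Require Import measurable_realfun lebesgue_integral_under.
From mathcomp Require Import ring lra.
Import Order.TTheory GRing.Theory Num.Theory.
Import numFieldNormedType.Exports.
Set Implicit Arguments.
Unset Strict Implicit.
Unset Printing Implicit Defensive.
Local Open Scope classical_set_scope.
Local Open Scope ring_scope.

(** The p-th power of the norm is a finite sum of p-th powers of L^p norms: of u, of its weak
    derivatives up to order m = [alpha], and of its weak fractional derivative. Each term is tied to
    u by a duality identity against test functions. By the fundamental lemma ([fundamental_lemma])
    these derivatives are unique almost everywhere, so the norm vanishes exactly on null functions.
    The identities survive L^p limits ([weak_family_lim]), so [Riesz_Fischer] applied term by term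
    gives completeness.

    Density is obtained without mollification, by solving the equation for the fractional
    derivative. Write [K tau] for the one-sided potential with kernel of order tau. Up to a
    constant, J = K(1)^m K(alpha - m), or K(1)^m when alpha is an integer, is a right inverse of the
    weak derivative of order alpha, and it is bounded on L^p together with its derivatives up to
    order m ([solution_operator]). The elements of zero weak derivative are almost everywhere finite
    sums of powers of the distance to one endpoint ([frac_kernel]). This follows from the du
    Bois-Reymond lemma: K(sigma) u is a power sum, and applying K(1 - sigma) and differentiating
    recovers u, which is Abel's inversion. Finally power sums, already as polynomials, are dense in
    L^p ([psum_dense], through Bernstein polynomials), and J sends power sums to power sums.

    Given w with fractional derivative v, take a power sum g close to v in L^p and put h = g - v.
    Then w + J h has derivative g, so it differs from the power sum J g by an element of the kernel.
    It is therefore a power sum almost everywhere, which is smooth inside (a,b), and its distance to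
    w is the norm of J h, which is small ([frac_sobolev_dense]). *)

(** * Smooth functions and chains of derivatives *)

Section Smooth.
Context {R : realType}.
Implicit Types (D : set R) (f g : R -> R) (F : nat -> R -> R).

Lemma eq_is_derive f g (x d d' : R) :
  is_derive x 1 f d -> f =1 g -> d = d' -> is_derive x 1 g d'.
Proof. by move=> df /funext <- <-. Qed.

(** Smoothness is proved by exhibiting the whole chain of derivatives at once. Openness of [D] lets
    [f] be replaced by [F 0] near each point, although the two agree on [D] only. *)
Lemma derive_family D f F : open D ->
  (forall n x, D x -> is_derive x 1 (F n) (F n.+1 x)) ->
  (forall x, D x -> f x = F 0%N x) ->
  forall n x, D x -> derive1n n f x = F n x /\ is_derive x 1 (derive1n n f) (F n.+1 x).
Proof.
move=> oD dF f0.
have step n : (forall x, D x -> derive1n n f x = F n x) ->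
    forall x, D x -> is_derive x 1 (derive1n n f) (F n.+1 x).
  move=> E x Dx; apply: near_eq_is_derive (dF n x Dx).
  have : nbhs x D by exact: open_nbhs_nbhs.
  by apply: filterS => y Dy; rewrite E.
elim=> [|n IH] x Dx; first by split; [exact: f0|exact: step].
have E y : D y -> derive1n n.+1 f y = F n.+1 y.
  by move=> Dy; rewrite derive1nS derive1E; have [_ [_ ->]] := IH _ Dy.
by split; [exact: E|exact: step].
Qed.

Lemma smooth_family D f F : open D ->
  (forall n x, D x -> is_derive x 1 (F n) (F n.+1 x)) ->
  (forall x, D x -> f x = F 0%N x) -> smooth_on D f.
Proof.
by move=> oD dF f0 n x Dx; have [_ []] := derive_family oD dF f0 n Dx.
Qed.

Lemma smooth_is_derive D f n x : smooth_on D f -> D x ->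
  is_derive x 1 (derive1n n f) (derive1n n.+1 f x).
Proof.
by move=> sf Dx; rewrite derive1nS derive1E; apply: derivableP; exact: sf.
Qed.

Lemma smooth_derive1n D f k : smooth_on D f -> smooth_on D (derive1n k f).
Proof. by move=> sf n x Dx; rewrite /derive1n -iterD; exact: sf. Qed.

Lemma smoothD D f g : open D -> smooth_on D f -> smooth_on D g ->
  smooth_on D (f \+ g).
Proof.
move=> oD sf sg; apply: (@smooth_family _ _ (fun n => derive1n n f \+ derive1n n g)) => //.
by move=> n x Dx; apply: is_deriveD; exact: (@smooth_is_derive D).
Qed.

Lemma derive1nD f g n : smooth_on setT f -> smooth_on setT g ->
  derive1n n (f \+ g) = derive1n n f \+ derive1n n g.
Proof.
move=> sf sg; apply/funext => x.
apply: (@derive_family setT _ (fun n => derive1n n f \+ derive1n n g) _ _ _ n x _).1 => //.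
  exact: openT.
by move=> k y _; apply: is_deriveD; exact: (@smooth_is_derive setT).
Qed.

Lemma smoothZ D f (c : R) : open D -> smooth_on D f -> smooth_on D (fun x => c * f x).
Proof.
move=> oD sf; apply: (@smooth_family _ _ (fun n x => c * derive1n n f x)) => //.
by move=> n x Dx; apply: (@is_deriveZ _ _ _ (derive1n n f) c); exact: (@smooth_is_derive D).
Qed.

Lemma derive1nZ f (c : R) n : smooth_on setT f ->
  derive1n n (fun x => c * f x) = (fun x => c * derive1n n f x).
Proof.
move=> sf; apply/funext => x.
apply: (@derive_family setT _ (fun n x => c * derive1n n f x) _ _ _ n x _).1 => //.
  exact: openT.
by move=> k y _; apply: (@is_deriveZ _ _ _ (derive1n k f) c); exact: (@smooth_is_derive setT).
Qed.

Lemma smooth_affine f (c d : R) : smooth_on setT f ->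
  smooth_on setT (fun x => f (c * x + d)).
Proof.
move=> sf.
apply: (@smooth_family _ _ (fun n x => c ^+ n * derive1n n f (c * x + d))) => //.
- exact: openT.
- move=> n x _.
  have d1 : is_derive x 1 (fun x : R => c * x + d) c.
    have H : is_derive x 1 (fun x : R => c * x + d) (c * 1 + 0).
      exact: (@is_deriveD R R R (fun x => c * x) (cst d) x 1 _ _ (@is_deriveZ R R R id c x 1 1 _)).
    by move: H; rewrite mulr1 addr0.
  have d2 := smooth_is_derive n sf (I : setT (c * x + d)).
  have d3 := @is_derive1_comp R (derive1n n f) (fun x : R => c * x + d) x _ _ d2 d1.
  apply: eq_is_derive (@is_deriveZ _ _ _ _ (c ^+ n) x 1 _ d3) _ _ => //.
  by rewrite /GRing.scale/= exprSr -mulrA; congr *%R; rewrite mulrC.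
- by move=> x _; rewrite expr0 mul1r.
Qed.

(* C^n-differentiability, by recursion on [n], is stable under products
   because only finitely many derivatives are involved at each stage. *)
Fixpoint Cn (n : nat) f : Prop :=
  if n is n'.+1 then (forall x, derivable f x 1) /\ Cn n' (derive1 f) else True.

Lemma CnW n f : Cn n.+1 f -> Cn n f.
Proof. by elim: n f => // n IH f [df Cf]; split => //; exact: IH. Qed.

Lemma CnD n f g : Cn n f -> Cn n g -> Cn n (f \+ g).
Proof.
elim: n f g => // n IH f g [df Cf] [dg Cg]; split.
  by move=> x; exact: derivableD.
have -> : derive1 (f \+ g) = derive1 f \+ derive1 g.
  by apply/funext => x; rewrite /= !derive1E deriveD.
exact: IH.
Qed.

Lemma CnM n f g : Cn n f -> Cn n g -> Cn n (f \* g).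
Proof.
elim: n f g => // n IH f g [df Cf] [dg Cg]; split.
  by move=> x; exact: derivableM.
have -> : derive1 (f \* g) = (f \* derive1 g) \+ (g \* derive1 f).
  by apply/funext => x; rewrite /= !derive1E deriveM.
by apply: CnD; apply: IH => //; apply: CnW.
Qed.

Lemma smooth_Cn f : smooth_on setT f <-> forall n, Cn n f.
Proof.
split => [sf n|Cf n x _].
  elim: n f sf => // n IH f sf; split; first by move=> x; exact: (sf 0%N).
  by apply: IH; exact: (@smooth_derive1n _ _ 1).
elim: n f Cf x => [|n IH] f Cf x; first exact: (Cf 1%N).1.
by rewrite derive1Sn; apply: IH => k; exact: (Cf k.+1).2.
Qed.

Lemma smoothM f g : smooth_on setT f -> smooth_on setT g ->
  smooth_on setT (f \* g).
Proof. by move=> /smooth_Cn sf /smooth_Cn sg; apply/smooth_Cn => n; exact: CnM. Qed.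

Lemma smooth_continuous f : smooth_on setT f -> continuous f.
Proof.
move=> sf x; apply: differentiable_continuous; apply/derivable1_diffP.
exact: (sf 0%N).
Qed.

End Smooth.

(** * The flat function exp(-1/x) *)

Section Flat.
Context {R : realType}.

(** The exponential series gives t^k <= k! e^t for each monomial, whence the weights k! in the
    constant. *)
Lemma horner_expR_bound (p : {poly R}) :
  exists2 C, 0 <= C & forall t, 0 <= t -> `|p.[t]| <= C * expR t.
Proof.
exists (\sum_(i < size p) `|p`_i| * i`!%:R); first exact: sumr_ge0.
move=> t t0; rewrite horner_coef mulr_suml; apply: le_trans (ler_norm_sum _ _ _) _.
apply: ler_sum => i _; rewrite normrM -mulrA ler_wpM2l//.
rewrite ger0_norm ?exprn_ge0//; case: (i : nat) => [|k].
  by rewrite expr0 fact0 mul1r -expR0 ler_expR.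
rewrite mulrC -ler_pdivrMr ?ltr0n ?fact_gt0//.
by apply: le_trans (expR_ge1Dxn k t0); rewrite lerDr.
Qed.

Lemma is_derive0_quadratic (f : R -> R) (C : R) :
  (forall h, `|f h| <= C * h ^+ 2) -> is_derive (0 : R) 1 f 0.
Proof.
move=> fC; apply/is_derive1_caratheodory.
have f0 : f 0 = 0.
  by have := fC 0; rewrite expr0n mulr0 normr_le0 => /eqP.
(* The slope in Caratheodory's criterion; as division by 0 gives 0, it already has the right value
   at the origin. *)
exists (fun z => f z / z); split.
- move=> z; rewrite subr0 f0 subr0; have [->|z0] := eqVneq z 0.
    by rewrite f0 mulr0.
  by rewrite divfK.
- apply/cvgrPdist_le => /= e e0.
  rewrite f0 mul0r.
  have C0 : 0 <= C by have := fC 1; rewrite expr1n mulr1; exact: le_trans.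
  have eC : 0 < e / (C + 1) by rewrite divr_gt0// ltr_wpDl.
  near=> z; rewrite sub0r normrN normrM normfV.
  have [->|z0] := eqVneq z 0; first by rewrite f0 normr0 mul0r ltW.
  rewrite ler_pdivrMr ?normr_gt0//; apply: le_trans (fC _) _.
  rewrite -real_normK ?num_real// expr2 mulrA ler_wpM2r//.
  have : `|z| <= e / (C + 1) by near: z; apply: (@nbhs0_le R R^o).
  rewrite ler_pdivlMr ?ltr_wpDl// mulrDr mulr1 mulrC; apply: le_trans.
  by rewrite lerDl.
- by rewrite f0 mul0r.
Unshelve. all: end_near. Qed.

Definition flat (x : R) : R := if 0 < x then expR (- x^-1) else 0.

(** For x > 0 the n-th derivative of exp(-1/x) is P_n(1/x) exp(-1/x); differentiating once more
    gives P_{n+1}(y) = y^2 (P_n(y) - P_n'(y)). *)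
Let flat_poly (n : nat) : {poly R} := iter n (fun p => 'X^2 * (p - p^`())) 1.

Let flat_derivs (n : nat) (x : R) : R :=
  if 0 < x then (flat_poly n).[x^-1] * expR (- x^-1) else 0.

(** With y = 1/h, this is |P_n(y)| y^2 <= C e^y rearranged. It settles differentiability at 0, where
    the two formulas meet. *)
Let flat_derivs_quadratic n : exists C, forall h, `|flat_derivs n h| <= C * h ^+ 2.
Proof.
have [C C0 CP] := horner_expR_bound (flat_poly n * 'X^2).
exists C => h; rewrite /flat_derivs; case: ifPn => h0; last first.
  by rewrite normr0 mulr_ge0// sqr_ge0.
have hV : 0 <= h^-1 by rewrite invr_ge0 ltW.
have := CP _ hV.
rewrite hornerM hornerXn normrM (ger0_norm (exprn_ge0 _ hV)) => H.
rewrite normrM (ger0_norm (expR_ge0 _)) expRN ler_pdivrMr ?expR_gt0//.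
by rewrite mulrAC -ler_pdivrMr ?exprn_gt0// -exprVn.
Qed.

Let flat_derivsP (n : nat) (x : R) : is_derive x 1 (flat_derivs n) (flat_derivs n.+1 x).
Proof.
case: (ltgtP x 0) => [x0|x0|->].
- rewrite {2}/flat_derivs ltNge (ltW x0)/=.
  apply: (@near_eq_is_derive _ R R (cst 0)).
  near=> y; rewrite /flat_derivs ifF//; apply/negbTE; rewrite -leNgt ltW//.
  by near: y; exact: lt_nbhsl.
- rewrite {2}/flat_derivs x0.
  have xV : is_derive x 1 (fun y : R => y^-1) (- x ^- 2).
    apply: eq_is_derive (@is_deriveV R id x 1 1 _ _) _ _ => //.
      by rewrite gt_eqF.
    by rewrite /GRing.scale/= mulr1.
  have xE : is_derive x 1 (fun y : R => expR (- y^-1)) (x ^- 2 * expR (- x^-1)).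
    apply: eq_is_derive (@is_derive1_comp R expR (fun y : R => - y^-1) x _ _ (is_derive_expR _) (@is_deriveN _ _ _ _ _ _ _ xV)) _ _ => //.
    by rewrite opprK mulrC.
  have xP : is_derive x 1 (fun y : R => (flat_poly n).[y^-1]) (((flat_poly n)^`()).[x^-1] * (- x ^- 2)).
    exact: (@is_derive1_comp R (horner (flat_poly n)) (fun y : R => y^-1)).
  apply: (@near_eq_is_derive _ R R (fun y => (flat_poly n).[y^-1] * expR (- y^-1))).
    near=> y; rewrite /flat_derivs ifT//.
    by near: y; exact: lt_nbhsr.
  apply: eq_is_derive (@is_deriveM _ _ _ _ _ _ _ _ xP xE) _ _ => //.
  rewrite /GRing.scale/= hornerM hornerXn !hornerE/=.
  rewrite -!exprVn; ring.
- rewrite {2}/flat_derivs ltxx.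
  by have [C] := flat_derivs_quadratic n; exact: is_derive0_quadratic.
Unshelve. all: end_near. Qed.

Lemma smooth_flat : smooth_on setT flat.
Proof.
apply: (@smooth_family _ _ _ flat_derivs) => //; first exact: openT.
by move=> x _; rewrite /flat_derivs/= hornerC mul1r.
Qed.

Lemma flat_ge0 (x : R) : 0 <= flat x.
Proof. by rewrite /flat; case: ifP => // _; exact: expR_ge0. Qed.

Lemma flat_le1 (x : R) : flat x <= 1.
Proof.
by rewrite /flat; case: ifP => // x0; rewrite -expR0 ler_expR oppr_le0 invr_ge0 ltW.
Qed.

Lemma flat0 (x : R) : x <= 0 -> flat x = 0.
Proof. by rewrite /flat ltNge => ->. Qed.

Lemma cvg_flat (x : R) : 0 < x -> flat (n.+1%:R * x) @[n --> \oo] --> (1 : R).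
Proof.
move=> x0; rewrite -[X in _ --> X]expR0.
rewrite (_ : (fun n => _) = (fun n => expR (- (n.+1%:R^-1 * x^-1)))); last first.
  by apply/funext => n; rewrite /flat pmulr_rgt0// x0 invfM.
apply: (@continuous_cvg _ _ _ _ _ _ (@expR R)); first exact: continuous_expR.
rewrite -oppr0; apply: cvgN; rewrite -(mul0r x^-1); apply: cvgMl.
exact: cvg_harmonic.
Qed.

End Flat.

(** * Test functions on (a,b) *)

Section Test.
Context {R : realType} (a b : R).
Hypothesis ab : a < b.
Local Notation D := (`]a, b[%classic).
Implicit Types (phi psi : R -> R).

(** Trades the compact support for a segment [c, d] inside (a,b), the form in which supports are
    handled from here on. *)
Lemma test_functionP phi : test_function D phi <->
  smooth_on setT phi /\ exists c d, [/\ a < c, c < d, d < b &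
    forall x, phi x != 0 -> c <= x <= d].
Proof.
set S := [set x | phi x != 0]; split.
- move=> [sphi cS SD]; split => //.
  have SD' x : S x -> closure S x by exact: subset_closure.
  have [S0|/set0P S0] := eqVneq (closure S) set0.
    (* The support is empty here, so any segment inside (a,b) serves. *)
    have ab' := ab; exists (a + (b - a) / 3), (a + (b - a) / 3 * 2); split; [lra|lra|lra|].
    by move=> x Sx; have := SD' x Sx; rewrite S0.
  have cid : {within closure S, continuous (@id R)} by apply: continuous_subspaceT => x; exact: cvg_id.
  have [c /set_mem cS1 cm] := @compact_EVT_min _ R _ _ S0 cS cid.
  have [d /set_mem dS1 dM] := @compact_EVT_max _ R _ _ S0 cS cid.
  have := SD _ cS1; have := SD _ dS1; rewrite /= !in_itv/= => /andP[ad db] /andP[ac cb].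
  (* Only c <= d is known for the extreme points of the support; moving d halfway to b makes the
     inequality strict. *)
  exists c, ((d + b) / 2); have cd : c <= d by apply: cm; apply/mem_set.
  split => //; [lra|lra|].
  move=> x Sx; rewrite cm ?inE; last exact: SD'.
  have : x <= d by apply: dM; apply/mem_set; exact: SD'.
  by move=> xd /=; lra.
- move=> [sphi [c [d [ac cd db Scd]]]].
  have cl : closure S `<=` `[c, d]%classic.
    have <- : closure `[c, d]%classic = `[c, d]%classic.
      by apply/esym/closure_id; exact: itv_closed.
    by apply: closure_subset => x Sx; rewrite /= in_itv/=; exact: Scd.
  split => //.
  - apply: (subclosed_compact _ (@segment_compact _ c d) cl).
    exact: closed_closure.
  - move=> x /cl; rewrite /= !in_itv/= => /andP[cx xd].
    by rewrite (lt_le_trans ac cx) (le_lt_trans xd db).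
Qed.

Lemma test_smooth phi : test_function D phi -> smooth_on setT phi.
Proof. by case. Qed.

Lemma test0 phi x : test_function D phi -> ~~ (a < x < b) -> phi x = 0.
Proof.
move=> /test_functionP[_ [c [d [ac cd db Scd]]]] xab; apply/eqP.
by apply: contraNT xab => /Scd /andP[cx xd]; rewrite (lt_le_trans ac cx) (le_lt_trans xd db).
Qed.

Lemma testD phi psi : test_function D phi -> test_function D psi ->
  test_function D (phi \+ psi).
Proof.
move=> /test_functionP[sf [c [d [ac cd db Scd]]]].
move=> /test_functionP[sg [c' [d' [ac' cd' db' Scd']]]].
apply/test_functionP; split; first by apply: smoothD => //; exact: openT.
exists (Num.min c c'), (Num.max d d'); split.
- by rewrite lt_min ac ac'.
- by rewrite gt_min !lt_max cd.
- by rewrite gt_max db db'.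
- move=> x /=; rewrite ge_min le_max; have [->|/Scd/andP[-> ->]//] := eqVneq (phi x) 0.
  by rewrite add0r => /Scd'/andP[-> ->]; rewrite !orbT.
Qed.

Lemma testZ (c : R) phi : test_function D phi -> test_function D (fun x => c * phi x).
Proof.
move=> /test_functionP[sf [c' [d [ac cd db Scd]]]].
apply/test_functionP; split; first by apply: smoothZ => //; exact: openT.
exists c', d; split => // x; rewrite mulf_eq0 negb_or => /andP[_]; exact: Scd.
Qed.

Lemma test_derive1n n phi : test_function D phi -> test_function D (derive1n n phi).
Proof.
move=> /test_functionP[sf [c' [d [ac cd db Scd]]]].
apply/test_functionP; split; first exact: smooth_derive1n.
exists c', d; split => //.
elim: n => // n IH x; apply: contraNT; rewrite negb_and -!ltNge => xcd; apply/eqP.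
rewrite derive1nS derive1E.
have -> : 'D_1 (derive1n n phi) x = 'D_1 (cst 0 : R -> R) x; last by rewrite derive_cst.
apply: (@near_eq_derive _ R R).
case/orP: xcd => xcd; near=> y; apply/eqP/negP => /negP/IH;
    apply/negP; rewrite negb_and -!ltNge; apply/orP; [left|right].
  by near: y; exact: lt_nbhsl.
by near: y; exact: lt_nbhsr.
Unshelve. all: end_near. Qed.

Lemma test_bounded phi : test_function D phi ->
  exists2 M, 0 <= M & forall x, `|phi x| <= M.
Proof.
move=> /test_functionP[sf [c [d [ac cd db Scd]]]].
have cf : {within `[c, d], continuous (fun x => `|phi x|)}.
  apply: continuous_subspaceT => x; apply: continuous_comp.
    exact: smooth_continuous.
  exact: norm_continuous.
have [e _ eM] := EVT_max (ltW cd) cf.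
exists `|phi e| => // x; have [->|/Scd xcd] := eqVneq (phi x) 0; first by rewrite normr0.
by apply: eM; rewrite in_itv.
Qed.

(** Test functions with values in [0,1] that tend pointwise to the indicator of ]c, d[: they turn
    orthogonality to test functions into vanishing integrals over intervals. *)
Definition plateau (c d : R) (n : nat) (x : R) : R :=
  flat (n.+1%:R * (x - c)) * flat (n.+1%:R * (d - x)).

Lemma test_plateau c d n : a < c -> c < d -> d < b -> test_function D (plateau c d n).
Proof.
move=> ac cd db; apply/test_functionP; split.
  have -> : plateau c d n = (fun x => flat (n.+1%:R * x + - (n.+1%:R * c))) \*
     (fun x => flat (- n.+1%:R * x + n.+1%:R * d)).
    by apply/funext => x; rewrite /plateau /=; congr (flat _ * flat _); ring.
  by apply: smoothM; apply: smooth_affine; exact: smooth_flat.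
exists c, d; split => // x; apply: contraNT; rewrite negb_and -!ltNge => /orP[xc|dx].
  by rewrite /plateau flat0 ?mul0r// pmulr_rle0// subr_le0 ltW.
by rewrite /plateau (@flat0 _ (_ * (d - x))) ?mulr0// pmulr_rle0// subr_le0 ltW.
Qed.

Lemma plateau_ge0 c d n x : 0 <= plateau c d n x.
Proof. by rewrite mulr_ge0// flat_ge0. Qed.

Lemma plateau_le1 c d n x : `|plateau c d n x| <= 1.
Proof. by rewrite ger0_norm ?plateau_ge0// mulr_ile1// ?flat_ge0// flat_le1. Qed.

Lemma cvg_plateau c d x : plateau c d n x @[n --> \oo] --> (\1_(`]c, d[%classic) x : R).
Proof.
rewrite indicE; have [|] := boolP (x \in `]c, d[%classic).
  rewrite inE/= in_itv/= => /andP[cx xd] /=.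
  rewrite -[1%:R]mulr1; apply: cvgM; apply: cvg_flat; by rewrite subr_gt0.
rewrite notin_setE/= in_itv/= => /negP; rewrite negb_and -!leNgt => xcd.
rewrite (_ : (fun n => _) = cst 0); first exact: cvg_cst.
apply/funext => n; rewrite /plateau; case/orP: xcd => xcd.
  by rewrite flat0 ?mul0r// pmulr_rle0// subr_le0.
by rewrite (@flat0 _ (_ * (d - x))) ?mulr0// pmulr_rle0// subr_le0.
Qed.

End Test.

(** * Affine change of variables for the Lebesgue measure *)

Section Substitution.
Context {R : realType}.
Notation mu := (@lebesgue_measure R).

Let affine (r c : R) (t : R) : measurableTypeR R := r * t + c.

Let measurable_affine r c : measurable_fun setT (affine r c).
Proof. by apply: measurable_funD => //; apply: measurable_funM. Qed.

Let image_affine r c : {measure set (measurableTypeR R) -> \bar R} :=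
  @measure_function_pushforward__canonical__measure_function_Measure _ _ _ _ _ mu _ (measurable_affine r c).

Let scaled_image r c : {measure set (measurableTypeR R) -> \bar R} :=
  mscale (NngNum (normr_ge0 r)) (image_affine r c).

(** By uniqueness of the Lebesgue measure it suffices to compare on half-open intervals. A negative
    [r] swaps the closed and the open end, which does not change the length. *)
Let measure_affine (r c : R) (r0 : r != 0) (A : set R) : measurable A ->
  mu A = scaled_image r c A.
Proof.
move=> mA; apply: lebesgue_measure_unique => //= _ [[a b]] _ <-.
rewrite /mscale/= /pushforward.
have [r_lt0|r_gt0|/eqP] := ltgtP r 0; last by rewrite (negbTE r0).
- rewrite (_ : affine r c @^-1` _ = `[(b - c) / r, (a - c) / r[%classic); last first.
    by apply/seteqP; split => x; rewrite /affine/= !in_itv/= ltr_ndivlMr// ler_ndivrMr//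
      => /andP[? ?]; apply/andP; split; lra.
  rewrite !lebesgue_measure_itv/= !lte_fin ltr_nM2r ?invr_lt0// ltrD2r.
  case: ifPn => ab; last by rewrite mule0.
  rewrite -EFinB -EFinD -EFinM; congr EFin.
  by rewrite ltr0_norm//; field.
- rewrite (_ : affine r c @^-1` _ = `](a - c) / r, (b - c) / r]%classic); last first.
    by apply/seteqP; split => x; rewrite /affine/= !in_itv/= ler_pdivlMr// ltr_pdivrMr//
      => /andP[? ?]; apply/andP; split; lra.
  rewrite !lebesgue_measure_itv/= !lte_fin ltr_pM2r ?invr_gt0// ltrD2r.
  case: ifPn => ab; last by rewrite mule0.
  rewrite -EFinB -EFinD -EFinM; congr EFin.
  by rewrite gtr0_norm//; field.
Qed.

Lemma ge0_integral_affine (r c : R) (f : R -> \bar R) : r != 0 ->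
  measurable_fun setT f -> (forall x, (0 <= f x)%E) ->
  (\int[mu]_x f x = `|r|%:E * \int[mu]_x f (r * x + c)%R)%E.
Proof.
move=> r0 mf f0.
transitivity (\int[scaled_image r c]_x f x)%E.
  by apply: eq_measure_integral => A mA _; exact: measure_affine.
rewrite ge0_integral_mscale//=.
by rewrite ge0_integral_pushforward//=; exact: measurable_affine.
Qed.

Lemma integral_unit_affine (r c : R) (f : R -> \bar R) : `|r| = 1 ->
  measurable_fun setT f ->
  (\int[mu]_x f x = \int[mu]_x f (r * x + c)%R)%E.
Proof.
move=> r1 mf; have r0 : r != 0 by rewrite -normr_eq0 r1 oner_eq0.
rewrite integralE [RHS]integralE; congr (_ - _)%E.
  rewrite (@ge0_integral_affine r c (f^\+)%E)//; last exact: measurable_funepos.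
  by rewrite r1 mul1e; apply: eq_integral => x _; rewrite !funeposE.
rewrite (@ge0_integral_affine r c (f^\-)%E)//; last exact: measurable_funeneg.
by rewrite r1 mul1e; apply: eq_integral => x _; rewrite !funenegE.
Qed.

Lemma Rintegral_unit_affine (r c : R) (f : R -> R) : `|r| = 1 ->
  measurable_fun setT f ->
  \int[mu]_x f x = \int[mu]_x f (r * x + c)%R.
Proof.
move=> r1 mf; rewrite /Rintegral (@integral_unit_affine r c)//.
exact/measurable_EFinP.
Qed.

End Substitution.

(** * Truncated powers and the beta integral *)

Section PowerKernel.
Context {R : realType}.
Notation mu := (@lebesgue_measure R).
Implicit Types (tau t L p q r : R).

(** The truncated power that is the kernel of the fractional integral of order [tau], without the
    factor 1/Gamma(tau). *)
Definition pk tau t : R := if 0 < t then t `^ (tau - 1) else 0.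

Lemma pk_ge0 tau t : 0 <= pk tau t.
Proof. by rewrite /pk; case: ifP => // _; exact: powR_ge0. Qed.

Lemma pk0 tau t : t <= 0 -> pk tau t = 0.
Proof. by rewrite /pk ltNge => ->. Qed.

Lemma pk1 t : pk 1 t = if 0 < t then 1 else 0.
Proof. by rewrite /pk subrr powRr0. Qed.

Lemma pkM tau z t : 0 < z -> pk tau (z * t) = z `^ (tau - 1) * pk tau t.
Proof.
by move=> z0; rewrite /pk pmulr_rgt0//; case: ifPn => t0; rewrite ?mulr0// powRM// ltW.
Qed.

Lemma measurable_pk tau : measurable_fun setT (pk tau).
Proof.
apply: measurable_fun_ifT => //.
exact: measurable_fun_ltr.
Qed.

Lemma measurable_patch_lt L (f : R -> R) : measurable_fun setT f ->
  measurable_fun setT (fun t => if t < L then f t else 0).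
Proof. by move=> mf; apply: measurable_fun_ifT => //; exact: measurable_fun_ltr. Qed.

(** Monotone convergence along the intervals [1/(n+2), 1[, away from the singularity, where t^tau /
    tau is a regular primitive. *)
Let integral_pk1 tau : 0 < tau ->
  (\int[mu]_(t in `]0%R, 1%R[) (t `^ (tau - 1))%:E <= (tau^-1)%:E)%E.
Proof.
move=> tau0.
pose F (n : nat) := `[n.+2%:R^-1, 1[%classic : set R.
have -> : `]0, 1[%classic = \bigcup_n F n.
  apply/seteqP; split => [x|x [n _]]; rewrite /F/= !in_itv/=; last first.
    by move=> /andP[nx ->]; rewrite andbT (lt_le_trans _ nx)// invr_gt0.
  move=> /andP[x0 x1]; exists (Num.truncn x^-1) => //=; rewrite in_itv/= x1 andbT.
  rewrite invf_ple ?posrE// ltW//; apply: (lt_trans (truncnS_gt _)).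
  by rewrite ltr_nat.
have mp i : measurable_fun (F i) (fun t => (t `^ (tau - 1))%:E).
  by apply/measurable_EFinP; apply: measurable_funTS; exact: measurable_powR.
have ndF : nondecreasing_seq F.
  apply/nondecreasing_seqP => n; rewrite subsetEset => x; rewrite /F/= !in_itv/= => /andP[nx ->].
  by rewrite andbT (le_trans _ nx)// lef_pV2 ?posrE// ler_nat.
have cv : (\int[mu]_(t in F i) (t `^ (tau - 1))%:E @[i --> \oo] -->
    \int[mu]_(t in \bigcup_i F i) (t `^ (tau - 1))%:E)%E.
  apply: ge0_nondecreasing_set_cvg_integral => //.
    by move=> n; exact: measurable_itv.
  by move=> n t _; rewrite lee_fin powR_ge0.
rewrite -(cvg_lim _ cv)//; apply: lime_le; first exact: cvgP cv.
apply: nearW => n; rewrite /F integral_itv_bndo_bndc; last exact: mp.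
have e1 : n.+2%:R^-1 < 1 :> R by rewrite invf_lt1// ltr1n.
have e0 : 0 < n.+2%:R^-1 :> R by rewrite invr_gt0.
have dF (x : R) : 0 < x -> is_derive x 1 (fun t : R => tau^-1 * t `^ tau) (x `^ (tau - 1)).
  move=> x0; apply: eq_is_derive (@is_deriveZ R R R (fun t : R => t `^ tau) tau^-1 x 1 _ (is_derive1_powR tau x0)) _ _ => //.
  by rewrite /GRing.scale/= mulrA mulVf ?mul1r// gt_eqF.
have cF (x : R) : 0 < x -> {for x, continuous (fun t : R => tau^-1 * t `^ tau)}.
  move=> x0; apply: differentiable_continuous; apply/derivable1_diffP.
  by have [] := dF x x0.
rewrite (@continuous_FTC2 _ _ (fun t : R => tau^-1 * t `^ tau))//.
- by rewrite -EFinB lee_fin powR1 mulr1 gerBl// mulr_ge0// ?powR_ge0// invr_ge0 ltW.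
- apply: continuous_in_subspaceT => x; rewrite inE/= in_itv/= => /andP[ex _].
  have x0 := lt_le_trans e0 ex.
  apply: differentiable_continuous; apply/derivable1_diffP.
  by have [] := is_derive1_powR (tau - 1) x0.
- split.
  + move=> x; rewrite in_itv/= => /andP[ex _]; have x0 := lt_trans e0 ex.
    by have [] := dF x x0.
  + by apply: cvg_at_right_filter; exact: cF.
  + by apply: cvg_at_left_filter; exact: cF.
- move=> x; rewrite in_itv/= => /andP[ex _]; have x0 := lt_trans e0 ex.
  by rewrite derive1E; have [_ ->] := dF x x0.
Qed.

Lemma integral_pk_fin tau L : 0 < tau -> 0 < L ->
  (\int[mu]_t (if t < L then pk tau t else 0)%:E < +oo)%E.
Proof.
move=> tau0 L0.
have mf l : measurable_fun setT (fun t => (if t < l then pk tau t else 0)%:E).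
  by apply/measurable_EFinP; apply: measurable_patch_lt; exact: measurable_pk.
have f0 l x : (0 <= (if x < l then pk tau x else 0)%:E :> \bar R)%E.
  by rewrite lee_fin; case: ifP => // _; exact: pk_ge0.
rewrite (@ge0_integral_affine _ L 0)//; last by rewrite gt_eqF.
apply: lte_mul_pinfty => //.
rewrite (_ : \int[mu]_x _ = (L `^ (tau - 1))%:E * \int[mu]_t (if t < 1 then pk tau t else 0)%:E)%E; last first.
  rewrite -ge0_integralZl//; [|exact: mf|by rewrite lee_fin powR_ge0].
  apply: eq_integral => x _; rewrite addr0 gtr_pMr// pkM// -EFinM.
  by case: ifP => // _; rewrite mulr0.
apply: lte_mul_pinfty => //; first by rewrite lee_fin powR_ge0.
apply: le_lt_trans (ltry tau^-1); apply: le_trans (integral_pk1 tau0).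
rewrite [leRHS]integral_mkcond/= le_eqVlt; apply/orP; left; apply/eqP/eq_integral => x _; rewrite patchE /pk.
rewrite mem_setE in_itv/= andbC; case: (x < 1) => //=; by case: (0 < x).
Qed.

(* Euler's beta integral, in its scale-invariant form below *)
Definition betaI tau1 tau2 : \bar R := (\int[mu]_s (pk tau1 (1 - s) * pk tau2 s)%:E)%E.

Lemma measurable_pkB tau1 tau2 (z : R) :
  measurable_fun setT (fun s : R => pk tau1 (z - s) * pk tau2 s).
Proof.
apply: measurable_funM; last exact: measurable_pk.
by apply: measurableT_comp; [exact: measurable_pk|exact: measurable_funB].
Qed.

(** The substitution s -> z s pulls all powers of z out of the integral; for z <= 0 both sides
    vanish. This is the semigroup law of fractional integrals, at the level of kernels. *)
Lemma integral_pkB tau1 tau2 (z : R) :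
  (\int[mu]_s (pk tau1 (z - s) * pk tau2 s)%:E =
   (pk (tau1 + tau2) z)%:E * betaI tau1 tau2)%E.
Proof.
have mf (z' : R) : measurable_fun setT (fun s : R => (pk tau1 (z' - s) * pk tau2 s)%:E).
  by apply/measurable_EFinP; exact: measurable_pkB.
have f0 (z' s : R) : (0 <= (pk tau1 (z' - s) * pk tau2 s)%:E)%E.
  by rewrite lee_fin mulr_ge0// pk_ge0.
have [z0|z0] := leP z 0.
  rewrite (@pk0 _ z)// mul0e integral0_eq// => s _.
  have [s0|s0] := leP s 0; first by rewrite (@pk0 _ s)// mulr0.
  by rewrite (@pk0 _ (z - s)) ?mul0r// subr_le0 (le_trans z0)// ltW.
have z0' : z != 0 by rewrite gt_eqF.
apply: (etrans (ge0_integral_affine 0 z0' (mf z) (f0 z))).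
rewrite (gtr0_norm z0) /betaI.
under eq_integral => s _.
  have -> : (pk tau1 (z - (z * s + 0)) * pk tau2 (z * s + 0))%:E =
    ((z `^ (tau1 - 1) * z `^ (tau2 - 1))%:E * (pk tau1 (1 - s) * pk tau2 s)%:E)%E.
    rewrite addr0 -[X in X - _]mulr1 -mulrBr !pkM// -EFinM; congr EFin; ring.
  over.
rewrite ge0_integralZl//; [|exact: mf|by rewrite lee_fin mulr_ge0// powR_ge0].
rewrite muleA -EFinM; congr (_%:E * _)%E.
have zD r1 r2 : z `^ (r1 + r2) = z `^ r1 * z `^ r2 by rewrite powRD// (gt_eqF z0) implybT.
rewrite /pk z0 -{1}(powRr1 (ltW z0)) -!zD.
by congr powR; ring.
Qed.

(** The two singularities are separated at 1/2: on either half, the factor that is regular there is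
    at most 2, and the other one is integrable. *)
Lemma betaI_fin tau1 tau2 : 0 < tau1 -> 0 < tau2 -> (betaI tau1 tau2 < +oo)%E.
Proof.
move=> t1 t2.
have half (tau s : R) : 0 < tau -> 2^-1 <= s -> s <= 1 -> s `^ (tau - 1) <= 2.
  move=> t0 s1 s2; have s0 : 0 < s by lra.
  have [t1'|t1'] := leP 1 tau.
    apply: (@le_trans _ _ 1); last lra.
    by rewrite -[leRHS](powRr0 s) ger_powR ?s0//; lra.
  apply: (@le_trans _ _ (s `^ (-1))).
    by rewrite ger_powR ?s0//; lra.
  by rewrite (powR_inv1 (ltW s0)) invf_ple// posrE.
pose g (tau s : R) : R := if s < 1 then pk tau s else 0.
have g0 (tau s : R) : 0 <= g tau s by rewrite /g; case: ifP => // _; exact: pk_ge0.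
have mg tau : measurable_fun setT (g tau) by apply: measurable_patch_lt; exact: measurable_pk.
have bnd (s : R) : pk tau1 (1 - s) * pk tau2 s <= 2 * g tau1 (1 - s) + 2 * g tau2 s.
  have rhs0 : 0 <= 2 * g tau1 (1 - s) + 2 * g tau2 s by rewrite addr_ge0// mulr_ge0.
  have [s0|s0] := leP s 0; first by rewrite (@pk0 _ s)// mulr0.
  have [s1|s1] := leP 1 s; first by rewrite (@pk0 _ (1 - s)) ?subr_le0// mul0r.
  have u0 : 0 < 1 - s by rewrite subr_gt0.
  have u1 : 1 - s < 1 by rewrite gtrBl.
  rewrite /g s1 u1 /pk s0 u0.
  have p1 := powR_ge0 (1 - s) (tau1 - 1); have p2 := powR_ge0 s (tau2 - 1).
  have [sh|sh] := leP (2^-1) s.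
    have h2 := half _ _ t2 sh (ltW s1); rewrite -[leLHS]addr0; apply: lerD.
      by rewrite mulrC ler_wpM2r.
    by rewrite mulr_ge0.
  have h1 : (1 - s) `^ (tau1 - 1) <= 2 by apply: half => //; lra.
  rewrite -[leLHS]add0r; apply: lerD; first by rewrite mulr_ge0.
  by rewrite ler_wpM2r.
have mB : measurable_fun setT (fun s : R => (2 * g tau1 (1 - s))%:E).
  apply/measurable_EFinP; apply: measurable_funM => //.
  by apply: measurableT_comp; [exact: mg|exact: measurable_funB].
have mA : measurable_fun setT (fun s : R => (2 * g tau2 s)%:E).
  by apply/measurable_EFinP; apply: measurable_funM => //; exact: mg.
apply: (@le_lt_trans _ _ (\int[mu]_s ((2 * g tau1 (1 - s))%:E + (2 * g tau2 s)%:E))%E).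
  apply: ge0_le_integral => //.
  - by move=> s _; rewrite lee_fin mulr_ge0// pk_ge0.
  - by apply/measurable_EFinP; exact: measurable_pkB.
  - by apply: emeasurable_funD.
  - by move=> s _; rewrite -EFinD lee_fin.
rewrite ge0_integralD//; last 2 first.
- by move=> s _; rewrite lee_fin mulr_ge0.
- by move=> s _; rewrite lee_fin mulr_ge0.
have fin tau : 0 < tau -> (\int[mu]_s (2 * g tau s)%:E < +oo)%E.
  move=> t0; under eq_integral do rewrite EFinM.
  rewrite ge0_integralZl//; [|by apply/measurable_EFinP; exact: mg|by move=> s _; rewrite lee_fin].
  by apply: lte_mul_pinfty => //; exact: integral_pk_fin.
apply: lte_add_pinfty; last exact: fin.
rewrite (_ : (\int[mu]_s _)%E = \int[mu]_s (2 * g tau1 s)%:E)%E; first exact: fin.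
have mg2 : measurable_fun setT (fun s => (2 * g tau1 s)%:E).
  by apply/measurable_EFinP; apply: measurable_funM => //; exact: mg.
apply: (etrans _ (esym (integral_unit_affine 1 (normrN1 R) mg2))).
by apply: eq_integral => s _; rewrite mulN1r addrC.
Qed.

(** Nonpositive exponents make both factors at least 1 on (0,1). This is what allows division by the
    beta constant in Abel's inversion. *)
Lemma betaI_gt0 tau1 tau2 : tau1 <= 1 -> tau2 <= 1 -> (0 < betaI tau1 tau2)%E.
Proof.
move=> t1 t2; apply: (@lt_le_trans _ _ (\int[mu]_(s in `]0%R, 1%R[) 1)%E).
  by rewrite integral_cst//= mul1e lebesgue_measure_itv/= lte_fin ltr01 sube0 lte_fin.
rewrite integral_mkcond; apply: ge0_le_integral => //.
- by move=> s _; rewrite patchE; case: ifP.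
- by apply/(measurable_restrictT _ _).1.
- by apply/measurable_EFinP; exact: measurable_pkB.
- move=> s _; rewrite patchE mem_setE in_itv/=; case: ifPn => [/andP[s0 s1]|_]; last first.
    by rewrite lee_fin mulr_ge0// pk_ge0.
  rewrite lee_fin /pk s0 subr_gt0 s1 -[leLHS]mul1r; apply: ler_pM => //.
    by rewrite -[leLHS](powRr0 (1 - s)) ger_powR ?subr_gt0 ?s1 ?gerBl ?(ltW s0) ?subr_le0.
  by rewrite -[leLHS](powRr0 s) ger_powR ?s0 ?(ltW s1) ?subr_le0.
Qed.

End PowerKernel.

(** * Fubini's theorem for real-valued integrals *)

Section RFubini.
Context {R : realType}.
Notation T := (measurableTypeR R).
Notation mu := (@lebesgue_measure R : {sigma_finite_measure set T -> \bar R}).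
Implicit Type F : T * T -> R.

(** An integrable extended-valued function is finite almost everywhere, so [fine] changes it on a
    null set only. *)
Let integral_fine (G : T -> \bar R) : mu.-integrable setT G ->
  mu.-integrable setT (EFin \o fine \o G) /\
  (\int[mu]_x ((EFin \o fine \o G) x) = \int[mu]_x G x)%E.
Proof.
move=> iG; have mG := measurable_int mu iG.
have mfG : measurable_fun setT (EFin \o fine \o G).
  by apply/measurable_EFinP; apply: measurableT_comp => //; exact: fine_measurable.
split.
  apply: (le_integrable _ mfG _ iG) => // x _ /=.
  by case: (G x) => [r||] //=; rewrite normr0 leey.
apply: ae_eq_integral => //.
have := integrable_ae measurableT iG.
by apply: filterS => x /(_ I) fGx _ /=; rewrite fineK.
Qed.

Lemma integrable_swap F : (mu \x mu)%E.-integrable setT (EFin \o F) ->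
  (mu \x mu)%E.-integrable setT (EFin \o (fun z => F (z.2, z.1))).
Proof.
move=> iF; have mF := measurable_int (mu \x mu)%E iF.
apply/integrable12ltyP.
  apply/measurable_EFinP; apply: measurableT_comp; last exact: measurable_swap.
  exact/measurable_EFinP.
exact: ((integrable21ltyP _ _ mF).1 iF).
Qed.

Lemma integrable_Rfubini1 F : (mu \x mu)%E.-integrable setT (EFin \o F) ->
  mu.-integrable setT (EFin \o (fun x => \int[mu]_y F (x, y))).
Proof. by move=> iF; have [] := integral_fine (integrable_fubini_F iF). Qed.

Lemma Rfubini F : (mu \x mu)%E.-integrable setT (EFin \o F) ->
  \int[mu]_x \int[mu]_y F (x, y) = \int[mu]_y \int[mu]_x F (x, y).
Proof.
move=> iF; rewrite /Rintegral; congr fine.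
have [_] := integral_fine (integrable_fubini_F iF).
have [_] := integral_fine (integrable_fubini_F (integrable_swap iF)).
by rewrite /fubini_F/= => -> ->; exact: (Fubini (f := EFin \o F)).
Qed.

End RFubini.

Lemma ae_eq_Rintegral {R : realType} d (T : measurableType d) (mu : {measure set T -> \bar R})
    (D : set T) (f g : T -> R) : measurable D ->
  measurable_fun D f -> measurable_fun D g ->
  {ae mu, forall x, D x -> f x = g x} ->
  \int[mu]_(x in D) f x = \int[mu]_(x in D) g x.
Proof.
move=> mD mf mg fg; congr fine; apply: ae_eq_integral => //; first exact/measurable_EFinP.
  exact/measurable_EFinP.
by apply: filterS fg => x /[apply] ->.
Qed.

(** * Integral operators under Schur's condition *)

Section Schur.
Context {R : realType}.
Notation T := (measurableTypeR R).
Notation mu := (@lebesgue_measure R : {sigma_finite_measure set T -> \bar R}).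
Implicit Types (k : T -> T -> R) (f g : T -> R).

Definition kop k f : T -> R := fun x => \int[mu]_y (k x y * f y).

Definition schur k (C : R) := [/\ measurable_fun setT (fun z : T * T => k z.1 z.2),
  (forall x y, 0 <= k x y),
  (forall x, (\int[mu]_y (k x y)%:E <= C%:E)%E) &
  (forall y, (\int[mu]_x (k x y)%:E <= C%:E)%E)].

Lemma schurC k C : schur k C -> schur (fun x y => k y x) C.
Proof.
case=> mk k0 k1 k2; split => //.
exact: (measurableT_comp mk (@measurable_swap _ _ _ _)).
Qed.

Variables (k : T -> T -> R) (C : R).
Hypothesis kC : schur k C.

Let mk : measurable_fun setT (fun z : T * T => k z.1 z.2). Proof. by case: kC. Qed.
Let k0 x y : 0 <= k x y. Proof. by case: kC. Qed.

Lemma measurable_kernel1 x : measurable_fun setT (k x).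
Proof. exact: (measurable_fun_pair2 x mk). Qed.

Lemma schur_ge0 : 0 <= C.
Proof.
case: kC => _ _ /(_ 0) + _; rewrite -lee_fin; apply: le_trans.
by apply: integral_ge0 => y _; rewrite lee_fin.
Qed.

(** Tonelli, integrating in x first: the bound on [g] and the column mass leave at most M C times
    the L^1 norm of [f]. It licenses the use of Fubini in [kop_transpose]. *)
Lemma integrable_kernel f g : mu.-integrable setT (EFin \o f) ->
  measurable_fun setT g -> (exists M, forall x, `|g x| <= M) ->
  (mu \x mu)%E.-integrable setT (EFin \o (fun z => g z.1 * (k z.1 z.2 * f z.2))).
Proof.
move=> jf mg [M gM].
have mf : measurable_fun setT f by have /measurable_EFinP := measurable_int mu jf.
have mgk : measurable_fun setT (fun z : T * T => g z.1 * (k z.1 z.2 * f z.2)).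
  apply: measurable_funM; first exact: (measurableT_comp mg measurable_fst).
  by apply: measurable_funM => //; exact: (measurableT_comp mf measurable_snd).
have M0 : 0 <= M by exact: le_trans (gM 0).
apply/integrable21ltyP; first exact/measurable_EFinP.
have mkf : measurable_fun setT (fun z : T * T => M * (k z.1 z.2 * `|f z.2|)).
  apply: measurable_funM => //; apply: measurable_funM => //.
  by apply: measurableT_comp => //; exact: (measurableT_comp mf measurable_snd).
apply: (@le_lt_trans _ _ (\int[mu]_y ((M * C)%:E * `|f y|%:E))%E).
  have mgkf : measurable_fun setT (fun z : T * T => `|g z.1 * (k z.1 z.2 * f z.2)|%:E).
    by apply/measurable_EFinP; exact: measurableT_comp.
  apply: ge0_le_integral => //.
  - by move=> y _; exact: integral_ge0.
  - exact: (measurable_fun_fubini_tonelli_G _ mgkf).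
  - apply: emeasurable_funM => //; apply/measurable_EFinP; exact: measurableT_comp.
  - move=> y _; apply: (@le_trans _ _ (\int[mu]_x ((M * `|f y|)%:E * (k x y)%:E))%E).
      have mky : measurable_fun setT (k ^~ y) := measurable_fun_pair1 y mk.
      apply: ge0_le_integral => //.
      + exact: (measurable_fun_pair1 y mgkf).
      + by apply: emeasurable_funM => //; exact/measurable_EFinP.
      + by move=> x _; rewrite /= -EFinM lee_fin !normrM (ger0_norm (k0 _ _)) mulrA
          mulrAC ler_wpM2r// ler_wpM2r.
    have mky : measurable_fun setT (k ^~ y) := measurable_fun_pair1 y mk.
    rewrite ge0_integralZl//; [|exact/measurable_EFinP|by move=> x _; rewrite lee_fin|by rewrite lee_fin mulr_ge0].
    case: kC => _ _ _ /(_ y) H; rewrite -EFinM (mulrAC M) [leRHS]EFinM.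
    by apply: lee_wpmul2l => //; rewrite lee_fin mulr_ge0.
rewrite ge0_integralZl//; last 2 first.
- by apply/measurable_EFinP; exact: measurableT_comp.
- by rewrite lee_fin mulr_ge0// schur_ge0.
apply: lte_mul_pinfty => //.
  by rewrite lee_fin mulr_ge0// schur_ge0.
by have /integrableP[_] := jf.
Qed.

Lemma integrable_kop f : mu.-integrable setT (EFin \o f) ->
  mu.-integrable setT (EFin \o kop k f).
Proof.
move=> jf.
have := @integrable_kernel f (cst 1) jf (measurable_cst _) (ex_intro _ 1 _).
have H (x : R) : `|cst 1 x : R| <= 1 by rewrite normr1.
move=> /(_ H)/integrable_Rfubini1; apply: eq_integrable => // x _ /=.
by congr EFin; apply: eq_Rintegral => y _; rewrite mul1r.
Qed.

Lemma ae_integrable_kop f : mu.-integrable setT (EFin \o f) ->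
  {ae mu, forall x, mu.-integrable setT (EFin \o (fun y => k x y * f y))}.
Proof.
move=> jf.
have := @integrable_kernel f (cst 1) jf (measurable_cst _) (ex_intro _ 1 _).
have H (x : R) : `|cst 1 x : R| <= 1 by rewrite normr1.
move=> /(_ H)/ae_integrable1; apply: filterS => x.
by apply: eq_integrable => // y _ /=; rewrite mul1r.
Qed.

Lemma integrable_kernel_bounded g x : measurable_fun setT g ->
  (exists M, forall x, `|g x| <= M) ->
  mu.-integrable setT (EFin \o (fun y => k x y * g y)).
Proof.
move=> mg [M gM].
have ik : mu.-integrable setT (EFin \o k x).
  apply/integrableP; split; first by apply/measurable_EFinP; exact: measurable_kernel1.
  under eq_integral do rewrite /= ger0_norm//.
  by case: kC => _ _ /(_ x) H _; exact: le_lt_trans H (ltry _).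
have ikM : mu.-integrable setT (EFin \o (fun y => M * k x y)).
  have := integrableZl measurableT M ik.
  by apply: eq_integrable => // y _ /=; rewrite EFinM.
apply: le_integrable ikM => //.
  by apply/measurable_EFinP; apply: measurable_funM => //; exact: measurable_kernel1.
move=> y _ /=; rewrite lee_fin normrM (ger0_norm (k0 _ _)) mulrC.
by apply: le_trans (ler_norm _); rewrite ler_wpM2r.
Qed.

Lemma kop_bounded g M x : measurable_fun setT g -> (forall x, `|g x| <= M) ->
  `|kop k g x| <= C * M.
Proof.
move=> mg gM; have M0 : 0 <= M by exact: le_trans (gM 0).
have mkx := measurable_kernel1 x.
have ikg := integrable_kernel_bounded x mg (ex_intro _ M gM).
rewrite -lee_fin /kop EFin_normr_Rintegral//.
apply: le_trans (le_abse_integral _ _ _) _ => //; first exact: measurable_int ikg.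
apply: (@le_trans _ _ (\int[mu]_y (M%:E * (k x y)%:E))%E).
  apply: ge0_le_integral => //.
  - by apply: measurableT_comp => //; exact: measurable_int ikg.
  - by apply: emeasurable_funM => //; exact/measurable_EFinP.
  - move=> y _; rewrite -EFinM lee_fin normrM (ger0_norm (k0 _ _)) mulrC.
    by rewrite ler_wpM2r.
rewrite ge0_integralZl//; [|exact/measurable_EFinP|by move=> y _; rewrite lee_fin].
by rewrite mulrC EFinM; case: kC => _ _ /(_ x) H _; apply: lee_wpmul2l.
Qed.

End Schur.

(** * Transposition, L^p bounds and composition of integral operators *)

Section SchurOps.
Context {R : realType}.
Notation T := (measurableTypeR R).
Notation mu := (@lebesgue_measure R : {sigma_finite_measure set T -> \bar R}).
Implicit Types (k : T -> T -> R) (f g : T -> R).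

Lemma kop_transpose k C f g : schur k C -> mu.-integrable setT (EFin \o f) ->
  measurable_fun setT g -> (exists M, forall x, `|g x| <= M) ->
  \int[mu]_x (g x * kop k f x) = \int[mu]_y (kop (fun x y => k y x) g y * f y).
Proof.
move=> kC jf mg gM.
have iF := integrable_kernel kC jf mg gM.
transitivity (\int[mu]_x \int[mu]_y (g x * (k x y * f y))).
  apply: ae_eq_Rintegral => //.
  - apply: measurable_funM => //.
    by have /measurable_EFinP := measurable_int mu (integrable_kop kC jf).
  - by have /measurable_EFinP := measurable_int mu (integrable_Rfubini1 iF).
  - apply: filterS (ae_integrable_kop kC jf) => x ikx _.
    by rewrite RintegralZl.
rewrite (Rfubini iF)/=; apply: eq_Rintegral => y _; rewrite /kop.
rewrite -RintegralZr//; last exact: (integrable_kernel_bounded (schurC kC) y mg gM).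
by apply: eq_Rintegral => x _; ring.
Qed.

(** Hoelder's inequality for the splitting k |f| = (k^(1/p) |f|) k^(1 - 1/p); the second factor
    contributes the row mass to the power p - 1. *)
Lemma kop_pow_le k C p f x : schur k C -> 1 <= p -> measurable_fun setT f ->
  ((`|kop k f x| `^ p)%:E <=
   (C `^ (p - 1))%:E * \int[mu]_y (k x y * `|f y| `^ p)%:E)%E.
Proof.
move=> kC p1 mf; have p0 : 0 < p by exact: lt_le_trans p1.
have mkx := measurable_kernel1 kC x.
have [_ k0 kx _] := kC.
pose A := (\int[mu]_y (k x y * `|f y|)%:E)%E.
have leA : (`|kop k f x|%:E <= A)%E.
  apply: (@le_trans _ _ (`| \int[mu]_y (k x y * f y)%:E |)%E).
    rewrite /kop /Rintegral; case: (\int[mu]_y _)%E => [r||] //=; by rewrite normr0 leey.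
  apply: le_trans (le_abse_integral _ _ _) _ => //.
    by apply/measurable_EFinP; exact: measurable_funM.
  rewrite /A le_eqVlt; apply/orP; left; apply/eqP; apply: eq_integral => y _ /=.
  by rewrite normrM ger0_norm.
have A0 : (0 <= A)%E by apply: integral_ge0 => y _; rewrite lee_fin mulr_ge0.
rewrite -poweR_EFin; apply: (@le_trans _ _ (A `^ p)%E).
  by apply: gt0_ler_poweR => //; rewrite ?(ltW p0)// in_itv/= leey andbT.
(* The case p = 1, where the conjugate exponent would be infinite, is immediate. *)
move: p1; rewrite le_eqVlt => /predU1P[<-|p1].
  rewrite subrr powRr0 mul1e poweRe1//.
  rewrite /A le_eqVlt; apply/orP; left; apply/eqP; apply: eq_integral => y _.
  by rewrite powRr1.
have q0 : 0 < 1 - p^-1 by rewrite subr_gt0 invf_lt1.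
have qp : (1 - p^-1) * p = p - 1 by rewrite mulrBl mul1r mulVf// gt_eqF.
have mphi : measurable_fun setT (fun y => k x y `^ p^-1 * `|f y|).
  apply: measurable_funM; last exact: measurableT_comp.
  exact: (measurableT_comp (measurable_powR _) mkx).
have mpsi : measurable_fun setT (fun y => k x y `^ (1 - p^-1)).
  exact: (measurableT_comp (measurable_powR _) mkx).
have q1 : p^-1 + (1 - p^-1)^-1^-1 = 1 by rewrite invrK subrKC.
have qV : 0 < (1 - p^-1)^-1 by rewrite invr_gt0.
have := hoelder mu mphi mpsi p0 qV q1.
rewrite Lnorm1 [X in (X <= _)%E -> _](_ : _ = A); last first.
  apply: eq_integral => y _ /=; congr EFin.
  rewrite ger0_norm ?mulr_ge0 ?powR_ge0// mulrAC -powRD ?subrKC ?oner_eq0//.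
  by rewrite powRr1.
move=> /(gt0_ler_poweR (ltW p0)) => H.
apply: le_trans (H _ _) _; rewrite ?in_itv/= ?A0 ?leey//.
  by rewrite andbT mule_ge0// Lnorm_ge0.
rewrite poweRM ?Lnorm_ge0// poweR_Lnorm ?gt_eqF// muleC.
rewrite [X in (_ * X <= _)%E](_ : _ = \int[mu]_y (k x y * `|f y| `^ p)%:E)%E; last first.
  apply: eq_integral => y _ /=; congr EFin.
  rewrite ger0_norm ?mulr_ge0 ?powR_ge0// powRM ?powR_ge0//.
  by rewrite -powRrM mulVf ?gt_eqF// powRr1.
apply: lee_wpmul2r.
  by apply: integral_ge0 => y _; rewrite lee_fin mulr_ge0// powR_ge0.
rewrite unlock -poweRrM invrK qp -poweR_EFin.
have p10 : 0 <= p - 1 by rewrite subr_ge0 ltW.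
apply: gt0_ler_poweR => //.
- by rewrite in_itv/= leey andbT integral_ge0// => y _; rewrite poweR_ge0.
- by rewrite in_itv/= leey andbT lee_fin (schur_ge0 kC).
rewrite [X in (X <= _)%E](_ : _ = \int[mu]_y (k x y)%:E)%E//.
apply: eq_integral => y _ /=; rewrite ger0_norm ?powR_ge0//.
by rewrite -powRrM mulfV ?gt_eqF// powRr1.
Qed.

(** Schur's test: integrating the pointwise bound and exchanging the integrals, the column mass
    supplies the factor that completes C^(p-1) to C^p. *)
Lemma kop_Lp k C p f : schur k C -> 1 <= p -> measurable_fun setT f ->
  mu.-integrable setT (EFin \o f) ->
  (\int[mu]_x (`|kop k f x| `^ p)%:E <= (C `^ p)%:E * \int[mu]_x (`|f x| `^ p)%:E)%E.
Proof.
move=> kC p1 mf jf; have p0 : 0 < p by exact: lt_le_trans p1.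
have [mk k0 _ ky] := kC; have C0 := schur_ge0 kC.
have mfp : measurable_fun setT (fun y => `|f y| `^ p).
  by apply: (measurableT_comp (measurable_powR _)); exact: measurableT_comp.
have mG : measurable_fun setT (fun z : T * T => (k z.1 z.2 * `|f z.2| `^ p)%:E).
  apply/measurable_EFinP; apply: measurable_funM => //.
  exact: (measurableT_comp mfp measurable_snd).
have G0 (z : T * T) : (0 <= (k z.1 z.2 * `|f z.2| `^ p)%:E)%E.
  by rewrite lee_fin mulr_ge0// powR_ge0.
apply: (@le_trans _ _ (\int[mu]_x ((C `^ (p - 1))%:E * \int[mu]_y (k x y * `|f y| `^ p)%:E))%E).
  apply: ge0_le_integral => //.
  - apply/measurable_EFinP; apply: (measurableT_comp (measurable_powR _)).
    apply: measurableT_comp => //.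
    by have /measurable_EFinP := measurable_int mu (integrable_kop kC jf).
  - by apply: emeasurable_funM => //; exact: (measurable_fun_fubini_tonelli_F _ mG).
  - by move=> x _; exact: kop_pow_le.
rewrite ge0_integralZl//; last 3 first.
- exact: (measurable_fun_fubini_tonelli_F _ mG).
- by move=> x _; apply: integral_ge0 => y _; exact: (G0 (x, y)).
- by rewrite lee_fin powR_ge0.
rewrite (fubini_tonelli _ mG G0)/=.
have -> : C `^ p = C `^ (p - 1) * C by rewrite mulrC mulr_powRB1.
rewrite EFinM -muleA.
apply: lee_wpmul2l; first by rewrite lee_fin powR_ge0.
rewrite -ge0_integralZl//; last exact/measurable_EFinP.
apply: ge0_le_integral => //.
- by move=> y _; apply: integral_ge0 => x _; exact: (G0 (x, y)).
- exact: (measurable_fun_fubini_tonelli_G _ mG).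
- by apply: emeasurable_funM => //; exact/measurable_EFinP.
- move=> y _; under eq_integral do rewrite mulrC EFinM.
  rewrite ge0_integralZl//; last 2 first.
  + by apply/measurable_EFinP; exact: (measurable_kernel1 (schurC kC) y).
  + by move=> x _; rewrite lee_fin.
  by rewrite muleC; apply: lee_wpmul2r => //; rewrite lee_fin powR_ge0.
Qed.

(** Fubini for the composed kernel. The bound on the row [k3 x] makes the double integral converge
    absolutely at this very x, so the identity holds at the point and not merely almost
    everywhere. *)
Lemma kop_comp k1 k2 k3 C1 C2 C3 B f x : schur k1 C1 -> schur k2 C2 -> schur k3 C3 ->
  0 <= B ->
  mu.-integrable setT (EFin \o f) ->
  (exists M, forall t, k3 x t <= M) ->
  (forall t, (\int[mu]_y (k1 x y * k2 y t)%:E = (B * k3 x t)%:E)%E) ->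
  kop k1 (kop k2 f) x = B * kop k3 f x.
Proof.
move=> k1C k2C k3C B0 jf [M k3M] k12.
have [mk1 k10 _ _] := k1C; have [mk2 k20 _ _] := k2C; have [mk3 k30 _ _] := k3C.
have M0 : 0 <= M by exact: le_trans (k3M 0).
have mf : measurable_fun setT f by have /measurable_EFinP := measurable_int mu jf.
have mk1x := measurable_kernel1 k1C x.
have mF : measurable_fun setT (fun z : T * T => k1 x z.1 * (k2 z.1 z.2 * f z.2)).
  apply: measurable_funM; first exact: (measurableT_comp mk1x measurable_fst).
  by apply: measurable_funM => //; exact: (measurableT_comp mf measurable_snd).
have mk12 t : measurable_fun setT (fun y => k1 x y * k2 y t).
  by apply: measurable_funM => //; exact: (measurable_kernel1 (schurC k2C) t).
have iF : (mu \x mu)%E.-integrable setT (EFin \o (fun z => k1 x z.1 * (k2 z.1 z.2 * f z.2))).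
  apply/integrable21ltyP; first exact/measurable_EFinP.
  apply: (@le_lt_trans _ _ (\int[mu]_t ((B * M)%:E * `|(f t)%:E|))%E); last first.
    rewrite ge0_integralZl//; last 2 first.
    - by apply: measurableT_comp => //; exact/measurable_EFinP.
    - by rewrite lee_fin mulr_ge0.
    apply: lte_mul_pinfty => //; first by rewrite lee_fin mulr_ge0.
    by have /integrableP[] := jf.
  apply: ge0_le_integral => //.
  - by move=> t _; exact: integral_ge0.
  - apply: (measurable_fun_fubini_tonelli_G (fun z : T * T => `|k1 x z.1 * (k2 z.1 z.2 * f z.2)|%:E)) => //.
    by apply/measurable_EFinP; exact: measurableT_comp.
  - by apply: emeasurable_funM => //; apply: measurableT_comp => //; exact/measurable_EFinP.
  move=> t _; rewrite (_ : (\int[mu]_y _)%E = \int[mu]_y (`|f t|%:E * (k1 x y * k2 y t)%:E))%E; last first.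
    apply: eq_integral => y _; rewrite /= -EFinM; congr EFin.
    by rewrite !normrM (ger0_norm (k10 _ _)) (ger0_norm (k20 _ _)); ring.
  rewrite ge0_integralZl//; last 2 first.
  - exact/measurable_EFinP.
  - by move=> y _; rewrite lee_fin mulr_ge0.
  by rewrite k12 -!EFinM lee_fin mulrC ler_wpM2r// ler_wpM2l.
transitivity (\int[mu]_y \int[mu]_t (k1 x y * (k2 y t * f t))).
  apply: ae_eq_Rintegral => //.
  - apply: measurable_funM => //.
    by have /measurable_EFinP := measurable_int mu (integrable_kop k2C jf).
  - by have /measurable_EFinP := measurable_int mu (integrable_Rfubini1 iF).
  - apply: filterS (ae_integrable_kop k2C jf) => y iky _.
    by rewrite RintegralZl.
rewrite (Rfubini iF)/= /kop -RintegralZl//; last first.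
  apply: le_integrable (integrableZl measurableT M jf) => //.
  - apply/measurable_EFinP; apply: measurable_funM => //; exact: (measurable_kernel1 k3C x).
  - move=> t _ /=; rewrite lee_fin !normrM (ger0_norm (k30 _ _)) (ger0_norm M0).
    by rewrite ler_wpM2r.
apply: eq_Rintegral => t _; rewrite mulrA.
transitivity (\int[mu]_y (f t * (k1 x y * k2 y t))).
  by apply: eq_Rintegral => y _; ring.
rewrite RintegralZl//; last first.
  apply/integrableP; split; first exact/measurable_EFinP.
  under eq_integral do rewrite /= ger0_norm ?mulr_ge0//.
  by rewrite k12 ltry.
by rewrite /Rintegral k12/= mulrC.
Qed.

End SchurOps.

(** * One-sided fractional potentials on (a,b) *)

Section Kernels.
Context {R : realType} (a b : R).
Hypothesis ab : a < b.
Notation mu := (@lebesgue_measure R).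
Notation D := (`]a, b[%classic : set R).
Implicit Types (s : side) (tau q sigma x y t : R) (f g phi : R -> R).

(** With this sign and the base point of the side, left and right potentials depend on sg s (x - y)
    in the same way and share their proofs. *)
Definition sg s : R := match s with Left => 1 | Right => -1 end.
Definition base s : R := match s with Left => a | Right => b end.
Definition dist_base s x := sg s * (x - base s).

Lemma sgK s : sg s * sg s = 1.
Proof. by case: s; rewrite /= ?mulr1 // mulrNN mulr1. Qed.

Lemma norm_sg s : `|sg s| = 1.
Proof. by case: s; rewrite /= ?normrN normr1. Qed.

Lemma sg_other s : sg (other s) = - sg s.
Proof. by case: s; rewrite //= opprK. Qed.

Lemma dist_base_gt0 s x : D x -> 0 < dist_base s x.
Proof.
by rewrite /= in_itv/= => /andP[ax xb]; case: s; rewrite /dist_base/= ?mul1r ?mulN1r; lra.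
Qed.

(** Cut off to (a,b) in both variables, so that potentials act on functions on the whole line and
    the Schur machinery applies. The factor 1/Gamma(tau) is restored in [frac_intE]. *)
Definition ker tau s x y : R := \1_D x * \1_D y * pk tau (sg s * (x - y)).

Definition frac_pot tau s f : R -> R := kop (ker tau s) f.

Local Notation K := frac_pot.

Lemma ker_ge0 tau s x y : 0 <= ker tau s x y.
Proof. by rewrite !mulr_ge0// pk_ge0. Qed.

Lemma ker_other tau s x y : ker tau (other s) x y = ker tau s y x.
Proof.
by rewrite /ker sg_other (mulrC (\1_D x)); congr (_ * pk _ _); ring.
Qed.

Lemma ker1_le1 s x y : ker 1 s x y <= 1.
Proof.
by rewrite /ker pk1 !indicE; do 2 case: (_ \in _); case: ifP; rewrite ?(mul0r,mulr0,mul1r).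
Qed.

Lemma measurable_D : measurable D.
Proof. exact: measurable_itv. Qed.

Lemma measurable_ker tau s :
  measurable_fun setT (fun z : measurableTypeR R * measurableTypeR R => ker tau s z.1 z.2).
Proof.
apply: measurable_funM.
  apply: measurable_funM.
    exact: (measurableT_comp (measurable_indic measurable_D) measurable_fst).
  exact: (measurableT_comp (measurable_indic measurable_D) measurable_snd).
apply: measurableT_comp; first exact: measurable_pk.
apply: measurable_funM => //; apply: measurable_funB.
  exact: measurable_fst.
exact: measurable_snd.
Qed.

(** A convolution majorant of [ker]: two points of (a,b) are less than b - a apart. The cut makes it
    integrable on the whole line for tau > 0. *)
Definition cutpk tau t : R := if t < b - a then pk tau t else 0.

Lemma cutpk_ge0 tau t : 0 <= cutpk tau t.
Proof. by rewrite /cutpk; case: ifP => // _; exact: pk_ge0. Qed.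

Lemma measurable_cutpk tau : measurable_fun setT (cutpk tau).
Proof. by apply: measurable_patch_lt; exact: measurable_pk. Qed.

Lemma ker_le_cutpk tau s x y : ker tau s x y <= cutpk tau (sg s * (x - y)).
Proof.
rewrite /ker !indicE.
have [xD|_] := boolP (x \in _); last by rewrite !mul0r cutpk_ge0.
have [yD|_] := boolP (y \in _); last by rewrite mulr0 mul0r cutpk_ge0.
rewrite !mul1r /cutpk; move: xD yD; rewrite !inE/= !in_itv/= => /andP[ax xb] /andP[ay yb].
by rewrite ifT//; case: s; rewrite /= ?mul1r ?mulN1r; lra.
Qed.

Definition cutpk_mass tau : R := fine (\int[mu]_t (cutpk tau t)%:E)%E.

Lemma cutpk_massE tau : 0 < tau -> ((cutpk_mass tau)%:E = \int[mu]_t (cutpk tau t)%:E)%E.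
Proof.
move=> tau0; rewrite fineK// ge0_fin_numE ?integral_pk_fin ?subr_gt0//.
by apply: integral_ge0 => t _; rewrite lee_fin cutpk_ge0.
Qed.

(** Every row lies below a reflected translate of [cutpk], whose mass does not depend on x; the
    columns are the rows of the other side. *)
Lemma schur_ker tau s : 0 < tau -> schur (ker tau s) (cutpk_mass tau).
Proof.
move=> tau0.
have H s' x : (\int[mu]_y (ker tau s' x y)%:E <= (cutpk_mass tau)%:E)%E.
  rewrite cutpk_massE//.
  apply: (@le_trans _ _ (\int[mu]_y (cutpk tau (sg s' * (x - y)))%:E)%E).
    apply: ge0_le_integral => //.
    - by move=> y _; rewrite lee_fin ker_ge0.
    - by apply/measurable_EFinP; exact: (measurable_fun_pair2 x (measurable_ker tau s')).
    - apply/measurable_EFinP; apply: measurableT_comp; first exact: measurable_cutpk.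
      by apply: measurable_funM => //; exact: measurable_funB.
    - by move=> y _; rewrite lee_fin ker_le_cutpk.
  rewrite (@integral_unit_affine R (- sg s') x) ?normrN ?norm_sg//.
    rewrite le_eqVlt; apply/orP; left; apply/eqP/eq_integral => t _.
    congr (EFin (cutpk _ _)); rewrite opprD mulNr opprK addrCA subrr addr0.
    by rewrite mulrA sgK mul1r.
  apply/measurable_EFinP; apply: measurableT_comp; first exact: measurable_cutpk.
  by apply: measurable_funM => //; exact: measurable_funB.
split => //; first exact: measurable_ker.
  by move=> x y; exact: ker_ge0.
by move=> y; under eq_integral do rewrite -ker_other; exact: H.
Qed.

(** The product of the truncated powers lives between t and x, so the cutoff to (a,b) costs nothing.
    The point t may be an endpoint, as potentials of powers of [dist_base] require. *)
Lemma integral_pkB_side tau q s x t : D x -> a <= t <= b ->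
  (\int[mu]_y (\1_D y * pk tau (sg s * (x - y)) * pk q (sg s * (y - t)))%:E =
   (pk (tau + q) (sg s * (x - t)))%:E * betaI tau q)%E.
Proof.
rewrite /= in_itv/= => /andP[ax xb] /andP[at_ tb].
have mf : measurable_fun setT
    (fun y => (\1_D y * pk tau (sg s * (x - y)) * pk q (sg s * (y - t)))%:E).
  apply/measurable_EFinP; apply: measurable_funM; first apply: measurable_funM.
  - exact: measurable_indic.
  - apply: measurableT_comp; first exact: measurable_pk.
    by apply: measurable_funM => //; exact: measurable_funB.
  - apply: measurableT_comp; first exact: measurable_pk.
    by apply: measurable_funM => //; exact: measurable_funB.
rewrite -integral_pkB; apply: (etrans (integral_unit_affine t (norm_sg s) mf)).
apply: eq_integral => w _; congr EFin.
have -> : sg s * (x - (sg s * w + t)) = sg s * (x - t) - w.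
  by rewrite -[in RHS](mul1r w) -(sgK s); ring.
rewrite addrK mulrA sgK mul1r.
have [w0|w0] := leP w 0; first by rewrite (pk0 _ w0) !mulr0.
have [zw|zw] := leP (sg s * (x - t)) w; first by rewrite (@pk0 _ tau) ?subr_le0// mulr0 !mul0r.
rewrite indicE mem_set ?mul1r//= in_itv/=.
by clear mf; move: zw; case: s; rewrite /= ?mul1r ?mulN1r => zw; apply/andP; split; lra.
Qed.

Lemma ker_comp tau q s x t : 0 < tau -> 0 < q ->
  (\int[mu]_y (ker tau s x y * ker q s y t)%:E =
   (fine (betaI tau q) * ker (tau + q) s x t)%:E)%E.
Proof.
move=> tau0 q0; rewrite /ker !indicE.
have [xD|_] := boolP (x \in _); last first.
  by rewrite !mul0r mulr0 integral0_eq// => y _; rewrite !mul0r.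
have [tD|_] := boolP (t \in _); last first.
  by rewrite mulr0 mul0r mulr0 integral0_eq// => y _; rewrite mulr0 mul0r mulr0.
transitivity (\int[mu]_y (\1_D y * pk tau (sg s * (x - y)) * pk q (sg s * (y - t)))%:E)%E.
  by apply: eq_integral => y _; rewrite !indicE mul1r mulr1; case: (_ \in _); rewrite ?(mul0r,mul1r).
move: xD tD; rewrite !inE => xD; rewrite /= in_itv/= => /andP[at_ tb].
rewrite integral_pkB_side//; last by rewrite !ltW.
rewrite !mul1r (mulrC (fine _)) EFinM fineK// ge0_fin_numE ?betaI_fin//.
by apply: integral_ge0 => y _; rewrite lee_fin mulr_ge0// pk_ge0.
Qed.

(** Abel's identity: the orders add up to 1, so the composition is a plain primitive. The kernel of
    order 1 is bounded, which gives the equality at every point. *)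
Lemma K_comp sigma s f x : 0 < sigma -> sigma < 1 ->
  mu.-integrable setT (EFin \o f) ->
  K (1 - sigma) s (K sigma s f) x = fine (betaI (1 - sigma) sigma) * K 1 s f x.
Proof.
move=> s0 s1 jf; have s1' : 0 < 1 - sigma by rewrite subr_gt0.
apply: (kop_comp (schur_ker s s1') (schur_ker s s0) (schur_ker s ltr01)) => //.
- by rewrite fine_ge0// integral_ge0// => y _; rewrite lee_fin mulr_ge0// pk_ge0.
- by exists 1 => t; exact: ker1_le1.
- by move=> t; rewrite ker_comp// subrK.
Qed.

Lemma K_pk tau q s x : 0 < tau -> D x ->
  K tau s (fun y => pk q (dist_base s y)) x =
  fine (betaI tau q) * pk (tau + q) (dist_base s x).
Proof.
move=> tau0 xD; rewrite /frac_pot /kop /Rintegral.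
rewrite (_ : (\int[mu]_y _)%E = ((pk (tau + q) (dist_base s x))%:E * betaI tau q)%E).
  have : (0 <= betaI tau q)%E.
    by apply: integral_ge0 => y _; rewrite lee_fin mulr_ge0// pk_ge0.
  case: (betaI tau q) => [r||] //= _; first by rewrite mulrC.
  (* If the beta integral is infinite, [fine] makes both sides 0. *)
  rewrite mul0r mulry; have := pk_ge0 (tau + q) (dist_base s x).
  by rewrite le_eqVlt => /predU1P[<-|p0]; rewrite ?sgr0 ?mul0e// gtr0_sg// mul1e.
rewrite -integral_pkB_side//; last by case: s => /=; rewrite lexx ltW.
by apply: eq_integral => y _; rewrite /ker !indicE (mem_set xD) mul1r.
Qed.

Lemma K_out tau s f x : ~ D x -> K tau s f x = 0.
Proof.
move=> xD; rewrite /frac_pot /kop /Rintegral integral0_eq// => y _.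
by rewrite /ker !indicE (memNset xD) !mul0r.
Qed.

Lemma eq_K tau s f g : (forall x, D x -> f x = g x) -> K tau s f = K tau s g.
Proof.
move=> fg; apply/funext => x; apply: eq_Rintegral => y _; rewrite /ker !indicE.
by have [/set_mem/fg->//|_] := boolP (y \in D); rewrite mulr0 !mul0r.
Qed.

(** Fractional integration by parts: transposing the kernel exchanges the two sides of the
    interval. *)
Lemma K_transpose tau s f g : 0 < tau -> mu.-integrable setT (EFin \o f) ->
  measurable_fun setT g -> (exists M, forall x, `|g x| <= M) ->
  \int[mu]_x (K tau s f x * g x) = \int[mu]_x (f x * K tau (other s) g x).
Proof.
move=> tau0 jf mg gM.
transitivity (\int[mu]_x (g x * K tau s f x)); first by apply: eq_Rintegral => x _; rewrite mulrC.
rewrite (kop_transpose (schur_ker s tau0) jf mg gM); apply: eq_Rintegral => y _.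
have -> : K tau (other s) g y = kop (fun x z => ker tau s z x) g y.
  by apply: eq_Rintegral => x _; rewrite ker_other.
exact: mulrC.
Qed.

End Kernels.

(** * Fractional derivatives of test functions, and sums of powers *)

Section FracDeriv.
Context {R : realType} (a b : R).
Hypothesis ab : a < b.
Notation mu := (@lebesgue_measure R).
Notation D := (`]a, b[%classic : set R).
Implicit Types (s : side) (tau q sigma x y t : R) (f g phi : R -> R).
Local Notation K := (frac_pot a b).
Local Notation base := (base a b).
Local Notation dist_base := (dist_base a b).

Lemma K1E s f x : D x -> K 1 s f x =
  match s with Left => \int[mu]_(y in `]a, x[) f y
             | Right => \int[mu]_(y in `]x, b[) f y end.
Proof.
move=> xD; have := xD; rewrite /= in_itv/= => /andP[ax xb].
case: s; rewrite /= Rintegral_mkcond; apply: eq_Rintegral => y _;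
  rewrite patchE /ker !indicE !mem_setE !in_itv/= ax xb pk1/= ?mul1r ?mulN1r ?oppr_gt0 ?subr_gt0 ?subr_lt0.
- have [yx|xy] := ltP y x; last by rewrite mulr0 mul0r andbF.
  by rewrite (lt_trans yx xb) !andbT; case: (a < y); rewrite ?mul1r ?mul0r.
- have [xy|yx] := ltP x y; last by rewrite mulr0 mul0r.
  by rewrite (lt_trans ax xy)/=; case: (y < b); rewrite ?mul1r ?mul0r.
Qed.

Lemma continuous_measurable f : continuous f -> measurable_fun setT f.
Proof. exact: continuous_measurable_fun. Qed.

Lemma Rintegral_derive1 f x y : x < y -> smooth_on setT f ->
  \int[mu]_(t in `]x, y[) derive1 f t = f y - f x.
Proof.
move=> xy sf.
have cf : continuous f by exact: smooth_continuous.
have cf' : continuous (derive1 f).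
  exact: smooth_continuous (@smooth_derive1n _ _ _ 1 sf).
rewrite /Rintegral -(@integral_itv_bndoo _ _ _ _ true false).
  rewrite (@continuous_FTC2 _ _ f)//.
  - exact: continuous_subspaceT.
  - split; last 2 first.
    + by apply: cvg_at_right_filter; exact: cf.
    + by apply: cvg_at_left_filter; exact: cf.
    by move=> t _; exact: (sf 0%N).
apply/measurable_EFinP; apply: measurable_funTS.
exact: continuous_measurable_fun.
Qed.

Lemma K1_derive1 s f x : D x -> smooth_on setT f -> f (base s) = 0 ->
  K 1 s (derive1 f) x = sg s * f x.
Proof.
move=> xD sf f0; have := xD; rewrite /= in_itv/= => /andP[ax xb].
by rewrite K1E//; case: s f0 => /= f0; rewrite Rintegral_derive1// f0; ring.
Qed.

(** The potential of a test function as a convolution: the variable x leaves the singular kernel for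
    phi, so derivatives in x fall on phi alone. It agrees with [K] on (a,b) ([K_test]) and is smooth
    on the whole line. *)
Definition Phi sigma s phi (x : R) : R :=
  \int[mu]_t (cutpk a b sigma t * phi (x - sg s * t)).

Lemma K_test sigma s phi x : D x -> test_function D phi ->
  K sigma s phi x = Phi sigma s phi x.
Proof.
move=> xD tphi; have := xD; rewrite /= in_itv/= => /andP[ax xb].
have mphi : measurable_fun setT phi.
  by apply: continuous_measurable_fun; apply: smooth_continuous; exact: test_smooth tphi.
rewrite /frac_pot /kop (@Rintegral_unit_affine R (- sg s) x) ?normrN ?norm_sg//; last first.
  apply: measurable_funM => //.
  exact: (measurable_fun_pair2 x (measurable_ker a b sigma s)).
apply: eq_Rintegral => t _.
have -> : - sg s * t + x = x - sg s * t by ring.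
rewrite /ker /cutpk !indicE (mem_set xD) mul1r.
have -> : sg s * (x - (x - sg s * t)) = t by rewrite -[RHS]mul1r -(sgK s); ring.
have [t0|t0] := leP t 0; first by rewrite (pk0 _ t0) mulr0 if_same !mul0r.
have [yD|yD] := boolP ((x - sg s * t) \in _).
  rewrite mul1r ifT//; move: yD; rewrite inE/= in_itv/=.
  by case: s => /=; rewrite ?mul1r ?mulN1r => /andP[? ?]; lra.
rewrite mul0r mul0r (test0 ab tphi) ?mulr0//.
by move: yD; rewrite notin_setE/= in_itv/= => /negP.
Qed.

Lemma integrable_cutpk sigma : 0 < sigma -> mu.-integrable setT (EFin \o cutpk a b sigma).
Proof.
move=> s0; apply/integrableP; split.
  by apply/measurable_EFinP; exact: measurable_cutpk.
under eq_integral do rewrite /= ger0_norm ?cutpk_ge0//.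
by rewrite integral_pk_fin// subr_gt0.
Qed.

(** Differentiation under the integral, dominated by [cutpk] times a bound on the derivative of
    phi. *)
Lemma is_derive_Phi sigma s phi x : 0 < sigma -> test_function D phi ->
  is_derive x 1 (Phi sigma s phi) (Phi sigma s (derive1 phi) x).
Proof.
move=> s0 tphi.
have tphi' : test_function D (derive1 phi) by exact: (test_derive1n ab 1 tphi).
have [M M0 phiM] := test_bounded ab tphi.
have [M' M'0 phiM'] := test_bounded ab tphi'.
have c0 t := cutpk_ge0 a b sigma t.
have cphi : continuous phi by apply: smooth_continuous; exact: test_smooth tphi.
have ic := integrable_cutpk s0.
have iG N : 0 <= N -> mu.-integrable setT (EFin \o (fun t => cutpk a b sigma t * N)).
  move=> N0; have := integrableZl measurableT N ic.
  by apply: eq_integrable => // t _; rewrite /= -EFinM mulrC.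
have df y t : is_derive y 1 (fun z => cutpk a b sigma t * phi (z - sg s * t))
    (cutpk a b sigma t * derive1 phi (y - sg s * t)).
  apply: (@is_deriveZ _ _ _ (fun z => phi (z - sg s * t)) (cutpk a b sigma t)).
  have d1 : is_derive y 1 (fun z : R => z - sg s * t) 1.
    apply: eq_is_derive (@is_deriveB R R R id (cst (sg s * t)) y 1 _ _ _ _) _ _ => //.
    by rewrite subr0.
  have d2 : is_derive (y - sg s * t) 1 phi (derive1 phi (y - sg s * t)).
    exact: (smooth_is_derive 0 (test_smooth tphi) (I : setT (y - sg s * t))).
  apply: eq_is_derive (@is_derive1_comp R phi (fun z : R => z - sg s * t) y _ _ d2 d1) _ _ => //.
  by rewrite mulr1.
have xI : `](x - 1), (x + 1)[%classic x by rewrite /= in_itv/=; apply/andP; split; lra.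
have mt y : measurable_fun setT (fun t => phi (y - sg s * t)).
  apply: measurableT_comp; first exact: continuous_measurable_fun.
  by apply: measurable_funB => //; exact: measurable_funM.
have intf y : `](x - 1), (x + 1)[%classic y ->
    mu.-integrable setT (EFin \o (fun t => cutpk a b sigma t * phi (y - sg s * t))).
  move=> _; apply: le_integrable (iG _ M0) => //.
    by apply/measurable_EFinP; apply: measurable_funM ; [exact: measurable_cutpk|exact: mt].
  move=> t _ /=; rewrite lee_fin !normrM (ger0_norm (c0 t)) ler_wpM2l//.
  by rewrite (ger0_norm M0).
have der y t : `](x - 1), (x + 1)[%classic y -> setT t ->
    derivable (fun z => cutpk a b sigma t * phi (z - sg s * t)) y 1.
  by move=> _ _; have [] := df y t.
have d1E y t : partial1of2 (fun z t => cutpk a b sigma t * phi (z - sg s * t)) y t =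
    cutpk a b sigma t * derive1 phi (y - sg s * t).
  by rewrite partial1of2E; have [_ ->] := df y t.
have bnd y t : `](x - 1), (x + 1)[%classic y -> setT t ->
    `|partial1of2 (fun z t => cutpk a b sigma t * phi (z - sg s * t)) y t| <= cutpk a b sigma t * M'.
  by move=> _ _; rewrite d1E normrM (ger0_norm (c0 t)) ler_wpM2l.
have G0 t : 0 <= cutpk a b sigma t * M' by rewrite mulr_ge0.
apply: DeriveDef.
  exact: (derivable_under_integral measurableT xI intf der G0 (iG _ M'0) bnd).
rewrite -derive1E (differentiation_under_integral measurableT xI intf der G0 (iG _ M'0) bnd).
by apply: eq_Rintegral => t _; rewrite d1E.
Qed.

Lemma derive1n_Phi sigma s phi n : 0 < sigma -> test_function D phi ->
  derive1n n (Phi sigma s phi) = Phi sigma s (derive1n n phi) /\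
  smooth_on setT (Phi sigma s phi).
Proof.
move=> s0 tphi.
have dF k x : setT x -> is_derive x 1 (Phi sigma s (derive1n k phi)) (Phi sigma s (derive1n k.+1 phi) x).
  by move=> _; apply: is_derive_Phi => //; exact: test_derive1n.
split; last exact: (smooth_family openT dF).
by apply/funext => x; have [] := derive_family openT dF (fun x _ => erefl) n (I : setT x).
Qed.

(** From the base point the convolution only looks outward, where phi vanishes. Hence integrating
    the derivative of [Phi] leaves no boundary term. *)
Lemma Phi_base sigma s phi : test_function D phi -> Phi sigma s phi (base s) = 0.
Proof.
move=> tphi; rewrite /Phi /Rintegral integral0_eq// => t _.
have [t0|t0] := leP t 0; first by rewrite /cutpk (pk0 _ t0) if_same mul0r.
rewrite (test0 ab tphi) ?mulr0//.
by case: s => /=; rewrite ?mul1r ?mulN1r; apply/negP => /andP[? ?]; lra.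
Qed.

Lemma test_base s phi : test_function D phi -> phi (base s) = 0.
Proof.
by move=> tphi; rewrite (test0 ab tphi)//; case: s; rewrite /= ltxx// andbF.
Qed.

Lemma K1_test s phi x : D x -> test_function D phi ->
  K 1 s (derive1 phi) x = sg s * phi x.
Proof.
move=> xD tphi; apply: K1_derive1 => //; first exact: test_smooth tphi.
exact: test_base.
Qed.

Lemma iter_K1_test s phi m k x : D x -> test_function D phi ->
  iter m (K 1 s) (derive1n (m + k) phi) x = sg s ^+ m * derive1n k phi x.
Proof.
move=> + tphi; elim: m k x => [|m IH] k x xD; first by rewrite add0n expr0 mul1r.
rewrite iterS (@eq_K _ _ _ _ _ _ (fun y => sg s ^+ m * derive1 (derive1n k phi) y)); last first.
  by move=> y yD; rewrite addSnnS IH// -derive1nS.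
have tk := test_derive1n ab k tphi.
have -> : (fun y => sg s ^+ m * derive1 (derive1n k phi) y) = derive1 (fun y => sg s ^+ m * derive1n k phi y).
  by rewrite -[RHS]/(derive1n 1 _) derive1nZ//; exact: test_smooth tk.
by rewrite K1_test//; [rewrite mulrA exprS|exact: testZ].
Qed.

Lemma KZ_bounded tau s c f x : 0 < tau -> measurable_fun setT f ->
  (exists M, forall x, `|f x| <= M) ->
  K tau s (fun y => c * f y) x = c * K tau s f x.
Proof.
move=> t0 mf fM.
rewrite [RHS](_ : _ = \int[mu]_y (c * (ker a b tau s x y * f y))).
  by apply: eq_Rintegral => y _; rewrite mulrCA.
by rewrite RintegralZl//; exact: (integrable_kernel_bounded (schur_ker ab s t0) x mf fM).
Qed.

Lemma test_measurable phi : test_function D phi -> measurable_fun setT phi.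
Proof.
by move=> tphi; apply: continuous_measurable_fun; apply: smooth_continuous; exact: test_smooth tphi.
Qed.

(** The potential of phi' is the derivative of [Phi], which vanishes at the base; [K 1] integrates
    it back. *)
Lemma K1_frac sigma s phi x : 0 < sigma -> D x -> test_function D phi ->
  K 1 s (K sigma s (derive1 phi)) x = sg s * K sigma s phi x.
Proof.
move=> s0 xD tphi; have tphi1 : test_function D (derive1 phi) by exact: (test_derive1n ab 1 tphi).
have [dPhi _] := derive1n_Phi s 1 s0 tphi; have [_ sPhi] := derive1n_Phi s 0 s0 tphi.
rewrite (@eq_K _ _ _ _ _ _ (derive1 (Phi sigma s phi))); last first.
  by move=> z zD; rewrite (K_test _ _ zD tphi1) -[RHS]/(derive1n 1 _ _) dPhi.
by rewrite K1_derive1 ?Phi_base// (K_test _ _ xD tphi).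
Qed.

Lemma iter_K1_frac sigma s phi m k x : 0 < sigma -> D x -> test_function D phi ->
  iter m (K 1 s) (K sigma s (derive1n (m + k) phi)) x = sg s ^+ m * K sigma s (derive1n k phi) x.
Proof.
move=> s0 + tphi; elim: m k x => [|m IH] k x xD; first by rewrite add0n expr0 mul1r.
have tk := test_derive1n ab k tphi; have tk1 := test_derive1n ab k.+1 tphi.
rewrite iterS (@eq_K _ _ _ _ _ _ (K sigma s (derive1 (fun y => sg s ^+ m * derive1n k phi y)))); last first.
  move=> y yD; rewrite addSnnS IH//.
  have [M _ phiM] := test_bounded ab tk1.
  rewrite -(KZ_bounded _ _ _ s0 (test_measurable tk1)); last by exists M.
  congr (K _ _ _ _); apply/funext => z.
  by rewrite -[RHS]/(derive1n 1 _ _) derive1nZ//; exact: test_smooth tk.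
rewrite K1_frac//; last exact: testZ.
have [M _ phiM] := test_bounded ab tk.
by rewrite (KZ_bounded _ _ _ s0 (test_measurable tk)) ?mulrA -?exprS//; exists M.
Qed.

Lemma frac_intE s sigma f x : D x ->
  frac_int s a b sigma f x = (Gamma sigma)^-1 * K sigma s f x.
Proof.
move=> xD; have := xD; rewrite /= in_itv/= => /andP[ax xb].
have powE (r : R) : r `^ (sigma - 1) = (r `^ (1 - sigma))^-1 by rewrite -powRN opprB.
rewrite /frac_int; congr (_ * _); case: s; rewrite /= Rintegral_mkcond; apply: eq_Rintegral => y _;
  rewrite patchE /ker !indicE !mem_setE !in_itv/= ax xb /pk/= ?mul1r ?mulN1r ?oppr_gt0 ?subr_gt0 ?subr_lt0.
- have [yx|xy] := ltP y x; last by rewrite mulr0 mul0r andbF.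
  rewrite (lt_trans yx xb) !andbT powE; case: (a < y); rewrite ?mul1r ?mul0r//.
  by rewrite mulrC.
- have [xy|yx] := ltP x y; last by rewrite mulr0 mul0r.
  rewrite (lt_trans ax xy)/= opprB powE; case: (y < b); rewrite ?mul1r ?mul0r//.
  by rewrite mulrC.
Qed.

(** On test functions the Riemann-Liouville and Caputo derivatives coincide: in convolution form all
    m + 1 derivatives pass onto phi. *)
Lemma frac_derivE s alpha phi x (m := Num.truncn alpha) (sigma := m.+1%:R - alpha) :
  0 < alpha -> alpha != m%:R -> D x -> test_function D phi ->
  frac_deriv s a b alpha phi x =
    sg s ^+ m.+1 * ((Gamma sigma)^-1 * K sigma s (derive1n m.+1 phi) x).
Proof.
move=> a0 am xD tphi; rewrite /frac_deriv -/m (negbTE am).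
have s0 : 0 < sigma by rewrite subr_gt0; exact: truncnS_gt.
have tn := test_derive1n ab m.+1 tphi.
have H s' : derive1n m.+1 (frac_int s' a b sigma phi) x = (Gamma sigma)^-1 * K sigma s' (derive1n m.+1 phi) x.
  have [dPhi sPhi] := derive1n_Phi s' m.+1 s0 tphi.
  rewrite (K_test _ _ xD tn) -dPhi.
  have dF n y : D y -> is_derive y 1 (fun z => (Gamma sigma)^-1 * derive1n n (Phi sigma s' phi) z)
     ((Gamma sigma)^-1 * derive1n n.+1 (Phi sigma s' phi) y).
    move=> _; apply: (@is_deriveZ _ _ _ (derive1n n (Phi sigma s' phi)) (Gamma sigma)^-1).
    exact: (smooth_is_derive n sPhi (I : setT y)).
  have oD : open D by exact: itv_open.
  have f0 y : D y -> frac_int s' a b sigma phi y = (Gamma sigma)^-1 * derive1n 0 (Phi sigma s' phi) y.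
    by move=> yD; rewrite frac_intE// (K_test _ _ yD tphi).
  by have [] := derive_family oD dF f0 m.+1 xD.
case: s; first by rewrite /sg expr1n mul1r; exact: H.
by rewrite -(H Right).
Qed.

Lemma is_derive_pk s q x : D x ->
  is_derive x 1 (fun x => pk q (dist_base s x)) (sg s * (q - 1) * pk (q - 1) (dist_base s x)).
Proof.
move=> xD; have z0 := dist_base_gt0 s xD.
have dz : is_derive x 1 (dist_base s) (sg s).
  apply: eq_is_derive (@is_deriveZ R R R (fun y => y - base s) (sg s) x 1 1 _) _ _ => //.
    by apply: eq_is_derive (@is_deriveB R R R id (cst (base s)) x 1 _ _ _ _) _ _ => //; rewrite subr0.
  by rewrite /GRing.scale/= mulr1.
apply: (@near_eq_is_derive _ R R (fun x => dist_base s x `^ (q - 1))).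
  near=> y; rewrite /pk ifT//.
  by apply: dist_base_gt0; near: y; apply: open_nbhs_nbhs; split => //; exact: itv_open.
apply: eq_is_derive (@is_derive1_comp R (fun t => t `^ (q - 1)) (dist_base s) x _ _ (is_derive1_powR (q - 1) z0) dz) _ _ => //.
by rewrite /pk z0; ring.
Unshelve. all: end_near. Qed.

Lemma smooth_pk s q : smooth_on D (fun x => pk q (dist_base s x)).
Proof.
pose c n := iter n (fun p : R * R => (p.1 * (sg s * (p.2 - 1)), p.2 - 1)) (1, q).
apply: (@smooth_family _ _ _ (fun n x => (c n).1 * pk (c n).2 (dist_base s x))).
- exact: itv_open.
- move=> n x xD.
  apply: eq_is_derive (@is_deriveZ _ _ _ _ (c n).1 _ _ _ (is_derive_pk s (c n).2 xD)) _ _ => //.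
  by rewrite /GRing.scale/= !mulrA.
- by move=> x _; rewrite mul1r.
Qed.

(** A pair (c, q) stands for c times the distance to the power q - 1. No sign of q is imposed, so
    derivatives of power sums are again of this form and all are smooth on (a,b). *)
Definition psum s (l : seq (R * R)) (x : R) : R :=
  \sum_(e <- l) e.1 * pk e.2 (dist_base s x).

(* finite combinations of the powers [dist_base s x `^ r], with [r > -1] *)
Definition is_psum s f := exists2 l, all (fun e => 0 < e.2) l & forall x, D x -> f x = psum s l x.

Lemma smooth_psum s l : smooth_on D (psum s l).
Proof.
have oD : open D by exact: itv_open.
elim: l => [|e l IH].
  apply: (@smooth_family _ _ _ (fun n => cst 0)) => //.
  by move=> x _; rewrite /psum big_nil.
rewrite (_ : psum s (e :: l) = (fun x => e.1 * pk e.2 (dist_base s x)) \+ psum s l).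
  by apply: (smoothD oD _ IH); apply: smoothZ; [exact: oD|exact: smooth_pk].
by apply/funext => x; rewrite /psum big_cons.
Qed.

Lemma measurable_psum s l : measurable_fun setT (psum s l).
Proof.
apply: measurable_sum => e; apply: measurable_funM => //.
apply: measurableT_comp; first exact: measurable_pk.
by apply: measurable_funM => //; exact: measurable_funB.
Qed.

Lemma integrable_ker_pk tau q s x : 0 < tau -> 0 < q -> D x ->
  mu.-integrable setT (EFin \o (fun y => ker a b tau s x y * pk q (dist_base s y))).
Proof.
move=> t0 q0 xD; apply/integrableP; split.
  apply/measurable_EFinP; apply: measurable_funM.
    exact: (measurable_fun_pair2 x (measurable_ker a b tau s)).
  apply: measurableT_comp; first exact: measurable_pk.
  by apply: measurable_funM => //; exact: measurable_funB.
have B0 : (0 <= betaI tau q)%E.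
  by apply: integral_ge0 => y _; rewrite lee_fin mulr_ge0// pk_ge0.
under eq_integral do rewrite /= ger0_norm ?mulr_ge0 ?pk_ge0 ?ker_ge0//.
rewrite (_ : (\int[mu]_y _)%E = ((pk (tau + q) (dist_base s x))%:E * betaI tau q)%E).
  by apply: lte_mul_pinfty; rewrite ?lee_fin ?pk_ge0// betaI_fin.
rewrite -(integral_pkB_side (a := a) (b := b))//; last by case: s => /=; rewrite lexx ltW.
by apply: eq_integral => y _; rewrite /ker !indicE (mem_set xD) mul1r.
Qed.

Lemma K_psum tau s l x : 0 < tau -> all (fun e => 0 < e.2) l -> D x ->
  K tau s (psum s l) x = psum s [seq (e.1 * fine (betaI tau e.2), tau + e.2) | e <- l] x.
Proof.
move=> t0 + xD; elim: l => [_|e l IH /andP[e0 l0]].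
  rewrite /psum big_nil /frac_pot /kop /Rintegral integral0_eq// => y _.
  by rewrite big_nil mulr0.
have ip := integrable_ker_pk s t0 e0 xD.
have ie : mu.-integrable setT (EFin \o (fun y => e.1 * (ker a b tau s x y * pk e.2 (dist_base s y)))).
  have := integrableZl measurableT e.1 ip.
  by apply: eq_integrable => // y _ /=; rewrite EFinM.
have il : mu.-integrable setT (EFin \o (fun y => ker a b tau s x y * psum s l y)).
  elim: l l0 {IH} => [_|e' l IH /andP[e'0 l0]].
    rewrite (_ : _ \o _ = cst 0%E); first exact: integrable0.
    by apply/funext => y /=; rewrite /psum big_nil mulr0.
  have := integrableD measurableT (integrableZl measurableT e'.1 (integrable_ker_pk s t0 e'0 xD)) (IH l0).
  apply: eq_integrable => // y _ /=; rewrite -EFinM -EFinD; congr EFin.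
  by rewrite [in RHS]/psum big_cons mulrDr; congr (_ + _); ring.
rewrite /psum/= big_cons -/(psum s _ x) -IH//.
transitivity (\int[mu]_y (e.1 * (ker a b tau s x y * pk e.2 (dist_base s y)) + ker a b tau s x y * psum s l y)).
  by apply: eq_Rintegral => y _; rewrite big_cons mulrDr mulrCA.
rewrite RintegralD// RintegralZl//; congr (_ + _).
by rewrite -mulrA -(K_pk ab)//.
Qed.

Lemma is_psum_K tau s f : 0 < tau -> is_psum s f -> is_psum s (K tau s f).
Proof.
move=> t0 [l l0 fl]; exists [seq (e.1 * fine (betaI tau e.2), tau + e.2) | e <- l].
  by rewrite all_map; apply: sub_all l0 => e /= e0; rewrite addr_gt0.
by move=> x xD; rewrite (eq_K _ _ fl) K_psum.
Qed.

Lemma is_psum_iterK tau s f m : 0 < tau -> is_psum s f -> is_psum s (iter m (K tau s) f).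
Proof. by move=> t0 pf; elim: m => //= m; exact: is_psum_K. Qed.

Lemma psum_cat s l l' x : psum s (l ++ l') x = psum s l x + psum s l' x.
Proof. by rewrite /psum big_cat. Qed.

Lemma is_psumD s f g : is_psum s f -> is_psum s g -> is_psum s (f \+ g).
Proof.
move=> [l l0 fl] [l' l'0 gl']; exists (l ++ l'); first by rewrite all_cat l0.
by move=> x xD; rewrite psum_cat -fl// -gl'.
Qed.

Lemma is_psumZ s c f : is_psum s f -> is_psum s (fun x => c * f x).
Proof.
move=> [l l0 fl]; exists [seq (c * e.1, e.2) | e <- l]; first by rewrite all_map.
move=> x xD; rewrite fl// /psum big_map mulr_sumr.
by apply: eq_bigr => e _; rewrite mulrA.
Qed.

Lemma eq_is_psum s f g : (forall x, D x -> f x = g x) -> is_psum s f -> is_psum s g.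
Proof. by move=> fg [l l0 fl]; exists l => // x xD; rewrite -fg// fl. Qed.

Lemma is_psum_dist_base s k : is_psum s (fun x => dist_base s x ^+ k).
Proof.
exists [:: (1, k.+1%:R)]; first by rewrite /= ltr0Sn.
move=> x xD; have z0 := dist_base_gt0 s xD.
by rewrite /psum big_seq1 mul1r /pk z0 -powR_mulrn ?ltW// -addn1 natrD addrK.
Qed.

Lemma is_psum_mul_dist s f : is_psum s f -> is_psum s (fun x => dist_base s x * f x).
Proof.
move=> [l l0 fl]; exists [seq (i.1, i.2 + 1) | i <- l].
  by rewrite all_map; apply: sub_all l0 => i /= /lt_trans; apply; rewrite ltrDl.
move=> x xD; rewrite fl// /psum big_map big_distrr/=; apply: eq_bigr => i _.
have z0 := dist_base_gt0 s xD.
rewrite mulrCA /pk z0; congr (_ * _).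
rewrite addrAC (@powRD _ _ (i.2 - 1) 1) ?(gt_eqF z0) ?implybT//.
by rewrite powRr1 ?ltW// mulrC.
Qed.

Lemma derive_psum s l x : D x ->
  is_derive x 1 (psum s l) (psum s [seq (e.1 * (sg s * (e.2 - 1)), e.2 - 1) | e <- l] x).
Proof.
move=> xD; elim: l => [|e l IH].
  apply: eq_is_derive (is_derive_cst (0 : R) x 1) _ _; last by rewrite /psum big_nil.
  by move=> y; rewrite /psum big_nil.
have de := @is_deriveZ _ _ _ _ e.1 _ _ _ (is_derive_pk s e.2 xD).
apply: eq_is_derive (@is_deriveD _ _ _ _ _ _ _ _ _ de IH) _ _.
  by move=> y; rewrite /psum big_cons.
by rewrite [in RHS]/psum/= big_cons/= /GRing.scale/= !mulrA.
Qed.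

End FracDeriv.

(** * Dominated convergence and the fundamental lemma of the calculus of variations *)

Lemma Rdominated_convergence d (T : measurableType d) (R : realType)
    (mu : {measure set T -> \bar R}) (D : set T) (f_ : nat -> T -> R) (f g : T -> R) :
  measurable D -> (forall n, measurable_fun D (f_ n)) -> measurable_fun D f ->
  (forall x, D x -> f_ n x @[n --> \oo] --> f x) ->
  mu.-integrable D (EFin \o g) -> (forall n x, D x -> `|f_ n x| <= g x) ->
  \int[mu]_(x in D) f_ n x @[n --> \oo] --> \int[mu]_(x in D) f x.
Proof.
move=> mD mf_ mf cvf ig fg.
have [iF _ H] : [/\ mu.-integrable D (EFin \o f),
    (\int[mu]_(x in D) `|(f_ n x)%:E - (f x)%:E| @[n --> \oo] --> 0)%E &
    (\int[mu]_(x in D) (f_ n x)%:E @[n --> \oo] --> \int[mu]_(x in D) (f x)%:E)%E].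
  apply: (@dominated_convergence _ _ _ mu D mD (fun n x => (f_ n x)%:E) (EFin \o f) (EFin \o g)) => //.
  - by move=> n; apply/measurable_EFinP; exact: mf_.
  - by apply/measurable_EFinP.
  - by apply: aeW => x Dx; apply: cvg_EFin; [exact: nearW|exact: cvf].
  - by apply: aeW => x n Dx; rewrite lee_fin; exact: fg.
have := integrable_fin_num mD iF => /fineK fE.
by apply: fine_cvg; rewrite -fE in H.
Qed.

Section Fundamental.
Context {R : realType} (a b : R).
Hypothesis ab : a < b.
Notation mu := (@lebesgue_measure R).
Notation D := (`]a, b[%classic : set R).
Implicit Types (s : side) (f g h u v phi psi : R -> R).

Lemma Rintegral_restrict (E : set R) u f :
  \int[mu]_(x in E) (u x * f x) = \int[mu]_x ((u \_ E) x * f x).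
Proof.
rewrite Rintegral_mkcond; apply: eq_Rintegral => x _; rewrite !patchE.
by case: ifP => // _; rewrite mul0r.
Qed.

Lemma locally_integrable_segment v c d : a < c -> d < b -> locally_integrable D v ->
  mu.-integrable `[c, d] (EFin \o v).
Proof.
move=> ac db [mv oD vK].
have cdD : `[c, d]%classic `<=` D.
  by move=> x; rewrite /= !in_itv/= => /andP[cx xd]; rewrite (lt_le_trans ac cx) (le_lt_trans xd db).
apply/integrableP; split.
  by apply/measurable_EFinP; apply: measurable_funS mv => //; exact: measurable_itv.
by apply: vK => //; exact: segment_compact.
Qed.

(** The plateaus tend to the indicator of ]c, d[ and stay below 1, so dominated convergence applies;
    the two endpoints carry no mass. *)
Lemma integral_itv_test0 v c d : locally_integrable D v ->
  (forall phi, test_function D phi -> \int[mu]_(x in D) (v x * phi x) = 0) ->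
  a < c -> c < d -> d < b -> \int[mu]_(x in `[c, d]) v x = 0.
Proof.
move=> lv v0 ac cd db.
have iv := locally_integrable_segment ac db lv.
have mv : measurable_fun `[c, d] v by apply/measurable_EFinP; exact: measurable_int iv.
have mp n : measurable_fun `[c, d] (plateau c d n).
  by apply: measurable_funTS; exact: (test_measurable (test_plateau ab n ac cd db)).
have cv : \int[mu]_(x in `[c, d]) (v x * plateau c d n x) @[n --> \oo] -->
    \int[mu]_(x in `[c, d]) (v x * \1_(`]c, d[%classic) x).
  apply: (@Rdominated_convergence _ _ _ mu _ _ _ (fun x => `|v x|)).
  - exact: measurable_itv.
  - by move=> n; apply: measurable_funM => //; exact: mp.
  - by apply: measurable_funM => //; apply: measurable_indic; exact: measurable_itv.
  - by move=> x _; apply: cvgMr; exact: cvg_plateau.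
  - exact: integrable_norm.
  - by move=> n x _; rewrite normrM ler_piMr// plateau_le1.
have E n : \int[mu]_(x in `[c, d]) (v x * plateau c d n x) = 0.
  transitivity (\int[mu]_(x in D) (v x * plateau c d n x)); last first.
    by apply: v0; exact: test_plateau.
  rewrite Rintegral_restrict [RHS]Rintegral_restrict.
  apply: eq_Rintegral => x _; rewrite !patchE !mem_setE !in_itv/=.
  case: ifPn => [/andP[cx xd]|]; first by rewrite (lt_le_trans ac cx) (le_lt_trans xd db).
  rewrite negb_and -!ltNge mul0r => xcd; rewrite /plateau.
  have -> : flat (n.+1%:R * (x - c)) * flat (n.+1%:R * (d - x)) = 0; last by rewrite mulr0.
  case/orP: xcd => xcd; first by rewrite flat0 ?mul0r// pmulr_rle0// subr_le0 ltW.
  by rewrite (@flat0 _ (_ * (d - x))) ?mulr0// pmulr_rle0// subr_le0 ltW.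
have mI (A : set R) : measurable A -> measurable_fun A v -> measurable_fun A (fun x => v x * \1_(`]c, d[%classic) x).
  by move=> mA mvA; apply: measurable_funM => //; apply: measurable_indic; exact: measurable_itv.
have mvo : measurable_fun `]c, d[ v.
  by apply: measurable_funS mv => //; exact: subset_itv_oo_cc.
have -> : \int[mu]_(x in `[c, d]) v x = \int[mu]_(x in `[c, d]) (v x * \1_(`]c, d[%classic) x).
  congr fine; apply: eq_integral_itv_bounded => //; first by apply: mI => //; exact: measurable_itv.
  by move=> x xcd; rewrite indicE mem_set ?mulr1.
rewrite -(cvg_lim (@Rhausdorff R) cv) (_ : (fun n => _) = cst 0) ?lim_cst//.
by apply/funext.
Qed.

Lemma ae_derive_primitive f : mu.-integrable setT (EFin \o f) ->
  {ae mu, forall x : R, is_derive x 1 (fun x : R => \int[mu]_(t in `]-oo, x]) f t) (f x)}.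
Proof.
move=> jf.
have if' y : mu.-integrable `]-oo, y] (EFin \o f) by apply: integrableS jf.
have := FTC1Ny if' (open_integrable_locally openT jf).
apply: (@filterS _ _ (ae_filter_ringOfSetsType mu)) => x [dF Fx].
by apply: DeriveDef; [exact: dF|rewrite -derive1E].
Qed.

(** The primitive of [v] cut to [c, d] vanishes on ]c, d[, whereas by Lebesgue's differentiation
    theorem its derivative is [v] almost everywhere. *)
Lemma ae0_segment v c d : a < c -> c < d -> d < b -> locally_integrable D v ->
  (forall phi, test_function D phi -> \int[mu]_(x in D) (v x * phi x) = 0) ->
  {ae mu, forall x, `]c, d[%classic x -> v x = 0}.
Proof.
move=> ac cd db lv v0.
have iv := locally_integrable_segment ac db lv.
have mcd : measurable (`[c, d]%classic : set R) by exact: measurable_itv.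
have jf : mu.-integrable setT (EFin \o (v \_ `[c, d])).
  by rewrite -restrict_EFin -integrable_mkcond.
have := ae_derive_primitive jf; apply: (@filterS _ _ (ae_filter_ringOfSetsType mu)) => x dx.
rewrite /= in_itv/= => /andP[cx xd].
have E y : c < y < d -> \int[mu]_(t in `]-oo, y]) (v \_ `[c, d]) t = 0.
  move=> /andP[cy yd].
  transitivity (\int[mu]_(x in `[c, y]) v x); last first.
    by apply: integral_itv_test0 => //; exact: lt_trans yd db.
  rewrite Rintegral_mkcond [RHS]Rintegral_mkcond; apply: eq_Rintegral => t _.
  rewrite !patchE !mem_setE !in_itv/=; case: (leP t y) => ty; rewrite ?andbF//= andbT.
  by rewrite (le_trans ty (ltW yd)) andbT.
have [_ <-] : is_derive x 1 (fun x => \int[mu]_(t in `]-oo, x]) (v \_ `[c, d]) t) 0.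
  apply: (@near_eq_is_derive _ R R (cst 0)).
  near=> y; rewrite E//; apply/andP; split; near: y; [exact: lt_nbhsr|exact: lt_nbhsl].
have [_ ->] := dx; rewrite patchE mem_set//= in_itv/=.
by rewrite !ltW.
Unshelve. all: end_near. Qed.

Lemma fundamental_lemma v : locally_integrable D v ->
  (forall phi, test_function D phi -> \int[mu]_(x in D) (v x * phi x) = 0) ->
  {ae mu, forall x, D x -> v x = 0}.
Proof.
(* The denominators start at 3 so that the intervals ]a + e n, b - e n[ exhausting (a,b) are all
   nondegenerate. *)
move=> lv v0; pose e (n : nat) : R := (b - a) / n.+3%:R.
have e0 n : 0 < e n by rewrite divr_gt0// subr_gt0.
have e3 n : e n <= (b - a) / 3.
  by rewrite ler_pM2l ?subr_gt0// lef_pV2 ?posrE// ler_nat.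
have : {ae mu, forall x, forall n, `](a + e n), (b - e n)[%classic x -> v x = 0}.
  apply: ae_foralln => n; apply: ae0_segment => //; have := e0 n; have := e3 n; have := ab; lra.
apply: (@filterS _ _ (ae_filter_ringOfSetsType mu)) => x xn; rewrite /= in_itv/= => /andP[ax xb].
pose m := Num.min (x - a) (b - x).
have m0 : 0 < m by rewrite lt_min !subr_gt0 ax xb.
pose n := Num.truncn ((b - a) / m).
have enm : e n < m.
  rewrite /e ltr_pdivrMr// mulrC -ltr_pdivrMr//; apply: (lt_trans (truncnS_gt _)).
  by rewrite ltr_nat.
apply: (xn n); rewrite /= in_itv/=.
by move: enm; rewrite lt_min => /andP[h1 h2]; apply/andP; split; lra.
Qed.

Lemma fundamental_lemma_eq u v : locally_integrable D u -> locally_integrable D v ->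
  (forall phi, test_function D phi ->
    \int[mu]_(x in D) (u x * phi x) = \int[mu]_(x in D) (v x * phi x)) ->
  {ae mu, forall x, D x -> u x = v x}.
Proof.
move=> lu lv uv.
have int_test w phi : locally_integrable D w -> test_function D phi ->
    mu.-integrable D (EFin \o (fun x => w x * phi x)).
  move=> lw tphi; have [mw _ _] := lw.
  have [M M0 phiM] := test_bounded ab tphi.
  have [_ [c [d [ac cd db Scd]]]] := (test_functionP ab phi).1 tphi.
  have iw := locally_integrable_segment ac db lw.
  have mD : measurable D by exact: measurable_itv.
  have iM : mu.-integrable D (fun x => M%:E * (EFin \o (w \_ `[c, d])) x)%E.
    apply: integrableZl => //; apply: (@integrableS _ _ _ mu setT D) => //.
    by rewrite -restrict_EFin -integrable_mkcond//; exact: measurable_itv.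
  apply: le_integrable iM => //.
    apply/measurable_EFinP; apply: measurable_funM => //; apply: measurable_funTS.
    exact: test_measurable tphi.
  move=> x _; rewrite /= lee_fin !normrM patchE mulrC (ger0_norm M0).
  case: ifPn => [_|]; first by rewrite ler_wpM2r.
  rewrite notin_setE/= in_itv/= => /negP; have [->|/Scd -> //] := eqVneq (phi x) 0.
  by rewrite normr0 mul0r mulr_ge0.
have := fundamental_lemma (locally_integrableB lu lv).
have H phi : test_function D phi -> \int[mu]_(x in D) ((u \- v) x * phi x) = 0.
  move=> tphi; rewrite -(subrr (\int[mu]_(x in D) (u x * phi x))) {2}uv//.
  rewrite -RintegralB; [|exact: measurable_itv|exact: int_test|exact: int_test].
  by apply: eq_Rintegral => x _; rewrite /= mulrBl.
by move=> /(_ H); apply: (@filterS _ _ (ae_filter_ringOfSetsType mu)) => x /[apply] /eqP; rewrite subr_eq0 => /eqP.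
Qed.

End Fundamental.

(** * Potentials of integrable functions on (a,b) and the du Bois-Reymond lemma *)

Section DuBoisReymond.
Context {R : realType} (a b : R).
Hypothesis ab : a < b.
Notation mu := (@lebesgue_measure R).
Notation D := (`]a, b[%classic : set R).
Implicit Types (s : side) (f g h u v phi psi chi : R -> R) (tau : R).
Local Notation K := (frac_pot a b).

Lemma integrable_D f : mu.-integrable D (EFin \o f) <-> mu.-integrable setT (EFin \o (f \_ D)).
Proof.
by rewrite -restrict_EFin -integrable_mkcond//; exact: measurable_itv.
Qed.

Lemma bounded_integrable_D f M : measurable_fun D f -> (forall x, D x -> `|f x| <= M) ->
  mu.-integrable D (EFin \o f).
Proof.
move=> mf fM; apply: measurable_bounded_integrable => //.
- by rewrite /= lebesgue_measure_itv/=; case: ifP => // _; rewrite -EFinB ltry.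
- by exists M; split; [exact: num_real|move=> N MN x /fM fx; exact: le_trans fx (ltW MN)].
Qed.

Lemma K_restrict tau s f : K tau s (f \_ D) = K tau s f.
Proof. by apply: eq_K => x xD; rewrite patchE mem_set. Qed.

Lemma integrable_K tau s f : 0 < tau -> mu.-integrable D (EFin \o f) ->
  mu.-integrable setT (EFin \o K tau s f).
Proof.
move=> t0 /integrable_D jf; rewrite -K_restrict.
exact: (integrable_kop (schur_ker ab s t0) jf).
Qed.

Lemma measurable_K tau s f : 0 < tau -> mu.-integrable D (EFin \o f) ->
  measurable_fun setT (K tau s f).
Proof.
by move=> t0 jf; have /measurable_EFinP := measurable_int mu (integrable_K s t0 jf).
Qed.

Lemma integrable_iterK tau s f m : 0 < tau -> mu.-integrable D (EFin \o f) ->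
  mu.-integrable D (EFin \o iter m (K tau s) f).
Proof.
move=> t0 jf; elim: m => //= m IH.
by apply: integrableS (integrable_K s t0 IH) => //; exact: measurable_itv.
Qed.

Lemma bounded_K tau s g : 0 < tau -> measurable_fun setT g -> (exists M, forall x, `|g x| <= M) ->
  measurable_fun setT (K tau s g) /\ exists M, forall x, `|K tau s g x| <= M.
Proof.
move=> t0 mg [M gM]; split.
  apply: measurable_K => //; apply: (bounded_integrable_D (M := M)) => //.
  exact: measurable_funTS.
exists (cutpk_mass a b tau * M) => x.
exact: (kop_bounded (schur_ker ab s t0) x mg gM).
Qed.

Lemma K_transpose_D tau s f g : 0 < tau -> mu.-integrable D (EFin \o f) ->
  measurable_fun setT g -> (exists M, forall x, `|g x| <= M) ->
  \int[mu]_(x in D) (K tau s f x * g x) = \int[mu]_(x in D) (f x * K tau (other s) g x).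
Proof.
move=> t0 jf mg gM; rewrite Rintegral_restrict [RHS]Rintegral_restrict.
rewrite -K_transpose//; last exact/integrable_D.
rewrite K_restrict; apply: eq_Rintegral => x _; rewrite patchE.
case: ifPn => //; rewrite notin_setE => xD; rewrite K_out// !mul0r.
Qed.

Lemma iterK_transpose tau s f g m : 0 < tau -> mu.-integrable D (EFin \o f) ->
  measurable_fun setT g -> (exists M, forall x, `|g x| <= M) ->
  \int[mu]_(x in D) (iter m (K tau s) f x * g x) =
  \int[mu]_(x in D) (f x * iter m (K tau (other s)) g x).
Proof.
move=> t0 jf mg gM; elim: m g mg gM => // m IH g mg gM.
have [mKg Kg] := bounded_K (other s) t0 mg gM.
apply: (etrans (K_transpose_D s t0 (integrable_iterK s m t0 jf) mg gM)).
by apply: (etrans (IH _ mKg Kg)); apply: eq_Rintegral => x _; rewrite iterSr.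
Qed.

(** If every test function had integral 0, the fundamental lemma would make the constant 1 vanish
    almost everywhere on an interval of positive length. *)
Lemma exists_test_integral_neq0 :
  exists2 theta, test_function D theta & \int[mu]_(x in D) theta x = 1.
Proof.
have [[theta tt i0]|H] := pselect (exists2 theta, test_function D theta & \int[mu]_(x in D) theta x != 0).
  have it : mu.-integrable D (EFin \o theta).
    have [M _ tM] := test_bounded ab tt.
    by apply: (bounded_integrable_D (M := M)) => //; apply: measurable_funTS; exact: test_measurable tt.
  exists (fun x => (\int[mu]_(x in D) theta x)^-1 * theta x); first exact: testZ.
  by rewrite RintegralZl ?mulVf//; exact: measurable_itv.
exfalso.
have l1 : locally_integrable D (cst 1 : R -> R).
  apply: open_integrable_locally; first exact: itv_open.
  by apply: (bounded_integrable_D (M := 1)) => // x _; rewrite normr1.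
have [A [mA A0 DA]] : {ae mu, forall x, D x -> cst 1 x = 0 :> R}.
  apply: fundamental_lemma => // phi tphi; apply/eqP; apply: contrapT => /negP i0.
  apply: H; exists phi => //; rewrite (_ : (fun x => _) = (fun x => cst 1 x * phi x))//.
  by apply/funext => x; rewrite mul1r.
have : (mu D <= mu A)%E.
  apply: le_measure; rewrite ?inE//.
  by move=> x xD; apply: DA => /(_ xD)/eqP; rewrite /= oner_eq0.
by rewrite A0 lebesgue_measure_itv/= lte_fin ab -EFinB lee_fin leNgt subr_gt0 ab.
Qed.

Lemma test_integrable phi : test_function D phi -> mu.-integrable setT (EFin \o phi).
Proof.
move=> tphi; have [M _ tM] := test_bounded ab tphi.
have : mu.-integrable setT (EFin \o (phi \_ D)).
  apply/integrable_D; apply: (bounded_integrable_D (M := M)) => //.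
  by apply: measurable_funTS; exact: test_measurable tphi.
apply: eq_integrable => // x _; rewrite /= patchE; case: ifPn => //.
by rewrite notin_setE/= in_itv/= => /negP H; rewrite (test0 ab tphi H).
Qed.

(** The primitive from the left vanishes before the support, and beyond it as well because the mean
    is zero; so it is again a test function. *)
Lemma test_antiderivative chi : test_function D chi -> \int[mu]_(x in D) chi x = 0 ->
  exists2 phi, test_function D phi & forall n, derive1n n.+1 phi = derive1n n chi.
Proof.
move=> tchi i0.
have ichi := test_integrable tchi.
pose phi x : R := \int[mu]_(t in `]-oo, x]) chi t.
have cchi : continuous chi by apply: smooth_continuous; exact: test_smooth tchi.
have dphi (x : R) : is_derive x 1 phi (chi x).
  have xu : x < x + 1 by rewrite ltrDl.
  have iu : mu.-integrable [set` Interval -oo%O (BRight (x + 1))] (EFin \o chi).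
    by apply: integrableS ichi.
  have [dF Fx] := @continuous_FTC1 _ chi -oo%O x (x + 1) xu iu (ltNyr _) (cchi x).
  by apply: DeriveDef; [exact: dF|rewrite -derive1E].
pose F n : R -> R := if n is k.+1 then derive1n k chi else phi.
have dF (n : nat) (x : R) : setT x -> is_derive x 1 (F n) (F n.+1 x).
  move=> _; case: n => [|n]; first exact: dphi.
  exact: (smooth_is_derive n (test_smooth tchi) (I : setT x)).
have f0 (x : R) : setT x -> phi x = F 0%N x by [].
exists phi; last by move=> n; apply/funext => x; have [] := derive_family openT dF f0 n.+1 (I : setT x).
apply/test_functionP => //; split; first exact: smooth_family openT dF f0.
have [_ [c [d [ac cd db Scd]]]] := (test_functionP ab chi).1 tchi.
exists c, d; split => // x; apply: contraNT; rewrite negb_and -!ltNge => /orP[xc|dx].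
  apply/eqP; rewrite /phi Rintegral_mkcond /Rintegral integral0_eq// => t _.
  rewrite patchE mem_setE in_itv/=; case: ifPn => // tx; congr EFin; apply/eqP.
  by apply: contraT => /Scd/andP[ct _]; have := le_lt_trans (le_trans ct tx) xc; rewrite ltxx.
rewrite -i0 /phi Rintegral_mkcond [X in _ == X]Rintegral_mkcond; apply/eqP/eq_Rintegral => t _.
rewrite !patchE !mem_setE !in_itv/=.
have [->|/Scd/andP[ct td]] := eqVneq (chi t) 0; first by rewrite !if_same.
by rewrite (lt_le_trans ac ct) (le_lt_trans td db) (le_trans td (ltW dx)).
Qed.

(** Induction on n: a multiple of the n-fold primitive [e] of 1 is subtracted from [h], so that the
    difference is orthogonal to all n-th derivatives. Thus [h] is a polynomial of degree below n;
    recording it as a power sum is what the fractional case needs. *)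
Lemma du_bois_reymond s n h : mu.-integrable D (EFin \o h) ->
  (forall phi, test_function D phi -> \int[mu]_(x in D) (h x * derive1n n phi x) = 0) ->
  exists2 f, is_psum a b s f & {ae mu, forall x, D x -> h x = f x}.
Proof.
have mD : measurable (D : set (measurableTypeR R)) by exact: measurable_itv.
elim: n h => [|n IH] h ih h0.
  exists (cst 0); first by exists [::] => // x _; rewrite /psum big_nil.
  apply: fundamental_lemma => //; apply: open_integrable_locally => //; exact: itv_open.
have [theta ttheta i1] := exists_test_integral_neq0.
pose c0 := \int[mu]_(x in D) (h x * derive1n n theta x).
pose e := iter n (K 1 s) (cst 1).
(* Against the n-th derivative of psi, [h] gives c0 times the integral of psi, and [e] gives the
   sign [sg (other s) ^+ n] times it; that sign is its own inverse. *)
pose c := c0 * sg (other s) ^+ n.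
have one_int : mu.-integrable D (EFin \o (cst 1 : R -> R)).
  by apply: (bounded_integrable_D (M := 1)) => // x _; rewrite normr1.
have ie : mu.-integrable D (EFin \o e) by exact: integrable_iterK.
have pe : is_psum a b s e.
  by apply: is_psum_iterK => //; apply: (eq_is_psum _ (is_psum_dist_base a b s 0)) => x _; rewrite expr0.
have ice : mu.-integrable D (EFin \o (fun x => c * e x)).
  have := integrableZl mD c ie.
  by apply: eq_integrable; [exact: measurable_itv|move=> x _; rewrite /= EFinM].
have ihe : mu.-integrable D (EFin \o (fun x => h x - c * e x)).
  have := integrableB mD ih ice.
  by apply: eq_integrable; [exact: measurable_itv|move=> x _].
have int_mul f phi k : mu.-integrable D (EFin \o f) -> test_function D phi ->
    mu.-integrable D (EFin \o (fun x => f x * derive1n k phi x)).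
  move=> jf tphi; have tk := test_derive1n ab k tphi; have [M M0 tM] := test_bounded ab tk.
  have iM := integrableZl mD M jf.
  apply: le_integrable iM; first exact: measurable_itv.
    apply/measurable_EFinP; apply: measurable_funM.
      by have /measurable_EFinP := measurable_int mu jf.
    by apply: measurable_funTS; exact: test_measurable tk.
  by move=> x _; rewrite /= lee_fin !normrM mulrC (ger0_norm M0) ler_wpM2r.
have test_int phi : test_function D phi -> mu.-integrable D (EFin \o phi).
  by move=> tphi; apply: integrableS (test_integrable tphi) => //; exact: measurable_itv.
have [psi tpsi|f pf hf] := IH _ ihe.
  pose I := \int[mu]_(x in D) psi x.
  (* Removing the mean of psi along theta makes it the derivative of a test function phi, to which
     the hypothesis on derivatives of order n + 1 applies. *)
  have tchi : test_function D (psi \+ (fun x => - I * theta x)).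
    by apply: testD => //; exact: testZ.
  have ichi : \int[mu]_(x in D) (psi \+ (fun x => - I * theta x)) x = 0.
    rewrite RintegralD; [|exact: measurable_itv|exact: test_int|by apply: test_int; exact: testZ].
    by rewrite RintegralZl ?i1 ?mulr1 ?subrr//; exact: test_int.
  have [phi tphi dphi] := test_antiderivative tchi ichi.
  have := h0 phi tphi; rewrite dphi derive1nD; [|exact: test_smooth tpsi|exact: (test_smooth (testZ ab _ ttheta))].
  rewrite derive1nZ; last exact: test_smooth ttheta.
  under eq_Rintegral do rewrite /= mulrDr mulrCA.
  rewrite RintegralD; [|exact: measurable_itv|exact: int_mul|]; last first.
    have := integrableZl mD (- I) (int_mul h theta n ih ttheta).
    by apply: eq_integrable; [exact: measurable_itv|move=> x _; rewrite /= EFinM].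
  rewrite RintegralZl; [|exact: measurable_itv|exact: int_mul].
  rewrite -/c0 mulNr => /eqP; rewrite subr_eq0 => /eqP hpsi.
  under eq_Rintegral do rewrite mulrBl -mulrA.
  rewrite RintegralB; [|exact: measurable_itv|exact: int_mul|]; last first.
    have := integrableZl mD c (int_mul e psi n ie tpsi).
    by apply: eq_integrable; [exact: measurable_itv|move=> x _; rewrite /= EFinM].
  rewrite RintegralZl; [|exact: measurable_itv|exact: int_mul].
  have tn := test_derive1n ab n tpsi; have [M M0 tM] := test_bounded ab tn.
  rewrite iterK_transpose//; [|exact: test_measurable tn|by exists M].
  rewrite hpsi (_ : \int[mu]_(x in D) _ = sg (other s) ^+ n * I).
    by rewrite /c -mulrA (mulrA (sg _ ^+ n)) -exprMn sgK expr1n mul1r mulrC subrr.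
  rewrite -RintegralZl; [|exact: measurable_itv|exact: test_int].
  apply: eq_Rintegral => x /set_mem xD; rewrite mul1r.
  by have := iter_K1_test ab (other s) n 0 xD tpsi; rewrite addn0.
exists (f \+ (fun x => c * e x)); first by apply: is_psumD => //; exact: is_psumZ.
by apply: (@filterS _ _ (ae_filter_ringOfSetsType mu)) hf => x /[apply]/eqP; rewrite subr_eq => /eqP.
Qed.

End DuBoisReymond.

(** Finiteness matters as much as positivity, since the real-valued integral would be 0 if it
    diverged: the integrand lies below a power before 1 and below the exponential density after
    it. *)
Lemma Gamma_gt0 (R : realType) (sigma : R) : 0 < sigma <= 1 -> 0 < Gamma sigma.
Proof.
move=> /andP[s0 s1]; pose mu := @lebesgue_measure R.
have powE0 (t : R) : 0 <= t `^ (sigma - 1) * expR (- t) by rewrite mulr_ge0 ?powR_ge0// expR_ge0.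
have mexp : measurable_fun setT (fun t : R => expR (- t)).
  by apply: continuous_measurable_fun => t; apply: continuous_comp; [exact: opp_continuous|exact: continuous_expR].
have mf : measurable_fun setT (fun t : R => t `^ (sigma - 1) * expR (- t)).
  by apply: measurable_funM => //; exact: measurable_powR.
have fin : (\int[mu]_(t in `]0%R, +oo[) (t `^ (sigma - 1) * expR (- t))%:E < +oo)%E.
  have m1 : measurable_fun setT (fun t : R => (if t < 1 then pk sigma t else 0)%:E).
    by apply/measurable_EFinP; apply: measurable_patch_lt; exact: measurable_pk.
  have m2 : measurable_fun setT (fun t : R => (exponential_pdf 1 t)%:E).
    by apply/measurable_EFinP; exact: measurable_exponential_pdf.
  have p1 (t : R) : 0 <= (if t < 1 then pk sigma t else 0) by case: ifP => // _; exact: pk_ge0.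
  have p2 (t : R) : 0 <= exponential_pdf 1 t by exact: exponential_pdf_ge0.
  apply: (@le_lt_trans _ _ (\int[mu]_t ((if t < 1 then pk sigma t else 0)%:E + (exponential_pdf 1 t)%:E))%E).
    rewrite integral_mkcond; apply: ge0_le_integral => //.
    - by move=> t _; rewrite patchE; case: ifP => // _; rewrite lee_fin.
    - apply/(measurable_restrictT _ _).1; first exact: measurable_itv.
      by apply/measurable_EFinP; exact: measurable_funTS.
    - exact: emeasurable_funD.
    - move=> t _; rewrite -EFinD patchE mem_setE in_itv/= andbT.
      case: ifPn => t0; last by rewrite lee_fin addr_ge0.
      rewrite lee_fin /pk t0 (exponential_pdfE _ (ltW t0)) mul1r mulN1r.
      have e0 := expR_ge0 (- t); have q0 := powR_ge0 t (sigma - 1).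
      have [t1|t1] := ltP t 1.
        apply: ler_wpDr => //; rewrite ler_piMr//.
        by rewrite -expR0 ler_expR oppr_le0 ltW.
      rewrite add0r ler_piMl// -[leRHS](powRr0 t) ler_powR// subr_le0//.
  rewrite ge0_integralD//; last 2 first.
  - by move=> t _; rewrite lee_fin.
  - by move=> t _; rewrite lee_fin.
  by rewrite integral_exponential_pdf// lte_add_pinfty ?ltry// integral_pk_fin.
have pos : (0 < \int[mu]_(t in `]0%R, +oo[) (t `^ (sigma - 1) * expR (- t))%:E)%E.
  apply: (@lt_le_trans _ _ (\int[mu]_(t in `]0%R, 1%R[) (expR (-1))%:E)%E).
    by rewrite integral_cst//= lebesgue_measure_itv/= lte_fin ltr01 -EFinB subr0 mule1 lte_fin expR_gt0.
  apply: (@le_trans _ _ (\int[mu]_(t in `]0%R, 1%R[) (t `^ (sigma - 1) * expR (- t))%:E)%E).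
    apply: ge0_le_integral => //.
    - by apply/measurable_EFinP; exact: measurable_funTS.
    - move=> t; rewrite /= in_itv/= => /andP[t0 t1]; rewrite lee_fin -[leLHS]mul1r.
      apply: ler_pM => //.
        by rewrite -[leLHS](powRr0 t) ger_powR ?t0 ?(ltW t1)// subr_le0.
      by rewrite ler_expR lerN2 ltW.
  apply: ge0_subset_integral => //.
  - by apply/measurable_EFinP; exact: measurable_funTS.
  - by move=> t _; rewrite lee_fin.
  - by move=> t; rewrite /= !in_itv/= => /andP[-> _].
by rewrite fine_gt0// pos.
Qed.

(** * The kernel of the weak fractional derivative *)

Section FracOperators.
Context {R : realType} (a b : R).
Hypothesis ab : a < b.
Notation mu := (@lebesgue_measure R).
Notation D := (`]a, b[%classic : set R).
Implicit Types (s : side) (f g h u v phi psi chi : R -> R) (tau : R).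
Local Notation K := (frac_pot a b).

Lemma ae_eq_K tau s f g x : measurable_fun D f -> measurable_fun D g ->
  {ae mu, forall x, D x -> f x = g x} -> K tau s f x = K tau s g x.
Proof.
move=> mf mg fg; rewrite -(K_restrict _ _ _ _ f) -(K_restrict _ _ _ _ g).
have mD : measurable (D : set (measurableTypeR R)) by exact: measurable_itv.
have mk : measurable_fun setT (ker a b tau s x) := measurable_fun_pair2 x (measurable_ker a b tau s).
apply: ae_eq_Rintegral => //.
- by apply: measurable_funM => //; apply/(measurable_restrictT _ _).1.
- by apply: measurable_funM => //; apply/(measurable_restrictT _ _).1.
- apply: (@filterS _ _ (ae_filter_ringOfSetsType mu)) fg => y Dfg _.
  by rewrite !patchE; case: ifPn => // /set_mem/Dfg ->.
Qed.

(** Lebesgue differentiation; on the right, [K 1] is the total integral minus the primitive, whence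
    the sign. *)
Lemma ae_derive_K1 s u : mu.-integrable D (EFin \o u) ->
  {ae mu, forall x : R, D x -> is_derive x 1 (K 1 s u) (sg s * u x)}.
Proof.
move=> /integrable_D ju; have := ae_derive_primitive ju.
apply: (@filterS _ _ (ae_filter_ringOfSetsType mu)) => x dx xD.
have mD : measurable (D : set (measurableTypeR R)) by exact: measurable_itv.
have nD : \forall y \near x, D y by apply: open_nbhs_nbhs; split => //; exact: itv_open.
have uE : u x = (u \_ D) x by rewrite patchE mem_set.
pose F y := \int[mu]_(t in `]-oo, y]) (u \_ D) t.
have oc (y : R) : \int[mu]_(t in `]-oo, y]) (u \_ D) t = \int[mu]_(t in `]-oo, y[) (u \_ D) t.
  rewrite Rintegral_itv_bndo_bndc//.
  by apply: integrableS ju => //; exact: measurable_itv.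
have FL y : D y -> F y = K 1 Left u y.
  move=> yD; have := yD; rewrite /= in_itv/= => /andP[ay yb].
  rewrite K1E// /F oc Rintegral_mkcond [RHS]Rintegral_mkcond; apply: eq_Rintegral => t _.
  rewrite !patchE !mem_setE !in_itv/=; case: (ltP t y) => ty; rewrite ?andbF// andbT.
  by rewrite (lt_trans ty yb) andbT.
have FR y : D y -> \int[mu]_t (u \_ D) t - F y = K 1 Right u y.
  move=> yD; have := yD; rewrite /= in_itv/= => /andP[ay yb].
  rewrite K1E//; apply/eqP; rewrite subr_eq addrC; apply/eqP.
  have -> : \int[mu]_(t in `]y, b[) u t = \int[mu]_(t in `]y, +oo[) (u \_ D) t.
    rewrite Rintegral_mkcond [RHS]Rintegral_mkcond; apply: eq_Rintegral => t _.
    rewrite !patchE !mem_setE !in_itv/=; case: (ltP y t) => // yt.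
    by rewrite (lt_trans ay yt).
  have TE : setT = `]-oo, y] `|` `]y, +oo[ :> set R.
    apply/esym/seteqP; split => // t _ /=; rewrite !in_itv/= andbT.
    by case: (leP t y) => ?; [left|right].
  rewrite TE in ju *; rewrite Rintegral_setU//.
  - apply/disj_set2P; rewrite -subset0 => t [] /=; rewrite !in_itv/= andbT leNgt.
    by move=> /negP.
case: s => /=.
- rewrite mul1r uE; apply: near_eq_is_derive dx.
  by apply: filterS nD => y yD; rewrite -FL.
- rewrite mulN1r uE; apply: (@near_eq_is_derive _ R R (fun y => \int[mu]_t (u \_ D) t - F y)).
    by apply: filterS nD => y yD; rewrite FR.
  apply: eq_is_derive (@is_deriveB R R R (cst _) F x 1 _ _ _ dx) _ _ => //.
  by rewrite sub0r.
Qed.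

Lemma psum_locally_determined s l f : (forall x, D x -> f x = psum a b s l x) ->
  forall x, D x -> is_derive x 1 f
    (psum a b s [seq (e.1 * (sg s * (e.2 - 1)), e.2 - 1) | e <- l] x).
Proof.
move=> fl x xD; apply: near_eq_is_derive (derive_psum s l xD).
have : \forall y \near x, D y by apply: open_nbhs_nbhs; split => //; exact: itv_open.
by apply: filterS => y yD; rewrite fl.
Qed.

(** For integer alpha this is [du_bois_reymond]. Otherwise, transposing the potential of order sigma
    shows that K(sigma) u is orthogonal to all derivatives of order m + 1, hence a power sum.
    Applying K(1 - sigma) gives a multiple of the primitive of u, again a power sum, and
    differentiating it recovers u almost everywhere. *)
Lemma frac_kernel s alpha u : 0 < alpha -> mu.-integrable D (EFin \o u) ->
  (forall phi, test_function D phi ->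
    \int[mu]_(x in D) (u x * frac_deriv (other s) a b alpha phi x) = 0) ->
  exists l, {ae mu, forall x, D x -> u x = psum a b s l x}.
Proof.
move=> a0 ju u0; pose m := Num.truncn alpha.
have mD : measurable (D : set (measurableTypeR R)) by exact: measurable_itv.
have [am|am] := eqVneq alpha m%:R.
  have H phi : test_function D phi -> \int[mu]_(x in D) (u x * derive1n m phi x) = 0.
    move=> tphi; rewrite -[RHS](u0 _ tphi); apply: eq_Rintegral => x _.
    by rewrite /frac_deriv -/m -am eqxx.
  have [f [l _ fl] uf] := du_bois_reymond ab s ju H.
  exists l; apply: (@filterS _ _ (ae_filter_ringOfSetsType mu)) uf => x uf xD.
  by rewrite uf// fl.
pose sigma := m.+1%:R - alpha.
have s0 : 0 < sigma by rewrite subr_gt0 truncnS_gt.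
have s1 : sigma < 1.
  rewrite ltrBlDr -natr1 addrC ltrD2l lt_neqAle eq_sym am/=.
  by rewrite truncn_le// ltW.
have jK := integrable_K ab s s0 ju.
have jKD : mu.-integrable D (EFin \o K sigma s u) by exact: integrableS jK.
have H phi : test_function D phi ->
    \int[mu]_(x in D) (K sigma s u x * derive1n m.+1 phi x) = 0.
  move=> tphi; have tn := test_derive1n ab m.+1 tphi; have [M _ tM] := test_bounded ab tn.
  rewrite K_transpose_D//; [|exact: test_measurable tn|by exists M].
  (* Multiplying phi by c cancels the sign and the factor 1/Gamma(sigma) in [frac_derivE]. *)
  pose c := sg (other s) ^+ m.+1 * Gamma sigma.
  transitivity (\int[mu]_(x in D) (u x * frac_deriv (other s) a b alpha (fun y => c * phi y) x)); last first.
    by apply: u0; exact: testZ.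
  apply: eq_Rintegral => x /set_mem xD; congr (_ * _).
  have tc : test_function D (fun y => c * phi y) by exact: testZ.
  rewrite (frac_derivE ab)// derive1nZ; last exact: test_smooth tphi.
  rewrite (KZ_bounded ab _ _ _ s0 (test_measurable tn)); last by exists M.
  rewrite /c -/m -/sigma; set X := K _ _ _ _; set e := _ ^+ _.
  have eK : e * e = 1 by rewrite -exprMn sgK expr1n.
  have G0 : Gamma sigma != 0 by rewrite gt_eqF// Gamma_gt0// s0 ltW.
  transitivity ((e * e) * (Gamma sigma * ((Gamma sigma)^-1 * X))); last by ring.
  by rewrite eK mul1r mulVKf.
have [P [l l0 Pl] KP] := du_bois_reymond ab s jKD H.
have B0 : 0 < fine (betaI (1 - sigma) sigma).
  apply: fine_gt0; apply/andP; split; first by apply: betaI_gt0; rewrite ?gerBl ltW.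
  by apply: betaI_fin => //; rewrite subr_gt0.
have pQ : is_psum a b s (fun x => (fine (betaI (1 - sigma) sigma))^-1 * K (1 - sigma) s (psum a b s l) x).
  by apply: is_psumZ; apply: is_psum_K; rewrite ?subr_gt0//; exists l.
have [l' _ Ql'] := pQ.
have K1l' x : D x -> K 1 s u x = psum a b s l' x.
  move=> xD; rewrite -Ql'//.
  have <- : K (1 - sigma) s (K sigma s u) x = K (1 - sigma) s (psum a b s l) x.
    apply: ae_eq_K.
    - by apply: measurable_funTS; exact: measurable_K.
    - by apply: measurable_funTS; exact: measurable_psum.
    - apply: (@filterS _ _ (ae_filter_ringOfSetsType mu)) KP => y Py yD.
      by rewrite Py// Pl.
  by rewrite -(K_restrict _ _ sigma) K_comp ?mulKf ?gt_eqF ?K_restrict//; exact/integrable_D.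
exists [seq (sg s * e.1, e.2) | e <- [seq (e.1 * (sg s * (e.2 - 1)), e.2 - 1) | e <- l']].
have := ae_derive_K1 s ju; apply: (@filterS _ _ (ae_filter_ringOfSetsType mu)) => x dx xD.
have [_ d1] := dx xD; have [_ d2] := psum_locally_determined K1l' xD.
have : sg s * (sg s * u x) = sg s * psum a b s [seq (e.1 * (sg s * (e.2 - 1)), e.2 - 1) | e <- l'] x.
  by rewrite -d2 d1.
rewrite mulrA sgK mul1r => ->.
rewrite /psum !big_map mulr_sumr; apply: eq_bigr => e _ /=; ring.
Qed.

End FracOperators.

(** * A bounded right inverse of the weak fractional derivative *)

Section SolutionOperator.
Context {R : realType} (a b : R).
Hypothesis ab : a < b.
Notation mu := (@lebesgue_measure R).
Notation D := (`]a, b[%classic : set R).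
Implicit Types (s : side) (f g h u v phi psi chi : R -> R) (tau p alpha : R).
Local Notation K := (frac_pot a b).

(** The p-th power of the L^p norm on (a,b), preferred to the norm because these powers are what the
    Sobolev norm adds up. *)
Definition Np p f : \bar R := (\int[mu]_x (`|(f \_ D) x| `^ p)%:E)%E.

Lemma Np_ge0 p f : (0 <= Np p f)%E.
Proof. by apply: integral_ge0 => x _; rewrite lee_fin powR_ge0. Qed.

Lemma measurable_restrict_D f : measurable_fun D f -> measurable_fun setT (f \_ D).
Proof.
by move=> mf; apply/(measurable_restrictT _ _).1 => //; exact: measurable_itv.
Qed.

Lemma measurable_pow p f : measurable_fun setT f -> measurable_fun setT (fun x => (`|f x| `^ p)%:E).
Proof.
move=> mf; apply/measurable_EFinP; apply: (measurableT_comp (measurable_powR _)).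
exact: measurableT_comp.
Qed.

Lemma integrable_measurable f : mu.-integrable D (EFin \o f) -> measurable_fun D f.
Proof. by move=> jf; have /measurable_EFinP := measurable_int mu jf. Qed.

Lemma K_Np tau s p g : 0 < tau -> 1 <= p -> mu.-integrable D (EFin \o g) ->
  (Np p (K tau s g) <= (cutpk_mass a b tau `^ p)%:E * Np p g)%E.
Proof.
move=> t0 p1 jg; have jgD := (integrable_D _ _ g).1 jg.
have p0 : 0 <= p by exact: le_trans p1.
have mK := measurable_K ab s t0 jg.
apply: (@le_trans _ _ (\int[mu]_x (`|K tau s g x| `^ p)%:E)%E).
  apply: ge0_le_integral => //.
  - by apply: measurable_pow; apply: measurable_restrict_D; exact: measurable_funTS.
  - exact: measurable_pow.
  - move=> x _; rewrite lee_fin ge0_ler_powR ?nnegrE// patchE.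
    by case: ifP => // _; rewrite normr0.
rewrite -K_restrict /Np; apply: (kop_Lp (schur_ker ab s t0) p1 _ jgD).
by apply: measurable_restrict_D; exact: integrable_measurable.
Qed.

Lemma iterK_Np tau s p m : 0 < tau -> 1 <= p -> exists2 C, 0 <= C &
  forall g, mu.-integrable D (EFin \o g) -> (Np p (iter m (K tau s) g) <= C%:E * Np p g)%E.
Proof.
move=> t0 p1; elim: m => [|m [C C0 IH]]; first by exists 1 => // g _; rewrite mul1e.
exists (cutpk_mass a b tau `^ p * C); first by rewrite mulr_ge0// powR_ge0.
move=> g jg /=; have jm := integrable_iterK ab s m t0 jg.
apply: le_trans (K_Np s t0 p1 jm) _; rewrite EFinM -muleA.
by apply: lee_wpmul2l; [rewrite lee_fin powR_ge0|exact: IH].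
Qed.

Lemma NpZ p c f : 1 <= p -> measurable_fun D f -> Np p (fun x => c * f x) = ((`|c| `^ p)%:E * Np p f)%E.
Proof.
move=> p1 mf; have p0 : 0 < p by exact: lt_le_trans p1.
rewrite /Np -ge0_integralZl//; last first.
  by apply: measurable_pow; exact: measurable_restrict_D.
apply: eq_integral => x _; rewrite -EFinM -powRM// -normrM !patchE.
by case: ifP => // _; rewrite mulr0.
Qed.

Lemma integrableZ_D c f : mu.-integrable D (EFin \o f) -> mu.-integrable D (EFin \o (fun x => c * f x)).
Proof.
have mD : measurable (D : set (measurableTypeR R)) by exact: measurable_itv.
move=> jf; have := integrableZl mD c jf.
by apply: eq_integrable; [exact: measurable_itv|move=> x _; rewrite /= EFinM].
Qed.

Lemma integrable_mul_bounded f g : mu.-integrable D (EFin \o f) -> measurable_fun D g ->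
  (exists M : R, forall x, D x -> `|g x| <= M) -> mu.-integrable D (EFin \o (fun x => f x * g x)).
Proof.
move=> jf mg [M gM]; have iM := integrableZ_D M jf.
apply: le_integrable iM; first exact: measurable_itv.
  by apply/measurable_EFinP; apply: measurable_funM => //; exact: integrable_measurable.
move=> x xD; rewrite /= lee_fin !normrM mulrC ler_wpM2r//.
by apply: le_trans (ler_norm _); exact: gM.
Qed.

Lemma integrable_mul_test f phi : mu.-integrable D (EFin \o f) -> test_function D phi ->
  mu.-integrable D (EFin \o (fun x => f x * phi x)).
Proof.
move=> jf tphi; apply: integrable_mul_bounded => //.
  by apply: measurable_funTS; exact: test_measurable tphi.
by have [M _ tM] := test_bounded ab tphi; exists M.
Qed.

Lemma sg_powK s k : sg s ^+ k * sg s ^+ k = 1 :> R.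
Proof. by rewrite -exprMn sgK expr1n. Qed.

Lemma sg_pow_other s k : (-1) ^+ k * sg (other s) ^+ k = sg s ^+ k :> R.
Proof. by rewrite -exprMn sg_other mulN1r opprK. Qed.

(** Moved onto the test function, k of the m integrations undo its k derivatives; the others stay on
    [f]. *)
Lemma iterK1_weak_deriv s f phi m k : (k <= m)%N -> mu.-integrable D (EFin \o f) ->
  test_function D phi ->
  \int[mu]_(x in D) (iter m (K 1 s) f x * derive1n k phi x) =
  sg (other s) ^+ k * \int[mu]_(x in D) (iter (m - k) (K 1 s) f x * phi x).
Proof.
move=> km jf tphi; rewrite -{1}(subnKC km).
have jm := integrable_iterK ab s (m - k) ltr01 jf.
have tk := test_derive1n ab k tphi; have [M _ tM] := test_bounded ab tk.
under eq_Rintegral do rewrite iterD.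
rewrite iterK_transpose//; [|exact: test_measurable tk|by exists M].
rewrite -RintegralZl; [|exact: measurable_itv|exact: integrable_mul_test].
apply: eq_Rintegral => x /set_mem xD; rewrite mulrCA; congr (_ * _).
by have := iter_K1_test ab (other s) k 0 xD tphi; rewrite addn0.
Qed.

Lemma frac_deriv_bounded s alpha phi : 0 < alpha -> test_function D phi ->
  measurable_fun D (frac_deriv s a b alpha phi) /\
  exists M : R, forall x, D x -> `|frac_deriv s a b alpha phi x| <= M.
Proof.
move=> a0 tphi; pose m := Num.truncn alpha.
have [am|am] := eqVneq alpha m%:R.
  have -> : frac_deriv s a b alpha phi = derive1n m phi.
    by apply/funext => x; rewrite /frac_deriv -/m -am eqxx.
  have tm := test_derive1n ab m tphi; have [M _ tM] := test_bounded ab tm.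
  by split; [apply: measurable_funTS; exact: test_measurable tm|exists M].
have tn := test_derive1n ab m.+1 tphi; have [M _ tM] := test_bounded ab tn.
have s0 : 0 < m.+1%:R - alpha by rewrite subr_gt0 truncnS_gt.
have [mK [N bK]] := bounded_K ab s s0 (test_measurable tn) (ex_intro _ M tM).
pose c := sg s ^+ m.+1 * (Gamma (m.+1%:R - alpha))^-1 : R.
have fE x : D x -> frac_deriv s a b alpha phi x = c * K (m.+1%:R - alpha) s (derive1n m.+1 phi) x.
  by move=> xD; rewrite (frac_derivE ab)// mulrA.
split; last by exists (`|c| * N) => x xD; rewrite fE// normrM ler_wpM2l.
apply: (@eq_measurable_fun _ _ _ _ _ (fun x => c * K (m.+1%:R - alpha) s (derive1n m.+1 phi) x)).
  by move=> x /set_mem xD; rewrite fE.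
by apply: measurable_funTS; apply: measurable_funM.
Qed.

(** [J 0] is the fractional integral of order alpha up to a constant, and [J k] is its k-th
    derivative. The clauses say in turn: integrability, weak derivatives up to m, weak fractional
    derivative equal to [g], L^p bounds, and stability of power sums. *)
Lemma solution_operator s alpha p (m := Num.truncn alpha) : 0 < alpha -> 1 <= p ->
  exists J : nat -> (R -> R) -> (R -> R), [/\
  forall k g, (k <= m)%N -> mu.-integrable D (EFin \o g) -> mu.-integrable D (EFin \o J k g),
  forall k g phi, (k <= m)%N -> mu.-integrable D (EFin \o g) -> test_function D phi ->
    \int[mu]_(x in D) (J k g x * phi x) = (-1) ^+ k * \int[mu]_(x in D) (J 0%N g x * derive1n k phi x),
  forall g phi, mu.-integrable D (EFin \o g) -> test_function D phi ->
    \int[mu]_(x in D) (g x * phi x) =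
    (-1) ^+ m * \int[mu]_(x in D) (J 0%N g x * frac_deriv (other s) a b alpha phi x),
  exists C, forall k g, (k <= m)%N -> mu.-integrable D (EFin \o g) -> (Np p (J k g) <= C%:E * Np p g)%E &
  forall g, is_psum a b s g -> is_psum a b s (J 0%N g)].
Proof.
move=> a0 p1.
have mD : measurable (D : set (measurableTypeR R)) by exact: measurable_itv.
(* Integration of order alpha is split into m plain integrations and an operator [A] for the
   fractional part of alpha, which is the identity when alpha is an integer. *)
have [A [c0 [iA NA pA AD]]] : exists (A : (R -> R) -> R -> R) (c0 : R), [/\
    forall g, mu.-integrable D (EFin \o g) -> mu.-integrable D (EFin \o A g),
    exists2 C, 0 <= C & forall g, mu.-integrable D (EFin \o g) -> (Np p (A g) <= C%:E * Np p g)%E,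
    forall g, is_psum a b s g -> is_psum a b s (A g) &
    forall g phi, mu.-integrable D (EFin \o g) -> test_function D phi ->
      \int[mu]_(x in D) (g x * phi x) = (-1) ^+ m *
        (c0 * \int[mu]_(x in D) (iter m (K 1 s) (A g) x * frac_deriv (other s) a b alpha phi x))].
  have [am|am] := eqVneq alpha m%:R.
    exists id, (sg s ^+ m); split => //; first by exists 1 => // g _; rewrite mul1e.
    move=> g phi jg tphi.
    under [in RHS]eq_Rintegral do rewrite /frac_deriv -/m -am eqxx.
    rewrite iterK1_weak_deriv// subnn mulrCA mulrA -mulrA (mulrA _ (sg (other s) ^+ m)).
    by rewrite sg_pow_other mulrA sg_powK mul1r.
  pose sigma := m.+1%:R - alpha.
  have s0 : 0 < sigma by rewrite subr_gt0 truncnS_gt.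
  have s1 : sigma < 1.
    rewrite ltrBlDr -natr1 addrC ltrD2l lt_neqAle eq_sym am/=.
    by rewrite truncn_le// ltW.
  have s1' : 0 < 1 - sigma by rewrite subr_gt0.
  have B0 : 0 < fine (betaI (1 - sigma) sigma).
    apply: fine_gt0; apply/andP; split; first by apply: betaI_gt0; rewrite ?gerBl ltW.
    exact: betaI_fin.
  have G0 : 0 < Gamma sigma by rewrite Gamma_gt0// s0 ltW.
  set B := fine _ in B0.
  (* The order 1 - sigma is alpha - m. The constant offsets the sign in the definition of the weak
     derivative, the 1/Gamma(sigma) of the fractional derivative and the beta constant of Abel's
     identity. *)
  exists (K (1 - sigma) s), ((-1) ^+ m * (Gamma sigma / B)); split.
  - by move=> g jg; apply: integrableS (integrable_K ab s s1' jg) => //; exact: measurable_itv.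
  - exists (cutpk_mass a b (1 - sigma) `^ p); first exact: powR_ge0.
    by move=> g jg; exact: K_Np.
  - by move=> g; exact: is_psum_K.
  - move=> g phi jg tphi.
    have jA : mu.-integrable D (EFin \o K (1 - sigma) s g).
      by apply: integrableS (integrable_K ab s s1' jg) => //; exact: measurable_itv.
    have tn := test_derive1n ab m.+1 tphi; have [M _ tM] := test_bounded ab tn.
    have t1 := test_derive1n ab 1 tphi; have [M1 _ tM1] := test_bounded ab t1.
    have [mKn bKn] := bounded_K ab (other s) s0 (test_measurable tn) (ex_intro _ M tM).
    have [mK1 bK1] := bounded_K ab (other s) s0 (test_measurable t1) (ex_intro _ M1 tM1).
    transitivity ((-1) ^+ m * ((-1) ^+ m * (Gamma sigma / B) *
       (sg (other s) ^+ m.+1 * (Gamma sigma)^-1 *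
        \int[mu]_(x in D) (iter m (K 1 s) (K (1 - sigma) s g) x * K sigma (other s) (derive1n m.+1 phi) x)))); last first.
      congr (_ * (_ * _)); rewrite -RintegralZl; [|exact: measurable_itv|].
        by apply: eq_Rintegral => x /set_mem xD; rewrite (frac_derivE ab)// mulrCA -!mulrA.
      apply: (@integrable_mul_bounded (iter m (K 1 s) (K (1 - sigma) s g)) (K sigma (other s) (derive1n m.+1 phi))).
      - exact: (integrable_iterK ab s m ltr01 jA).
      - exact: (measurable_funTS mKn).
      - by have [N bN] := bKn; exists N.
    rewrite iterK_transpose//.
    have -> : \int[mu]_(x in D) (K (1 - sigma) s g x * iter m (K 1 (other s)) (K sigma (other s) (derive1n m.+1 phi)) x) =
      sg (other s) ^+ m * (B * (sg (other s) * \int[mu]_(x in D) (g x * phi x))).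
      transitivity (sg (other s) ^+ m * \int[mu]_(x in D) (K (1 - sigma) s g x * K sigma (other s) (derive1n 1 phi) x)).
        rewrite -RintegralZl; [|exact: measurable_itv|]; last first.
          apply: (@integrable_mul_bounded (K (1 - sigma) s g) (K sigma (other s) (derive1n 1 phi)) jA (measurable_funTS mK1)).
          by have [N bN] := bK1; exists N.
        apply: eq_Rintegral => x /set_mem xD; rewrite mulrCA; congr (_ * _).
        by rewrite -addn1 iter_K1_frac.
      congr (_ * _); rewrite K_transpose_D//.
      rewrite -RintegralZl; [|exact: measurable_itv|exact: integrable_mul_test].
      rewrite -RintegralZl; [|exact: measurable_itv|exact/integrableZ_D/integrable_mul_test].
      apply: eq_Rintegral => x /set_mem xD.
      rewrite (K_comp ab)//; last by apply: (test_integrable ab); exact: t1.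
      by rewrite K1_test// -/B; ring.
    set I := \int[mu]_(x in D) _.
    transitivity (((-1) ^+ m * (-1) ^+ m) * (sg (other s) ^+ m * sg (other s) ^+ m) *
       (sg (other s) * sg (other s)) * (Gamma sigma / Gamma sigma) * (B / B) * I); last first.
      by rewrite exprS; ring.
    have N1 : (-1) ^+ m * (-1) ^+ m = 1 :> R by rewrite -exprMn mulrNN mulr1 expr1n.
    by rewrite N1 sg_powK sgK !divff ?gt_eqF// !mul1r.
(* Each differentiation removes one [K 1 s] and leaves a factor [sg s]. *)
exists (fun k g x => c0 * (sg s ^+ k * iter (m - k) (K 1 s) (A g) x)); split.
- move=> k g _ jg; do 2 apply: integrableZ_D.
  exact: (integrable_iterK ab s (m - k) ltr01 (iA g jg)).
- move=> k g phi km jg tphi; rewrite subn0.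
  have jAg := iA g jg.
  transitivity (c0 * (sg s ^+ k * \int[mu]_(x in D) (iter (m - k) (K 1 s) (A g) x * phi x))).
    rewrite -RintegralZl; [|exact: measurable_itv|exact: (integrable_mul_test (integrable_iterK ab s (m - k) ltr01 jAg))].
    rewrite -RintegralZl; [|exact: measurable_itv|exact: (integrableZ_D _ (integrable_mul_test (integrable_iterK ab s (m - k) ltr01 jAg) tphi))].
    by apply: eq_Rintegral => x _; rewrite -!mulrA.
  transitivity ((-1) ^+ k * (c0 * \int[mu]_(x in D) (iter m (K 1 s) (A g) x * derive1n k phi x))); last first.
    congr (_ * _); rewrite -RintegralZl; [|exact: measurable_itv|].
      by apply: eq_Rintegral => x _; rewrite expr0 mul1r mulrA.
    by apply: integrable_mul_test; [exact: (integrable_iterK ab s m ltr01 jAg)|exact: test_derive1n].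
  by rewrite iterK1_weak_deriv// -(sg_pow_other s k); ring.
- move=> g phi jg tphi; rewrite (AD g phi)//; congr (_ * _); rewrite subn0.
  under [in RHS]eq_Rintegral do rewrite expr0 mul1r -mulrA.
  have [mfr bfr] := frac_deriv_bounded (other s) a0 tphi.
  rewrite RintegralZl//.
  exact: (integrable_mul_bounded (integrable_iterK ab s m ltr01 (iA g jg)) mfr bfr).
- have [C C0 HC] := NA.
  pose Ck k : R := xget 0 [set C' | 0 <= C' /\ forall g, mu.-integrable D (EFin \o g) ->
    (Np p (iter (m - k) (K 1 s) g) <= C'%:E * Np p g)%E].
  have CkP k : 0 <= Ck k /\ forall g, mu.-integrable D (EFin \o g) ->
      (Np p (iter (m - k) (K 1 s) g) <= (Ck k)%:E * Np p g)%E.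
    have [C' C'0 HC'] := @iterK_Np 1 s p (m - k) ltr01 p1.
    exact: (@xgetPex _ 0 [set C' | 0 <= C' /\ forall g, mu.-integrable D (EFin \o g) ->
      (Np p (iter (m - k) (K 1 s) g) <= C'%:E * Np p g)%E] (ex_intro _ C' (conj C'0 HC'))).
  exists (`|c0| `^ p * ((\sum_(k < m.+1) Ck k) * C)) => k g km jg.
  have jk := integrable_iterK ab s (m - k) ltr01 (iA g jg).
  rewrite NpZ//; last by apply: integrable_measurable; exact: integrableZ_D.
  rewrite NpZ//; last exact: integrable_measurable.
  have -> : `|sg s ^+ k| = 1 :> R by rewrite normrX norm_sg expr1n.
  rewrite powR1 mul1e EFinM -muleA; apply: lee_wpmul2l; first by rewrite lee_fin powR_ge0.
  apply: le_trans ((CkP k).2 _ (iA g jg)) _; rewrite EFinM -muleA.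
  apply: lee_pmul; [by rewrite lee_fin; case: (CkP k)|exact: Np_ge0| |exact: HC].
  rewrite lee_fin (bigD1 (Ordinal (km : (k < m.+1)%N)))//= lerDl.
  by apply: sumr_ge0 => i _; case: (CkP i).
- move=> g pg; rewrite subn0; do 2 apply: is_psumZ.
  by apply: is_psum_iterK => //; exact: pA.
Qed.

End SolutionOperator.

(** * L^p spaces on a bounded interval *)

Section LebesgueSpaces.
Context {R : realType} (a b : R).
Hypothesis ab : a < b.
Notation mu := (@lebesgue_measure R).
Notation D := (`]a, b[%classic : set R).
Implicit Types (f g h u v w : R -> R) (p e : R).
Local Notation Np := (Np a b).

Let mD : measurable (D : set (measurableTypeR R)).
Proof. exact: measurable_itv. Qed.

Let mP p h : measurable_fun D h -> measurable_fun D (fun x => (`|h x| `^ p)%:E).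
Proof.
by move=> mh; apply/measurable_EFinP; apply: (measurableT_comp (measurable_powR _)); exact: measurableT_comp.
Qed.

Lemma NpE p f : 0 < p -> Np p f = (\int[mu]_(x in D) (`|f x| `^ p)%:E)%E.
Proof.
move=> p0; rewrite /Np [RHS]integral_mkcond; apply: eq_integral => x _.
by rewrite !patchE; case: ifP => // _; rewrite normr0 powR0// gt_eqF.
Qed.

Lemma Lp_normE p f : 0 < p -> Lp_norm D p f = (Np p f `^ p^-1)%E.
Proof.
move=> p0; rewrite /Lp_norm unlock/=; congr (_ `^ _)%E.
Qed.

Lemma Lp_norm_pow p f : 0 < p -> (Lp_norm D p f `^ p)%E = Np p f.
Proof. by move=> p0; rewrite Lp_normE// -poweRrM mulVf ?gt_eqF// poweRe1// Np_ge0. Qed.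

Lemma LpP p f : 0 < p -> Lp D p f <-> measurable_fun D f /\ (Np p f < +oo)%E.
Proof.
move=> p0.
have fin : ('N[mu]_p%:E[EFin \o f \_ D] < +oo)%E <-> (Np p f < +oo)%E.
  rewrite -[X in (X < _)%E]/(Lp_norm D p f); split => [|].
    by rewrite -(Lp_norm_pow f p0) => ?; rewrite poweR_lty.
  by rewrite Lp_normE// => ?; rewrite poweR_lty.
rewrite /Lp /=; split.
  case/andP; rewrite !inE/= => mf fp; split; last exact/fin.
  exact: (measurable_restrictT _ _).2 mf.
move=> [mf fp]; apply/andP; rewrite !inE/=; split; last exact/fin.
exact: measurable_restrict_D.
Qed.

Lemma eq_Np p f g : (forall x, D x -> f x = g x) -> Np p f = Np p g.
Proof.
move=> fg; apply: eq_integral => x _; rewrite !patchE.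
by case: ifP => // /set_mem xD; rewrite fg.
Qed.

Lemma ae_eq_Np p f g : 0 < p -> measurable_fun D f -> measurable_fun D g ->
  {ae mu, forall x, D x -> f x = g x} -> Np p f = Np p g.
Proof.
move=> p0 mf mg fg; rewrite (NpE f p0) (NpE g p0); apply: (ae_eq_integral _ _ mD (mP p mf) (mP p mg)).
by apply: (@filterS _ _ (ae_filter_ringOfSetsType mu)) fg => x /[apply] ->.
Qed.

Lemma NpN p f : Np p (- f) = Np p f.
Proof.
apply: eq_integral => x _; rewrite !patchE; case: ifP => // _.
by rewrite -[(- f) x]/(- f x) normrN.
Qed.

Lemma NpBC p f g : Np p (f - g) = Np p (g - f).
Proof. by rewrite -opprB NpN. Qed.

Lemma NpD p f g : 0 < p -> measurable_fun D f -> measurable_fun D g ->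
  (Np p (f + g)%R <= (2 `^ p)%:E * (Np p f + Np p g))%E.
Proof.
move=> p0 mf mg; rewrite !NpE//.
rewrite -ge0_integralD//; [|exact: mP|exact: mP].
rewrite -ge0_integralZl//; [|by apply: emeasurable_funD; exact: mP|by move=> x _; rewrite adde_ge0].
apply: ge0_le_integral => //.
- by apply: mP; exact: measurable_funD.
- by apply: measurable_funeM; apply: emeasurable_funD; exact: mP.
- move=> x xD; rewrite -EFinD -EFinM lee_fin.
  have p0' := ltW p0.
  have [fg|gf] := leP `|f x| `|g x|.
    apply: (@le_trans _ _ ((2 * `|g x|) `^ p)).
      rewrite ge0_ler_powR ?nnegrE ?mulr_ge0//.
      by apply: (le_trans (ler_normD (f x) (g x))); rewrite mulr_natl mulr2n lerD.
    by rewrite powRM// ler_wpM2l ?powR_ge0// lerDr powR_ge0.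
  apply: (@le_trans _ _ ((2 * `|f x|) `^ p)).
    rewrite ge0_ler_powR ?nnegrE ?mulr_ge0//.
    by apply: (le_trans (ler_normD (f x) (g x))); rewrite mulr_natl mulr2n lerD// ltW.
  by rewrite powRM// ler_wpM2l ?powR_ge0// lerDl powR_ge0.
Qed.

Lemma NpB_trans p f g h : 0 < p -> measurable_fun D f -> measurable_fun D g ->
  measurable_fun D h ->
  (Np p (f - h)%R <= (2 `^ p)%:E * (Np p (f - g)%R + Np p (g - h)%R))%E.
Proof.
move=> p0 mf mg mh; rewrite -(subrKA g).
by apply: NpD => //; exact: measurable_funB.
Qed.

(** Pointwise |f| <= lam + lam^(1-p) |f|^p, according to whether |f| is below or above lam. The free
    parameter makes L^1 smallness follow from L^p smallness in [L1_small], without Hoelder's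
    inequality. *)
Lemma L1_le_Np p lam f : 1 <= p -> 0 < lam -> measurable_fun D f ->
  (\int[mu]_(x in D) `|f x|%:E <= (lam * (b - a))%:E + (lam `^ (1 - p))%:E * Np p f)%E.
Proof.
move=> p1 l0 mf; have p0 : 0 < p by exact: lt_le_trans p1.
have -> : (lam * (b - a))%:E = (\int[mu]_(x in D) (cst lam%:E) x)%E.
  rewrite integral_cst// EFinM; congr (_ * _)%E.
  by transitivity (mu `]a, b[%classic); [rewrite lebesgue_measure_itv/= lte_fin ab|].
rewrite NpE// -ge0_integralZl//; [|exact: (mP p mf)|by rewrite lee_fin powR_ge0].
rewrite -ge0_integralD//; last first.
- by apply: measurable_funeM; exact: (mP p mf).
- by move=> x _; rewrite mule_ge0// lee_fin powR_ge0.
- by move=> x _; rewrite lee_fin ltW.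
apply: ge0_le_integral => //.
- by apply/measurable_EFinP; exact: measurableT_comp.
- by apply: emeasurable_funD => //; apply: measurable_funeM; exact: (mP p mf).
move=> x xD; rewrite -EFinM -EFinD lee_fin.
have [fl|lf] := leP `|f x| lam.
  by apply: le_trans fl _; rewrite lerDl mulr_ge0 ?powR_ge0.
apply: ler_wpDl; first exact: ltW.
have f0 : 0 < `|f x| by exact: lt_trans lf.
rewrite -{1}(powRr1 (ltW f0)) -{1}(subrK p 1) powRD; last by rewrite (gt_eqF f0) implybT.
rewrite ler_wpM2r ?powR_ge0// -(opprB p 1) !powRN lef_pV2 ?posrE ?powR_gt0//.
by apply: ge0_ler_powR; rewrite ?nnegrE ?subr_ge0 // ltW.
Qed.

Lemma Lp_integrable p f : 1 <= p -> measurable_fun D f -> (Np p f < +oo)%E ->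
  mu.-integrable D (EFin \o f).
Proof.
move=> p1 mf fp; apply/integrableP; split; first exact/measurable_EFinP.
apply: le_lt_trans (L1_le_Np p1 ltr01 mf) _.
by rewrite powR1 mul1e lte_add_pinfty// ltry.
Qed.

Lemma L1_small p e : 1 <= p -> 0 < e -> exists2 d, 0 < d &
  forall f, measurable_fun D f -> (Np p f < d%:E)%E -> (\int[mu]_(x in D) `|f x|%:E < e%:E)%E.
Proof.
move=> p1 e0; have ba : 0 < b - a by rewrite subr_gt0.
pose lam := e / 2 / (b - a); have l0 : 0 < lam by rewrite !divr_gt0.
exists (e / 2 / lam `^ (1 - p)); first by rewrite !divr_gt0// powR_gt0.
move=> f mf fd; apply: le_lt_trans (L1_le_Np p1 l0 mf) _.
rewrite divfK ?gt_eqF// [X in (_ < X%:E)%E]splitr EFinD lteD2lE//.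
by rewrite muleC -lte_pdivlMr ?powR_gt0.
Qed.

End LebesgueSpaces.

(** * Completeness of L^p *)

Section RieszFischer.
Context {R : realType} (a b : R).
Hypothesis ab : a < b.
Notation mu := (@lebesgue_measure R).
Notation D := (`]a, b[%classic : set R).
Implicit Types (f g h u v w : R -> R) (p e lam : R).
Local Notation Np := (Np a b).

Let mD : measurable (D : set (measurableTypeR R)).
Proof. exact: measurable_itv. Qed.

Lemma summable_cvg (x_ : nat -> R) (S : \bar R) : S \is a fin_num ->
  (\sum_(k <oo) `|x_ k.+1 - x_ k|%:E)%E = S -> cvgn x_.
Proof.
move=> Sfin SE.
have -> : x_ = (fun n => x_ 0%N + series (telescope x_) n).
  by apply/funext => n; rewrite -eq_sum_telescope.
apply: is_cvgD; first exact: is_cvg_cst.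
apply: normed_cvg; apply: nondecreasing_is_cvgn.
  by apply: nondecreasing_series => *; exact: normr_ge0.
exists (fine S) => _ [n _ <-]; rewrite -lee_fin fineK// -SE.
rewrite /= -sumEFin.
exact: (@nneseries_lim_ge _ (fun k => `|x_ k.+1 - x_ k|%:E) xpredT).
Qed.

Lemma continuous_norm_powR p : 0 < p -> continuous (fun y : R => `|y| `^ p).
Proof.
move=> p0 y; have [->|y0] := eqVneq y 0.
  rewrite /continuous_at normr0 powR0 ?gt_eqF//.
  apply/cvgrPdist_lt => e e0; have d0 : 0 < e `^ p^-1 by exact: powR_gt0.
  near=> z; have zd : `|0 - z| < e `^ p^-1 by near: z; exact: (nbhsx_ballx (0 : R) _ d0).
  rewrite sub0r normrN ger0_norm ?powR_ge0//.
  have -> : e = (e `^ p^-1) `^ p by rewrite -powRrM mulVf ?gt_eqF// powRr1// ltW.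
  by rewrite gt0_ltr_powR ?nnegrE ?powR_ge0// -(normrN z) -(sub0r z).
apply: (@continuous_comp _ _ _ (@Num.norm _ R) (fun x : R => x `^ p)); first exact: norm_continuous.
apply: differentiable_continuous; apply/derivable1_diffP/derivable_powR.
by rewrite in_itv/= andbT normr_gt0.
Unshelve. all: by end_near. Qed.

(** L^p Cauchy implies L^1 Cauchy on a bounded interval, so a subsequence with summable L^1 steps
    converges almost everywhere; Fatou's lemma then yields the convergence in L^p. *)
Lemma Riesz_Fischer p (u_ : nat -> R -> R) : 1 <= p ->
  (forall n, measurable_fun D (u_ n)) -> (forall n, (Np p (u_ n) < +oo)%E) ->
  (forall e, 0 < e -> exists k, forall i j, (k <= i)%N -> (k <= j)%N -> (Np p (u_ i - u_ j)%R < e%:E)%E) ->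
  exists w, [/\ measurable_fun D w, (Np p w < +oo)%E &
    (forall e, 0 < e -> exists k, forall i, (k <= i)%N -> (Np p (u_ i - w)%R < e%:E)%E)].
Proof.
move=> p1 mu_ fu cu; have p0 : 0 < p by exact: lt_le_trans p1.
have mB i j : measurable_fun D (u_ i - u_ j) by exact: measurable_funB.
have sub k : exists n, forall i j, (n <= i)%N -> (n <= j)%N ->
    (\int[mu]_(x in D) `|u_ i x - u_ j x|%:E < (1 / (2 ^ k.+1)%:R)%:E)%E.
  have e0 : 0 < 1 / (2 ^ k.+1)%:R :> R by rewrite divr_gt0// ltr0n expn_gt0.
  have [d d0 dP] := L1_small ab p1 e0.
  have [n nP] := cu d d0; exists n => i j ni nj.
  exact: (dP (u_ i - u_ j) (mB i j) (nP i j ni nj)).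
have {sub}[n_ n_P] := choice sub.
(* These indices are nondecreasing, and the k-th one exceeds or equals both k and the threshold
   [n_ k]. *)
pose N k := (k + \sum_(j < k.+1) n_ j)%N.
have nN k : (n_ k <= N k)%N by rewrite /N big_ord_recr/= addnA leq_addl.
have NS k : (N k <= N k.+1)%N.
  by rewrite /N [in leqRHS]big_ord_recr/= addnA (leq_trans _ (leq_addr _ _))// leq_add2r.
have kN k : (k <= N k)%N by exact: leq_addr.
pose v_ k := u_ (N k).
pose S x := (\sum_(k <oo) `|v_ k.+1 x - v_ k x|%:E)%E.
have mS k : measurable_fun D (fun x => `|v_ k.+1 x - v_ k x|%:E).
  by apply/measurable_EFinP; apply: measurableT_comp => //; exact: (mB (N k.+1) (N k)).
have S1 : (\int[mu]_(x in D) S x <= 1%:E)%E.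
  rewrite integral_nneseries//.
  apply: le_trans (@epsilon_trick0 R 1 xpredT ler01).
  apply: lee_nneseries => [i _ _|i _]; first by apply: integral_ge0 => x _; rewrite lee_fin.
  by apply/ltW/n_P; [exact: leq_trans (nN i) (NS i)|exact: nN].
have S0 x : (0 <= S x)%E by apply: nneseries_ge0 => n _ _; rewrite lee_fin.
have mSS : measurable_fun D S.
  by apply: ge0_emeasurable_sum => // k x _ _; rewrite lee_fin.
have iS : mu.-integrable D S.
  apply/integrableP; split => //; under eq_integral do rewrite gee0_abs//.
  by apply: le_lt_trans S1 _; exact: ltry.
have cvS : {ae mu, forall x, D x -> cvgn (v_ ^~ x)}.
  apply: (@filterS _ _ (ae_filter_ringOfSetsType mu)) (integrable_ae mD iS) => x /[apply] Sx.
  exact: (@summable_cvg (v_ ^~ x) (S x)).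
(* The upper limit is measurable everywhere and agrees with the limit wherever the latter exists. *)
pose w x := fine (limn_esup (fun k => (v_ k x)%:E)).
have mw : measurable_fun D w.
  apply: (measurableT_comp (fine_measurable measurableT)).
  by apply: measurable_fun_limn_esup => k; apply/measurable_EFinP; exact: mu_.
have cvw : {ae mu, forall x, D x -> v_ k x @[k --> \oo] --> w x}.
  apply: (@filterS _ _ (ae_filter_ringOfSetsType mu)) cvS => x /[apply] /cvg_ex[l vl].
  suff -> : w x = l by [].
  have cE : (v_ k x)%:E @[k --> \oo] --> l%:E by apply: cvg_EFin => //; exact: nearW.
  by rewrite /w is_cvg_limn_esupE; [rewrite (cvg_lim _ cE)|apply: cvgP cE].
have mP h : measurable_fun D h -> measurable_fun D (fun x => (`|h x| `^ p)%:E).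
  by move=> mh; apply/measurable_EFinP; apply: (measurableT_comp (measurable_powR _)); exact: measurableT_comp.
have wP e : 0 < e -> exists k, forall i, (k <= i)%N -> (Np p (u_ i - w)%R < e%:E)%E.
  move=> e0; have e20 : 0 < e / 2 by rewrite divr_gt0.
  have [k kP] := cu _ e20; exists k => i ki.
  apply: (@le_lt_trans _ _ (e / 2)%:E); last by rewrite lte_fin ltr_pdivrMr// ltr_pMr// ltr1n.
  rewrite NpE//.
  have -> : (\int[mu]_(x in D) (`|(u_ i - w) x| `^ p)%:E =
             \int[mu]_(x in D) limn_einf (fun j => (`|u_ i x - v_ j x| `^ p)%:E))%E.
    apply: ae_eq_integral => //.
    - by apply: mP; exact: measurable_funB.
    - apply: (@measurableT_comp _ _ _ _ _ _ -%E _ (fun x => limn_esup (fun j => - (`|u_ i x - v_ j x| `^ p)%:E)%E)); first exact: oppe_measurable.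
      apply: (@measurable_fun_limn_esup _ _ _ D (fun j x => - (`|u_ i x - v_ j x| `^ p)%:E)%E) => j.
      by apply: measurableT_comp => //; exact: (mP _ (mB i (N j))).
    apply: (@filterS _ _ (ae_filter_ringOfSetsType mu)) cvw => x /[apply] vx.
    have cE : (`|u_ i x - v_ j x| `^ p)%:E @[j --> \oo] --> (`|u_ i x - w x| `^ p)%:E.
      apply: cvg_EFin; first exact: nearW.
      have cB : u_ i x - v_ j x @[j --> \oo] --> u_ i x - w x by apply: cvgB => //; exact: cvg_cst.
      exact: (cvg_comp _ _ cB (@continuous_norm_powR p p0 (u_ i x - w x))).
    by rewrite is_cvg_limn_einfE; [rewrite (cvg_lim _ cE)|apply: cvgP cE].
  (* Fatou along the subsequence, with the index i fixed; the Cauchy condition bounds the lower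
     limit by e / 2. *)
  apply: le_trans (@fatou _ _ _ mu D mD (fun j x => (`|u_ i x - v_ j x| `^ p)%:E) _ _) _.
  - by move=> j; exact: (mP _ (mB i (N j))).
  - by move=> j x _; rewrite lee_fin powR_ge0.
  rewrite limn_einf_lim; apply: lime_le; first exact: is_cvg_einfs.
  exists k => // j /= kj.
  apply: (@le_trans _ _ (Np p (u_ i - v_ j)%R)).
    by apply: ereal_inf_lbound; exists j; [exact: leqnn|rewrite NpE].
  by apply/ltW/kP => //; exact: leq_trans (kN j).
exists w; split => //.
have [k kP] := wP 1 ltr01.
have := NpD p0 (mu_ k) (measurable_funB mw (mu_ k)).
rewrite addrC subrK => /le_lt_trans; apply.
rewrite lte_mul_pinfty ?lee_fin ?powR_ge0// lte_add_pinfty// NpBC.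
by apply: lt_trans (kP k (leqnn k)) _; exact: ltry.
Qed.

End RieszFischer.

(** * Bernstein polynomials *)

Section Bernstein.
Context {R : realType}.
Implicit Types (n k : nat) (t e A B C M : R) (x y : nat -> R).

(* [bernstein n x] is the Bernstein polynomial \sum_k 'C(n, k) t^k (1 - t)^(n-k) x k. *)
Fixpoint bernstein n x t : R :=
  if n is n'.+1 then t * bernstein n' (fun k => x k.+1) t + (1 - t) * bernstein n' x t
  else x 0%N.

Lemma le_bernstein n x y t : 0 <= t <= 1 -> (forall k, x k <= y k) ->
  bernstein n x t <= bernstein n y t.
Proof.
move=> /andP[t0 t1]; elim: n x y => [|n IH] x y xy //=.
by apply: lerD; apply: ler_wpM2l; rewrite ?subr_ge0//; apply: IH => // k; exact: xy.
Qed.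

(** The first moments of the binomial law: mean n t and variance n t (1 - t). *)
Lemma bernstein_quadratic n A B C t :
  bernstein n (fun k => A + B * k%:R + C * k%:R ^+ 2) t =
  A + B * (n%:R * t) + C * (n%:R * t * (1 - t) + (n%:R * t) ^+ 2).
Proof.
elim: n A B C => [|n IH] A B C /=; first by ring.
rewrite IH (_ : (fun k => _) = (fun k : nat => (A + B + C) + (B + 2 * C) * k%:R + C * k%:R ^+ 2)).
  by rewrite IH -natr1; ring.
by apply/funext => k; rewrite -natr1; ring.
Qed.

(** The operator is monotone and exact on quadratics, so the data are squeezed between two parabolas
    in k; the variance term is at most C/(n + 1). *)
Lemma bernstein_near n x t c e C : 0 <= t <= 1 -> 0 <= C ->
  (forall k, `|x k - c| <= e + C * (k%:R / n.+1%:R - t) ^+ 2) ->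
  `|bernstein n.+1 x t - c| <= e + C / n.+1%:R.
Proof.
move=> t01 C0 xc; have n0 : n.+1%:R != 0 :> R by rewrite pnatr_eq0.
have q (r r' : R) : bernstein n.+1 (fun k => r + r' * (e + C * (k%:R / n.+1%:R - t) ^+ 2)) t
    = r + r' * (e + C * (t * (1 - t)) / n.+1%:R).
  rewrite (_ : (fun k => _) = (fun k : nat => (r + r' * e + r' * C * t ^+ 2) +
      (- (2 * r' * C * t) / n.+1%:R) * k%:R + (r' * C / n.+1%:R ^+ 2) * k%:R ^+ 2)).
    by rewrite bernstein_quadratic; field.
  by apply/funext => k; field.
have tt1 : C * (t * (1 - t)) / n.+1%:R <= C / n.+1%:R.
  rewrite ler_wpM2r ?invr_ge0// ler_piMr//.
  by case/andP: t01 => t0 t1; rewrite mulr_ile1 ?subr_ge0// gerBl.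
apply: (@le_trans _ _ (e + C * (t * (1 - t)) / n.+1%:R)); last by rewrite lerD2l.
rewrite ler_distl; apply/andP; split.
  have := @le_bernstein n.+1 (fun k => c + (-1) * (e + C * (k%:R / n.+1%:R - t) ^+ 2)) x t t01.
  rewrite q mulN1r; apply => k.
  by move: (xc k); rewrite ler_distl mulN1r => /andP[].
have := @le_bernstein n.+1 x (fun k => c + 1 * (e + C * (k%:R / n.+1%:R - t) ^+ 2)) t t01.
rewrite q mul1r; apply => k.
by move: (xc k); rewrite ler_distl mul1r => /andP[].
Qed.

Lemma bernstein_bounded n x t M : 0 <= t <= 1 -> (forall k, `|x k| <= M) ->
  `|bernstein n x t| <= M.
Proof.
move=> t01 xM; have q r : bernstein n (fun=> r) t = r.
  transitivity (r + 0 * (n%:R * t) + 0 * (n%:R * t * (1 - t) + (n%:R * t) ^+ 2)); last by ring.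
  rewrite -bernstein_quadratic; congr bernstein.
  by apply/funext => k; ring.
rewrite ler_norml; apply/andP; split.
  rewrite -(q (- M)); apply: le_bernstein => // k.
  by move: (xM k); rewrite ler_norml => /andP[].
rewrite -[leRHS]q; apply: le_bernstein => // k.
by move: (xM k); rewrite ler_norml => /andP[].
Qed.

(** Within distance d of t continuity bounds the oscillation by e/2; farther away the bound 2 M is
    absorbed by a parabola with coefficient 2 M / d^2. Pointwise convergence is enough, as dominated
    convergence follows. *)
Lemma cvg_bernstein (h : R -> R) M t : 0 <= t <= 1 -> (forall r : R, `|h r| <= M) ->
  {for t, continuous h} -> bernstein n.+1 (fun k => h (k%:R / n.+1%:R)) t @[n --> \oo] --> h t.
Proof.
move=> t01 hM ch; have M0 : 0 <= M by exact: le_trans (hM 0).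
apply/cvgrPdist_le => e e0; have e20 : 0 < e / 2 by rewrite divr_gt0.
have /cvgrPdist_le/(_ _ e20) /nbhs_ballP[d /= d0 dP] := ch.
pose C := 2 * M / d ^+ 2.
have C0 : 0 <= C by apply: divr_ge0; [exact: mulr_ge0|exact: sqr_ge0].
have hC (y : R) : `|h y - h t| <= e / 2 + C * (y - t) ^+ 2.
  have [yt|yt] := ltP `|t - y| d.
    by rewrite distrC; apply: le_trans (dP y yt) _; rewrite lerDl mulr_ge0// sqr_ge0.
  apply: (@le_trans _ _ (2 * M)).
    by apply: (le_trans (ler_normB _ _)); rewrite mulr_natl mulr2n lerD.
  apply: ler_wpDl; first exact: ltW.
  rewrite /C mulrAC ler_pdivlMr ?exprn_gt0// ler_wpM2l ?mulr_ge0//.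
  by rewrite -[leRHS]ger0_norm ?sqr_ge0// normrX distrC lerXn2r ?nnegrE// ltW.
have cn : C / n.+1%:R @[n --> \oo] --> 0.
  by rewrite -(mulr0 C); apply: cvgMr; exact: cvg_harmonic.
have /cvgrPdist_le/(_ _ e20) := cn; apply: filterS => n.
rewrite sub0r normrN ger0_norm; last by apply: divr_ge0.
move=> nC.
rewrite distrC; apply: le_trans (bernstein_near t01 C0 (fun k => hC _)) _.
by rewrite [leRHS]splitr lerD2l.
Qed.

End Bernstein.

(** * Convergence to zero in the extended reals, and truncation of values *)

Lemma cvg0_ereal_lt (R : realType) (x_ : nat -> \bar R) (e : R) : x_ n @[n --> \oo] --> 0%E -> 0 < e ->
  exists k, forall n, (k <= n)%N -> (x_ n < e%:E)%E.
Proof.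
move=> cx e0; have := cx _ (@open_ereal_lt' _ 0%E e%:E _).
by rewrite lte_fin => /(_ e0) [k _ kP]; exists k.
Qed.

Lemma cvg_ereal_lt0 (R : realType) (x_ : nat -> \bar R) : (forall n, (0 <= x_ n)%E) ->
  (forall e : R, 0 < e -> exists k, forall n, (k <= n)%N -> (x_ n < e%:E)%E) ->
  x_ n @[n --> \oo] --> 0%E.
Proof.
move=> x0 cx; apply/fine_cvgP; split.
  have [k kP] := cx 1 ltr01; exists k => // n /= kn.
  by rewrite ge0_fin_numE//; apply: lt_trans (kP n kn) _; exact: ltry.
apply/cvgrPdist_lt => e e0; have [k kP] := cx e e0; exists k => // n /= kn.
have nf : x_ n \is a fin_num by rewrite ge0_fin_numE//; apply: lt_trans (kP n kn) _; exact: ltry.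
by rewrite sub0r normrN ger0_norm ?fine_ge0// -lte_fin fineK// kP.
Qed.

Section Clip.
Context {R : realType}.
Implicit Types M x y : R.

Definition clip M x : R := Num.max (- M) (Num.min M x).

Lemma norm_clip M x : 0 <= M -> `|clip M x| <= M.
Proof.
move=> M0; rewrite ler_norml /clip le_max lexx/= ge_max ge_min lexx/= andbT.
by rewrite ge0_cp.
Qed.

Lemma clip_id M x : `|x| <= M -> clip M x = x.
Proof. by rewrite ler_norml /clip => /andP[Mx xM]; rewrite (min_idPr xM) (max_idPr Mx). Qed.

Lemma dist_clip_le M x y : `|clip M x - clip M y| <= `|x - y|.
Proof.
rewrite /clip; wlog xy : x y / x <= y => [H|].
  by have [/H//|/ltW/H] := leP x y; rewrite (distrC y) (distrC (Num.max _ _)).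
rewrite (distrC x) (ger0_norm (_ : 0 <= y - x)) ?subr_ge0//.
rewrite ler_norml; case: (leP M x) => ?; case: (leP M y) => ?;
  do ![case: (leP (- M)) => ?]; apply/andP; split; lra.
Qed.

Lemma norm_sub_clip M x : 0 <= M -> `|x - clip M x| <= `|x|.
Proof.
move=> M0; rewrite /clip; have [x0|x0] := leP 0 x.
  rewrite [leRHS]ger0_norm// ler_norml; case: (leP M x) => ?;
  do ![case: (leP (- M)) => ?]; apply/andP; split; lra.
rewrite [leRHS]ltr0_norm// ler_norml; case: (leP M x) => ?;
do ![case: (leP (- M)) => ?]; apply/andP; split; lra.
Qed.

Lemma continuous_clip M : continuous (clip M).
Proof.
move=> x; apply/cvgrPdist_lt => e e0; near=> y.
by apply: le_lt_trans (dist_clip_le _ _ _) _; near: y; exact: (nbhsx_ballx x _ e0).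
Unshelve. all: by end_near. Qed.

End Clip.


(** * Density of power sums in L^p *)

Section Density.
Context {R : realType} (a b : R).
Hypothesis ab : a < b.
Notation mu := (@lebesgue_measure R).
Notation D := (`]a, b[%classic : set R).
Implicit Types (s : side) (f g h u v w : R -> R) (p e lam : R).
Local Notation Np := (Np a b).
Local Notation psum := (psum a b).
Local Notation is_psum := (is_psum a b).

Let mD : measurable (D : set (measurableTypeR R)).
Proof. exact: measurable_itv. Qed.

Let mP p h : measurable_fun D h -> measurable_fun D (fun x => (`|h x| `^ p)%:E).
Proof.
by move=> mh; apply/measurable_EFinP; apply: (measurableT_comp (measurable_powR _)); exact: measurableT_comp.
Qed.

Lemma Np_dominated p (f_ : nat -> R -> R) f g e : 0 < p -> 0 < e ->
  (forall n, measurable_fun D (f_ n)) -> measurable_fun D f -> measurable_fun D g ->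
  (forall x, D x -> f_ n x @[n --> \oo] --> f x) ->
  (forall n x, D x -> `|f x - f_ n x| <= `|g x|) -> (Np p g < +oo)%E ->
  exists n, (Np p (f - f_ n)%R < e%:E)%E.
Proof.
move=> p0 e0 mf_ mf mg cf fg gp.
have mB n : measurable_fun D (f - f_ n) by exact: measurable_funB.
have [_ _ cv] : [/\ mu.-integrable D (cst 0%E),
    (\int[mu]_(x in D) `|(`|(f - f_ n) x| `^ p)%:E - cst 0%E x| @[n --> \oo] --> 0)%E &
    (\int[mu]_(x in D) (`|(f - f_ n) x| `^ p)%:E @[n --> \oo] --> \int[mu]_(x in D) cst 0%E x)%E].
  apply: (@dominated_convergence _ _ _ mu D mD (fun n x => (`|(f - f_ n) x| `^ p)%:E) (cst 0%E)
    (fun x => (`|g x| `^ p)%:E)) => //.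
  - by move=> n; exact: mP.
  - apply: aeW => x xD; apply: cvg_EFin; first exact: nearW.
    have cB : f x - f_ n x @[n --> \oo] --> (0 : R).
      by rewrite -(subrr (f x)); apply: cvgB; [exact: cvg_cst|exact: cf].
    have := cvg_comp _ _ cB (@continuous_norm_powR R p p0 0).
    by rewrite /= normr0 powR0 ?gt_eqF.
  - apply/integrableP; split; first exact: mP.
    suff -> : (\int[mu]_(x in D) `|(`|g x| `^ p)%:E| = Np p g)%E by [].
    by rewrite NpE//; apply: eq_integral => x _; rewrite gee0_abs// lee_fin powR_ge0.
  - apply: aeW => x n xD /=; rewrite lee_fin ger0_norm ?powR_ge0//.
    by rewrite (ge0_ler_powR (ltW p0)) ?nnegrE//; exact: fg.
rewrite integral_cst// mul0e in cv.
have [k kP] := cvg0_ereal_lt cv e0; exists k.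
by have := kP k (leqnn k); rewrite -NpE.
Qed.

Lemma Np_cst p c : 0 < p -> (Np p (cst c) < +oo)%E.
Proof.
move=> p0; rewrite NpE// /= integral_cst//.
rewrite lte_mul_pinfty ?lee_fin ?powR_ge0//.
by rewrite -[X in (X < _)%E]/(mu `]a, b[%classic) lebesgue_measure_itv/= lte_fin ab ltry.
Qed.

(** Power sums are closed under multiplication by the distance to the base, so the recursion for
    [bernstein] stays among them. *)
Lemma is_psum_bernstein s c n y : is_psum s (fun x => bernstein n y (c * dist_base a b s x)).
Proof.
elim: n y => [|n IH] y.
  apply: eq_is_psum (is_psumZ (y 0%N) (is_psum_dist_base a b s 0)) => x _.
  by rewrite /= expr0 mulr1.
pose f x := c * (dist_base a b s x * bernstein n (fun k => y k.+1) (c * dist_base a b s x)).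
pose g x := (-1) * (c * (dist_base a b s x * bernstein n y (c * dist_base a b s x))).
apply: (@eq_is_psum _ _ _ _ ((f \+ g) \+ (fun x => bernstein n y (c * dist_base a b s x)))).
  by move=> x _; rewrite /= /f /g; ring.
apply: is_psumD => //; apply: is_psumD; first exact/is_psumZ/is_psum_mul_dist.
exact/is_psumZ/is_psumZ/is_psum_mul_dist.
Qed.

Definition psum_approx s p f :=
  forall e, 0 < e -> exists2 l, all (fun i => 0 < i.2) l & (Np p (f - psum s l)%R < e%:E)%E.

Lemma psum_approx_lim s p f : 0 < p -> measurable_fun D f ->
  (forall e, 0 < e -> exists g, [/\ measurable_fun D g, psum_approx s p g & (Np p (f - g)%R < e%:E)%E]) ->
  psum_approx s p f.
Proof.
move=> p0 mf fg e e0; pose c : R := 2 `^ p; have c0 : 0 < c by exact: powR_gt0.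
have d0 : 0 < e / 2 / c by rewrite !divr_gt0.
have [g [mg ag fgd]] := fg _ d0; have [l l0 gl] := ag _ d0; exists l => //.
apply: le_lt_trans (NpB_trans p0 mf mg _) _.
  by apply: measurable_funTS; exact: measurable_psum.
apply: (@lt_le_trans _ _ (c%:E * ((e / 2 / c)%:E + (e / 2 / c)%:E))%E); last first.
  by rewrite -EFinD -EFinM lee_fin mulrDr !(mulrC c) !divfK ?gt_eqF// -splitr.
by rewrite lte_pmul2l//; exact: lteD fgd gl.
Qed.

(** Bernstein polynomials in the distance to the base, rescaled to [0,1], are power sums. They
    converge pointwise and stay below M, so they converge in L^p. *)
Lemma psum_approx_continuous s p h M : 1 <= p -> continuous h -> (forall r, `|h r| <= M) ->
  psum_approx s p h.
Proof.
move=> p1 ch hM e e0; have p0 : 0 < p by exact: lt_le_trans p1.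
have ba : 0 < b - a by rewrite subr_gt0.
pose k t := h (base a b s + sg s * (b - a) * t).
pose P n x := bernstein n.+1 (fun j => k (j%:R / n.+1%:R)) ((b - a)^-1 * dist_base a b s x).
have pP n : is_psum s (P n) by exact: is_psum_bernstein.
have t01 x : D x -> 0 <= (b - a)^-1 * dist_base a b s x <= 1.
  move=> xD; apply/andP; split.
    by rewrite mulr_ge0// ?invr_ge0 ltW// dist_base_gt0.
  rewrite mulrC ler_pdivrMr// mul1r.
  by move: xD; rewrite /= in_itv/= => /andP[ax xb]; have ab' := ab; rewrite /dist_base; clear k P pP; case: s => /=; lra.
have [||||||n nP] := @Np_dominated p P h (cst (2 * M)) e p0 e0.
- move=> n; have [l _ Pl] := pP n; apply: (@eq_measurable_fun _ _ _ _ _ (psum s l)).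
    by move=> x /set_mem xD; rewrite Pl.
  by apply: measurable_funTS; exact: measurable_psum.
- by apply: measurable_funTS; exact: continuous_measurable.
- by [].
- move=> x xD.
  have -> : h x = k ((b - a)^-1 * dist_base a b s x).
    rewrite /k /dist_base; congr h.
    transitivity (base a b s + (sg s * sg s) * ((b - a) / (b - a)) * (x - base a b s)); last by ring.
    by rewrite sgK divff ?gt_eqF// !mul1r addrC subrK.
  apply: (@cvg_bernstein _ k M); [exact: t01|by move=> r; exact: hM|].
  suff ck : continuous (h \o (fun t => base a b s + sg s * (b - a) * t)) by exact: ck.
  move=> t; apply: continuous_comp; last exact: ch.
  by apply: cvgD; [exact: cvg_cst|apply: cvgMr; exact: cvg_id].
- move=> n x xD; have M0 : 0 <= M by exact: le_trans (hM 0).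
  rewrite (ger0_norm (_ : 0 <= 2 * M)) ?mulr_ge0// mulr_natl mulr2n.
  apply: le_trans (ler_normB _ _) _; apply: lerD => //.
  by apply: bernstein_bounded; [exact: t01|by move=> j; exact: hM].
- exact: Np_cst.
have [l l0 Pl] := pP n; exists l; first exact: l0.
have -> : Np p (h - psum s l) = Np p (h - P n) by apply: eq_Np => x xD; rewrite !fctE Pl.
exact: nP.
Qed.

(** Continuous approximants in L^1, clipped at M, are also close in L^p, since |f - g|^p <= (2
    M)^(p-1) |f - g| when both are bounded by M. *)
Lemma psum_approx_bounded s p f M : 1 <= p -> 0 <= M -> measurable_fun D f ->
  (forall x, D x -> `|f x| <= M) -> psum_approx s p f.
Proof.
move=> p1 M0 mf fM; have p0 : 0 < p by exact: lt_le_trans p1.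
apply: psum_approx_lim => // e e0.
have jf : mu.-integrable D (EFin \o f) by exact: (@bounded_integrable_D _ _ _ f M).
have Dfin : (mu (D : set (measurableTypeR R)) < +oo)%E.
  by rewrite -[X in (X < _)%E]/(mu `]a, b[%classic) lebesgue_measure_itv/= lte_fin ab ltry.
have [g_ [cg jg cv]] := approximation_continuous_integrable mD Dfin jf.
(* The added 1 keeps the constant positive when M = 0. *)
pose C : R := (2 * M) `^ (p - 1) + 1.
have C0 : 0 < C by rewrite ltr_wpDl// powR_ge0.
have [n nP] := cvg0_ereal_lt cv (divr_gt0 e0 C0).
have cc : continuous (clip M \o g_ n).
  by move=> x; apply: continuous_comp; [exact: cg|exact: continuous_clip].
have mc : measurable_fun D (clip M \o g_ n).
  by apply: measurable_funTS; exact: continuous_measurable.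
exists (clip M \o g_ n); split => //.
  by apply: (@psum_approx_continuous _ _ _ M) => // r; exact: norm_clip.
have mfg : measurable_fun D (fun x => `|(f x - g_ n x)%:E|%E).
  apply: measurableT_comp => //; apply/measurable_EFinP; apply: measurable_funB => //.
  by apply: measurable_funTS; exact: continuous_measurable.
apply: (@le_lt_trans _ _ (C%:E * \int[mu]_(x in D) `|(f x - g_ n x)%:E|)%E); last first.
  by rewrite muleC -lte_pdivlMr//; exact: nP.
rewrite NpE// -ge0_integralZl//; last by rewrite lee_fin ltW.
apply: ge0_le_integral => //.
- by apply: mP; exact: measurable_funB.
- exact: measurable_funeM.
move=> x xD; rewrite -EFinM lee_fin -(mulr_powRB1 _ p0)// mulrC.
have cE : `|(f - (clip M \o g_ n)) x| <= `|f x - g_ n x|.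
  have -> : (f - (clip M \o g_ n)) x = clip M (f x) - clip M (g_ n x) by rewrite (clip_id (fM x xD)).
  exact: dist_clip_le.
apply: ler_pM => //.
apply: (@le_trans _ _ ((2 * M) `^ (p - 1))); last by rewrite lerDl.
rewrite ge0_ler_powR ?nnegrE ?subr_ge0 ?mulr_ge0// mulr_natl mulr2n.
by apply: le_trans (ler_normB _ _) _; apply: lerD; [exact: fM|exact: norm_clip].
Qed.

Lemma psum_dense s p f : 1 <= p -> measurable_fun D f -> (Np p f < +oo)%E -> psum_approx s p f.
Proof.
move=> p1 mf fp; have p0 : 0 < p by exact: lt_le_trans p1.
apply: psum_approx_lim => // e e0.
have mc n : measurable_fun D (clip n%:R \o f).
  by apply: measurableT_comp => //; apply: continuous_measurable; exact: continuous_clip.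
have [n nP] : exists n, (Np p (f - (fun x => clip n%:R (f x)))%R < e%:E)%E.
  apply: (@Np_dominated p (fun n x => clip n%:R (f x)) f f e) => //.
  - move=> x xD; apply: cvg_near_cst; exists (Num.bound `|f x|) => // n /= fn.
    by rewrite clip_id//; apply: le_trans (ltW (archi_boundP (normr_ge0 _))) _; rewrite ler_nat.
  - by move=> n x xD; exact: norm_sub_clip.
exists (clip n%:R \o f); split => //.
by apply: (@psum_approx_bounded _ _ _ n%:R) => // x _; exact: norm_clip.
Qed.

End Density.

(** * Weak derivatives of all orders, treated uniformly by duality *)

Section WeakDerivatives.
Context {R : realType} (a b : R).
Hypothesis ab : a < b.
Notation mu := (@lebesgue_measure R).
Notation D := (`]a, b[%classic : set R).
Variables (s : side) (alpha p : R).
Hypotheses (a0 : 0 < alpha) (p1 : 1 <= p).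
Implicit Types (f g h q u v w phi : R -> R) (V W : nat -> R -> R).
Local Notation Np := (Np a b).
Local Notation m := (Num.truncn alpha).

Let p0 : 0 < p. Proof. exact: lt_le_trans p1. Qed.

Let LqP f : Lp D p f <-> measurable_fun D f /\ (Np p f < +oo)%E.
Proof. exact: LpP. Qed.

Let mD : measurable (D : set (measurableTypeR R)).
Proof. exact: measurable_itv. Qed.

Lemma LpW f : Lp D p f -> mu.-integrable D (EFin \o f).
Proof. by move/(LqP f) => [mf fp]; exact: Lp_integrable fp. Qed.

Lemma Lp_locally_integrable f : Lp D p f -> locally_integrable D f.
Proof. by move=> /LpW; apply: open_integrable_locally; exact: itv_open. Qed.

Lemma LpB f g : Lp D p f -> Lp D p g -> Lp D p (f - g).
Proof.
move=> /(LqP f)[mf fp] /(LqP g)[mg gp]; apply/(LqP _); split; first exact: measurable_funB.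
apply: le_lt_trans (NpD p0 mf (_ : measurable_fun D (- g))) _; first exact: measurableT_comp.
by rewrite NpN lte_mul_pinfty ?lee_fin ?powR_ge0// lte_add_pinfty.
Qed.

Lemma Lp_ae f g : Lp D p f -> measurable_fun D g -> {ae mu, forall x, D x -> g x = f x} -> Lp D p g.
Proof.
by move=> /(LqP f)[mf fp] mg gf; apply/(LqP _); split => //; rewrite (ae_eq_Np p0 mg mf gf).
Qed.

(* [dual_op i] with the sign [dual_sign i] defines the weak derivative of order [i]
   for [i <= m], and the weak fractional derivative for [i = m + 1]. *)
Definition dual_op i phi : R -> R :=
  if (i <= m)%N then derive1n i phi else frac_deriv (other s) a b alpha phi.

Definition dual_sign i : R := (-1) ^+ minn i m.

Lemma dual_op_bounded i phi : test_function D phi ->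
  measurable_fun D (dual_op i phi) /\ exists M : R, forall x, D x -> `|dual_op i phi x| <= M.
Proof.
move=> tphi; rewrite /dual_op; case: ifP => _; last exact: frac_deriv_bounded.
have ti := test_derive1n ab i tphi; have [M _ tM] := test_bounded ab ti.
by split; [apply: measurable_funTS; exact: test_measurable ti|exists M].
Qed.

Definition weak_dual i u v := forall phi, test_function D phi ->
  \int[mu]_(x in D) (v x * phi x) = dual_sign i * \int[mu]_(x in D) (u x * dual_op i phi x).

(** All terms of the norm at once, and free of the chosen representatives. At index 0 the duality
    forces [V 0] to be [u] almost everywhere. *)
Definition weak_family u V := Lp D p u /\
  forall i, (i <= m.+1)%N -> Lp D p (V i) /\ weak_dual i u (V i).

Lemma weak_dual_unique i u v w : weak_dual i u v -> weak_dual i u w ->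
  locally_integrable D v -> locally_integrable D w -> {ae mu, forall x, D x -> v x = w x}.
Proof.
move=> uv uw lv lw; apply: (fundamental_lemma_eq ab lv lw) => phi tphi.
by rewrite uv// uw.
Qed.

Lemma Rintegral_mulB f g q : mu.-integrable D (EFin \o f) -> mu.-integrable D (EFin \o g) ->
  measurable_fun D q -> (exists M : R, forall x, D x -> `|q x| <= M) ->
  \int[mu]_(x in D) ((f - g) x * q x) =
  \int[mu]_(x in D) (f x * q x) - \int[mu]_(x in D) (g x * q x).
Proof.
move=> jf jg mq bq; rewrite -RintegralB//.
- by apply: eq_Rintegral => x _; rewrite -mulrBl.
- exact: (integrable_mul_bounded jf mq bq).
- exact: (integrable_mul_bounded jg mq bq).
Qed.

Lemma test_funD_bounded phi : test_function D phi ->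
  measurable_fun D phi /\ exists M : R, forall x, D x -> `|phi x| <= M.
Proof.
move=> tphi; have [M _ tM] := test_bounded ab tphi.
by split; [apply: measurable_funTS; exact: test_measurable tphi|exists M].
Qed.

Lemma weak_dualB i u u' v v' : Lp D p u -> Lp D p u' -> Lp D p v -> Lp D p v' ->
  weak_dual i u v -> weak_dual i u' v' -> weak_dual i (u - u') (v - v').
Proof.
move=> lu lu' lv lv' uv uv' phi tphi.
have [mt bt] := test_funD_bounded tphi; have [mo bo] := dual_op_bounded i tphi.
by rewrite !Rintegral_mulB ?uv ?uv' ?mulrBr//; exact: LpW.
Qed.

Lemma weak_familyB u u' V V' : weak_family u V -> weak_family u' V' ->
  weak_family (u - u') (V - V').
Proof.
move=> [lu uV] [lu' uV']; split=> [|i im]; first exact: LpB.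
have [lv wv] := uV i im; have [lv' wv'] := uV' i im.
by split; [exact: LpB|exact: weak_dualB].
Qed.

Lemma weak_family_ae u w V : weak_family w V -> measurable_fun D u ->
  {ae mu, forall x, D x -> u x = w x} -> weak_family u V.
Proof.
move=> [lw wV] mf uw; have lu : Lp D p u by exact: Lp_ae lw mf uw.
split => // i im; have [lv wv] := wV i im; split => // phi tphi.
rewrite wv//; congr (_ * _); have [mo bo] := dual_op_bounded i tphi.
apply: ae_eq_Rintegral => //.
- by apply: measurable_funM => //; move/(LqP w) : lw => [].
- exact: measurable_funM.
- by apply: (@filterS _ _ (ae_filter_ringOfSetsType mu)) uw => x /[apply] ->.
Qed.

(** L^p convergence on a bounded interval gives L^1 convergence, which suffices against a bounded
    factor. *)
Lemma cvg_Rintegral_mul (f_ : nat -> R -> R) f q : (forall n, Lp D p (f_ n)) -> Lp D p f ->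
  (forall e, 0 < e -> exists k, forall n, (k <= n)%N -> (Np p (f_ n - f)%R < e%:E)%E) ->
  measurable_fun D q -> (exists M : R, forall x, D x -> `|q x| <= M) ->
  \int[mu]_(x in D) (f_ n x * q x) @[n --> \oo] --> \int[mu]_(x in D) (f x * q x).
Proof.
move=> lf_ lf cf mq [M qM]; apply/cvgrPdist_lt => e e0.
pose N := `|M| + 1; have N0 : 0 < N by rewrite ltr_wpDl.
have [d d0 dP] := L1_small ab p1 (divr_gt0 e0 N0).
have [k kP] := cf d d0; exists k => // n /= kn.
have lB := LpB (lf_ n) lf; have jB := LpW lB; have [mB _] := (LqP _).1 lB.
have bq : exists M : R, forall x, D x -> `|q x| <= M by exists M.
rewrite distrC -Rintegral_mulB//; try exact: LpW.
apply: (@le_lt_trans _ _ (N * \int[mu]_(x in D) `|(f_ n - f) x|)).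
  have jN : mu.-integrable D (EFin \o (fun x => `|(f_ n - f) x|)) by exact: integrable_norm.
  rewrite -RintegralZl//.
  apply: le_trans (le_normr_Rintegral mD (integrable_mul_bounded jB mq bq)) _.
  apply: le_Rintegral => //.
  - exact/integrable_norm/(integrable_mul_bounded jB mq bq).
  - exact: integrableZ_D.
  move=> x xD; rewrite normrM mulrC ler_wpM2r//.
  by apply: (le_trans (qM x xD)); apply: (le_trans (ler_norm M)); rewrite lerDl.
rewrite mulrC -ltr_pdivlMr// -lte_fin /Rintegral fineK.
  exact: dP mB (kP n kn).
have := integrable_fin_num mD (integrable_norm jB); by [].
Qed.

(** Weak derivatives are closed operators: for a fixed test function both sides of the duality
    identity pass to the limit. *)
Lemma weak_family_lim (u_ : nat -> R -> R) (V_ : nat -> nat -> R -> R) W :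
  (forall n, weak_family (u_ n) (V_ n)) -> (forall n, V_ n 0%N = u_ n) ->
  (forall i, (i <= m.+1)%N -> Lp D p (W i)) ->
  (forall i, (i <= m.+1)%N -> forall e, 0 < e ->
    exists k, forall n, (k <= n)%N -> (Np p (V_ n i - W i)%R < e%:E)%E) ->
  weak_family (W 0%N) W.
Proof.
move=> uV V0 lW cW; split; first exact: lW.
move=> i im; split; first exact: lW.
move=> phi tphi; have [mt bt] := test_funD_bounded tphi; have [mo bo] := dual_op_bounded i tphi.
have cV := @cvg_Rintegral_mul (fun n => V_ n i) (W i) phi (fun n => ((uV n).2 i im).1) (lW i im) (cW i im) mt bt.
have c0 : forall e, 0 < e -> exists k, forall n, (k <= n)%N -> (Np p (u_ n - W 0%N)%R < e%:E)%E.
  by move=> e e0; have [k kP] := cW 0%N (leq0n _) e e0; exists k => n kn; rewrite -V0 kP.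
have cu := cvg_Rintegral_mul (fun n => (uV n).1) (lW 0%N (leq0n _)) c0 mo bo.
have E : (fun n : nat => \int[mu]_(x in D) (V_ n i x * phi x)) =
    (fun n => dual_sign i * \int[mu]_(x in D) (u_ n x * dual_op i phi x)).
  by apply/funext => n; exact: ((uV n).2 i im).2.
rewrite E in cV; apply: (cvg_unique _ cV) => //.
exact: cvgMr.
Qed.

End WeakDerivatives.

(** * The fractional Sobolev norm in terms of weak families *)

Section SobolevNorm.
Context {R : realType} (a b : R).
Hypothesis ab : a < b.
Notation mu := (@lebesgue_measure R).
Notation D := (`]a, b[%classic : set R).
Variables (s : side) (alpha p : R).
Hypotheses (a0 : 0 < alpha) (p1 : 1 <= p).
Implicit Types (f g h q u v w phi : R -> R) (V W : nat -> R -> R).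
Local Notation Np := (Np a b).
Local Notation m := (Num.truncn alpha).
Local Notation dual := (weak_dual a b s alpha).
Local Notation weak_family := (weak_family a b s alpha p).

Let p0 : 0 < p. Proof. exact: lt_le_trans p1. Qed.

Lemma weak_dual_deriv k u v : (k <= m)%N -> locally_integrable D u -> locally_integrable D v ->
  is_weak_deriv D k u v <-> dual k u v.
Proof.
move=> km lu lv; rewrite /weak_dual /dual_sign /dual_op km (minn_idPl km).
by split => [[]|uv].
Qed.

Lemma weak_dual_frac_deriv u v : Lp D 1 u -> locally_integrable D v ->
  is_weak_frac_deriv s a b alpha u v <-> dual m.+1 u v.
Proof.
move=> lu lv; rewrite /weak_dual /dual_sign /dual_op ltnn (minn_idPr (leqnSn m)).
by split => [[]|uv].
Qed.

Lemma Lp_L1 u : Lp D p u -> Lp D 1 u.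
Proof.
move=> lu; have /integrableP[/measurable_EFinP mu1 u1] := LpW ab p1 lu.
apply/(LpP _ _ _ ltr01); split => //.
rewrite NpE//; apply: le_lt_trans u1; rewrite le_eqVlt; apply/orP; left; apply/eqP.
by apply: eq_integral => x _; rewrite powRr1.
Qed.

Definition weak_derivs u i : R -> R :=
  if i == 0%N then u else if (i <= m)%N then weak_deriv D i u
  else weak_frac_deriv s a b alpha u.

(** The representative picked by [xget] is a priori only locally integrable; by uniqueness it equals
    almost everywhere the L^p derivative that membership provides. *)
Lemma weak_derivsP u : frac_sobolev s a b alpha p u -> weak_family u (weak_derivs u).
Proof.
move=> [[lu wu] [v uv lv]]; split => // i im.
have liu : locally_integrable D u := Lp_locally_integrable ab p1 lu.
suff [w [uw1 lw1 [uw lw]]] : exists w, [/\ dual i u w, Lp D p w &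
    dual i u (weak_derivs u i) /\ locally_integrable D (weak_derivs u i)].
  split => //; apply: (Lp_ae p1 lw1); first by case: lw.
  by apply: (weak_dual_unique ab uw uw1) => //; exact: (Lp_locally_integrable ab p1).
rewrite /weak_derivs; have [->|i0] := eqVneq i 0%N.
  have uu : dual 0 u u.
    move=> phi _; rewrite /dual_op /dual_sign leq0n min0n expr0 mul1r.
    by apply: eq_Rintegral => x _; rewrite derive1n0.
  by exists u; split.
have [{}im|mi] := leqP i m.
  have [w uw lw] : exists2 v, is_weak_deriv D i u v & Lp D p v by apply: wu; rewrite lt0n i0.
  have : is_weak_deriv D i u (weak_deriv D i u).
    exact: (@xgetPex _ (cst 0) [set v | is_weak_deriv D i u v] (ex_intro _ w uw)).
  move=> dw; have [_ lw' _] := dw.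
  exists w; split => //; last split => //.
    by apply/weak_dual_deriv => //; exact: (Lp_locally_integrable ab p1).
  exact/weak_dual_deriv.
have {mi im}-> : i = m.+1 by apply/eqP; rewrite eqn_leq im.
have dv : is_weak_frac_deriv s a b alpha u (weak_frac_deriv s a b alpha u).
  exact: (@xgetPex _ (cst 0) [set v | is_weak_frac_deriv s a b alpha u v] (ex_intro _ v uv)).
have [l1 lw' _] := dv.
exists v; split => //; last split => //.
  by apply/weak_dual_frac_deriv => //; exact: (Lp_locally_integrable ab p1).
exact/weak_dual_frac_deriv.
Qed.

Lemma weak_family_sobolev u V : weak_family u V -> frac_sobolev s a b alpha p u.
Proof.
move=> [lu uV]; have liu : locally_integrable D u := Lp_locally_integrable ab p1 lu.
split; last first.
  have [lv uv] := uV m.+1 (leqnn _); exists (V m.+1) => //.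
  apply/weak_dual_frac_deriv => //; first exact: Lp_L1.
  exact: (Lp_locally_integrable ab p1).
split => // k /andP[k0 km]; have [lv uv] := uV k (leqW km); exists (V k) => //.
by apply/weak_dual_deriv => //; exact: (Lp_locally_integrable ab p1).
Qed.

(** By uniqueness almost everywhere, any family computes the norm, so differences and limits need no
    control over the chosen representatives. *)
Lemma frac_sobolev_normE u V : weak_family u V ->
  frac_sobolev_norm s a b alpha p u = ((\sum_(i < m.+2) Np p (V i)) `^ p^-1)%E.
Proof.
move=> uV; have uw := weak_derivsP (weak_family_sobolev uV).
have -> : (\sum_(i < m.+2) Np p (V i) = \sum_(i < m.+2) Np p (weak_derivs u i))%E.
  apply: eq_bigr => i _; have im : (i <= m.+1)%N by rewrite -ltnS.
  have [lv uv] := uV.2 i im; have [lw uwi] := uw.2 i im.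
  have li f : Lp D p f -> locally_integrable D f := @Lp_locally_integrable _ _ _ ab _ p1 f.
  have mLp f : Lp D p f -> measurable_fun D f by move/(LpP a b f p0) => [].
  apply: (ae_eq_Np p0); [exact: mLp|exact: mLp|].
  by apply: (weak_dual_unique ab uv uwi); exact: li.
rewrite /frac_sobolev_norm /sobolev_norm; congr (_ `^ _)%E.
rewrite -poweRrM mulVf ?gt_eqF// poweRe1; last first.
  by apply: adde_ge0; [|apply: sume_ge0 => i _]; exact: poweR_ge0.
rewrite big_ord_recr big_ord_recl/= !Lp_norm_pow//; congr (_ + _ + _)%E; last first.
  by rewrite /weak_derivs/= ltnn.
rewrite big_add1 big_mkord; apply: eq_bigr => i _.
by rewrite Lp_norm_pow// /weak_derivs /= ltn_ord.
Qed.

End SobolevNorm.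

(** * Smallness of powers and finite sums, and vanishing L^p norms *)

Lemma lt_poweR (R : realType) (x : \bar R) (p e : R) : (0 <= x)%E -> 0 < p -> 0 < e ->
  ((x `^ p^-1)%E < e%:E)%E = (x < (e `^ p)%:E)%E.
Proof.
move=> x0 p0 e0; have pV0 : 0 < p^-1 by rewrite invr_gt0.
case: x x0 => [r| |] //=; last by rewrite ?poweRyr ?gt_eqF// !ltNge !leey.
rewrite lee_fin => r0; rewrite ?poweR_EFin !lte_fin.
have eE : e = (e `^ p) `^ p^-1 by rewrite -powRrM mulfV ?gt_eqF// powRr1// ltW.
rewrite [in LHS]eE; have [re|er] := ltP r (e `^ p).
  by rewrite gt0_ltr_powR ?nnegrE ?powR_ge0.
by apply/negbTE; rewrite -leNgt ge0_ler_powR ?nnegrE ?powR_ge0// ltW.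
Qed.

Lemma lt_sum_eps (R : realType) (n : nat) (x_ : nat -> nat -> \bar R) :
  (forall i, (i < n)%N -> forall e : R, 0 < e -> exists k, forall j, (k <= j)%N -> (x_ j i < e%:E)%E) ->
  forall e : R, 0 < e -> exists k, forall j, (k <= j)%N -> (\sum_(i < n) x_ j i < e%:E)%E.
Proof.
elim: n => [|n IH] xP e e0; first by exists 0%N => j _; rewrite big_ord0 lte_fin.
have e20 : 0 < e / 2 by rewrite divr_gt0.
have [k1 kP1] := IH (fun i im => xP i (ltnW im)) _ e20.
have [k2 kP2] := xP n (ltnSn n) _ e20.
exists (maxn k1 k2) => j; rewrite geq_max => /andP[k1j k2j].
by rewrite big_ord_recr/= [e]splitr EFinD; apply: lteD; [exact: kP1|exact: kP2].
Qed.

Lemma Np_eq0 (R : realType) (a b p : R) (f : R -> R) : 1 <= p -> Lp `]a, b[ p f -> Np a b p f = 0%E ->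
  {ae (@lebesgue_measure R), forall x, `]a, b[%classic x -> f x = 0}.
Proof.
move=> p1; have p0 : 0 < p by exact: lt_le_trans p1.
move=> /(LpP a b f p0)[mf _] f0.
have := Lp_normE a b f p0; rewrite f0 poweR0r ?gt_eqF ?invr_gt0// => /Lnorm_eq0_eq0 H.
have {H} : EFin \o f \_ `]a, b[ = \0%E %[ae (@lebesgue_measure R)].
  by apply: H => //; apply/measurable_EFinP; exact: measurable_restrict_D.
apply: (@filterS _ _ (ae_filter_ringOfSetsType (@lebesgue_measure R))) => x /(_ I) /= [fx] xD.
by rewrite -fx patchE mem_set.
Qed.

Lemma Rintegral0_eq (R : realType) d (X : measurableType d) (mu : {measure set X -> \bar R})
    (D : set X) (f : X -> R) : (forall x, D x -> f x = 0) -> \int[mu]_(x in D) f x = 0.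
Proof. by move=> f0; rewrite /Rintegral integral0_eq// => x xD; rewrite f0. Qed.

(** * Separation and completeness of the fractional Sobolev space *)

Section Completion.
Context {R : realType} (a b : R).
Hypothesis ab : a < b.
Notation mu := (@lebesgue_measure R).
Notation D := (`]a, b[%classic : set R).
Variables (s : side) (alpha p : R).
Hypotheses (a0 : 0 < alpha) (p1 : 1 <= p).
Implicit Types (f g h q u v w phi : R -> R) (V W : nat -> R -> R).
Local Notation Np := (Np a b).
Local Notation m := (Num.truncn alpha).
Local Notation weak_dual := (weak_dual a b s alpha).
Local Notation weak_family := (weak_family a b s alpha p).
Local Notation weak_derivs := (weak_derivs a b s alpha).
Local Notation N := (frac_sobolev_norm s a b alpha p).
Local Notation T := (frac_sobolev s a b alpha p).

Let p0 : 0 < p. Proof. exact: lt_le_trans p1. Qed.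

Let LqP f : Lp D p f <-> measurable_fun D f /\ (Np p f < +oo)%E.
Proof. exact: LpP. Qed.

Let wdP u : T u -> weak_family u (weak_derivs u).
Proof. exact: weak_derivsP. Qed.

Lemma sum_Np_ge0 n V : (0 <= \sum_(i < n) Np p (V i))%E.
Proof. by apply: sume_ge0 => i _; exact: Np_ge0. Qed.

Lemma frac_sobolev_norm_lt u V e : weak_family u V -> 0 < e ->
  (N u < e%:E)%E = (\sum_(i < m.+2) Np p (V i) < (e `^ p)%:E)%E.
Proof.
by move=> uV e0; rewrite (frac_sobolev_normE ab p1 uV) lt_poweR// sum_Np_ge0.
Qed.

Lemma frac_sobolevB u v : T u -> T v -> weak_family (u - v) (weak_derivs u - weak_derivs v).
Proof. by move=> Tu Tv; apply: weak_familyB => //; exact: wdP. Qed.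

Lemma le_sum_Np n i V : (i < n)%N -> (Np p (V i) <= \sum_(j < n) Np p (V j))%E.
Proof.
move=> im; rewrite (bigD1 (Ordinal im))//= leeDl//.
by apply: sume_ge0 => j _; exact: Np_ge0.
Qed.

(** The term of index 0 alone gives one direction. Conversely, a function that vanishes almost
    everywhere has 0 as a weak derivative of every order considered, and uniqueness makes every term
    of the norm zero. *)
Lemma frac_sobolev_norm_eq0 u v : T u -> T v ->
  N (u - v) = 0%E <-> (u = v %[ae mu in D]).
Proof.
move=> Tu Tv; have uvB := frac_sobolevB Tu Tv.
have [lu lv] := ((wdP Tu).1, (wdP Tv).1).
have mLp f : Lp D p f -> measurable_fun D f by move/LqP => [].
have mD : measurable (D : set (measurableTypeR R)) by exact: measurable_itv.
rewrite (frac_sobolev_normE ab p1 uvB); split.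
  move/(poweR_eq0_eq0 (sum_Np_ge0 _ _)) => S0.
  have : Np p (u - v)%R = 0%E.
    apply/eqP; rewrite eq_le Np_ge0 andbT -S0.
    exact: (@le_sum_Np m.+2 0 (weak_derivs u - weak_derivs v)).
  move=> N0; have := Np_eq0 p1 uvB.1 N0.
  by apply: (@filterS _ _ (ae_filter_ringOfSetsType mu)) => x /[apply] /eqP; rewrite subr_eq0 => /eqP.
move=> uv; rewrite big1 ?poweR0r ?invr_neq0 ?gt_eqF// => i _.
have im : (i <= m.+1)%N by rewrite -ltnS.
have [lw dw] := uvB.2 i im; have [luv _] := uvB.
have m0 : measurable_fun D (cst (0 : R)) by exact: measurable_cst.
have l0 : Lp D p (cst 0) by apply/LqP; split => //; exact: Np_cst.
rewrite (ae_eq_Np p0 (mLp _ lw) m0).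
  by rewrite NpE//; apply: integral0_eq => x _; rewrite normr0 powR0// gt_eqF.
apply: (weak_dual_unique ab dw) => //; try exact: (Lp_locally_integrable ab p1).
move=> phi tphi; have [mo bo] := dual_op_bounded ab s a0 i tphi.
rewrite [LHS]Rintegral0_eq; last by move=> x _; rewrite mul0r.
rewrite [X in _ * X](_ : _ = 0) ?mulr0//.
transitivity (\int[mu]_(x in D) (cst 0 x : R)); last by rewrite Rintegral0_eq.
apply: ae_eq_Rintegral => //; first by apply: measurable_funM => //; exact: mLp.
apply: (@filterS _ _ (ae_filter_ringOfSetsType mu)) uv => x /[apply] uvx.
by rewrite -[(u - v) x]/(u x - v x) uvx subrr mul0r.
Qed.

(** Each of the m + 2 terms is Cauchy in L^p and has a limit there; closedness makes the limits a
    weak family of the limit at index 0. *)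
Lemma frac_sobolev_complete (u_ : nat -> R -> R) : (forall k, T (u_ k)) -> norm_cauchy N u_ ->
  exists2 w, T w & norm_cvg N u_ w.
Proof.
move=> Tu cu.
have ci i : (i <= m.+1)%N -> forall e : R, 0 < e -> exists k, forall j j', (k <= j)%N -> (k <= j')%N ->
    (Np p (weak_derivs (u_ j) i - weak_derivs (u_ j') i)%R < e%:E)%E.
  move=> im e e0; have e'0 : 0 < e `^ p^-1 by exact: powR_gt0.
  have [k kP] := cu _ e'0; exists k => j j' kj kj'.
  have := kP j j' kj kj'; rewrite (frac_sobolev_norm_lt (frac_sobolevB (Tu j) (Tu j')))//.
  rewrite -powRrM mulVf ?gt_eqF// powRr1 ?ltW//; apply: le_lt_trans.
  exact: (@le_sum_Np m.+2 i (weak_derivs (u_ j) - weak_derivs (u_ j'))).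
have sub i : exists w, (i <= m.+1)%N -> Lp D p w /\
    forall e : R, 0 < e -> exists k, forall j, (k <= j)%N -> (Np p (weak_derivs (u_ j) i - w)%R < e%:E)%E.
  have [im|] := leqP i m.+1; last by exists (cst 0).
  have lV n : Lp D p (weak_derivs (u_ n) i) := ((wdP (Tu n)).2 i im).1.
  have [w [mw wp wP]] := Riesz_Fischer ab p1 (fun n => ((LqP _).1 (lV n)).1)
    (fun n => ((LqP _).1 (lV n)).2) (ci i im).
  by exists w => _; split => //; exact/LqP.
have [W WP] := choice sub.
have WW : weak_family (W 0%N) W.
  apply: (weak_family_lim ab a0 p1 (fun n => wdP (Tu n))) => // i im; first by have [] := WP i im.
  by have [] := WP i im.
exists (W 0%N); first exact: (weak_family_sobolev ab p1 WW).
apply: cvg_ereal_lt0 => [n|e e0].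
  by rewrite poweR_ge0.
have e'0 : 0 < e `^ p by exact: powR_gt0.
have [k kP] := @lt_sum_eps R m.+2 (fun j i => Np p (weak_derivs (u_ j) i - W i)%R) 
  (fun i im => (WP i im).2) _ e'0.
exists k => n kn; rewrite (frac_sobolev_norm_lt (weak_familyB ab a0 p1 (wdP (Tu n)) WW))//.
exact: kP.
Qed.

End Completion.

(** * Density of smooth functions in the fractional Sobolev space *)

Section Density.
Context {R : realType} (a b : R).
Hypothesis ab : a < b.
Notation mu := (@lebesgue_measure R).
Notation D := (`]a, b[%classic : set R).
Variables (s : side) (alpha p : R).
Hypotheses (a0 : 0 < alpha) (p1 : 1 <= p).
Implicit Types (f g h q u v w phi : R -> R) (V W : nat -> R -> R).
Local Notation Np := (Np a b).
Local Notation m := (Num.truncn alpha).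
Local Notation weak_dual := (weak_dual a b s alpha).
Local Notation weak_family := (weak_family a b s alpha p).
Local Notation weak_derivs := (weak_derivs a b s alpha).
Local Notation N := (frac_sobolev_norm s a b alpha p).
Local Notation T := (frac_sobolev s a b alpha p).
Local Notation psum := (psum a b).
Local Notation is_psum := (is_psum a b).

Let p0 : 0 < p. Proof. exact: lt_le_trans p1. Qed.

Let LqP f : Lp D p f <-> measurable_fun D f /\ (Np p f < +oo)%E.
Proof. exact: LpP. Qed.

(** The solution operator recast as a weak family: index m + 1, the fractional derivative, is [g]
    itself. *)
Lemma weak_solution_family : exists (J : nat -> (R -> R) -> R -> R) (C : R), [/\ 0 <= C,
  forall g, Lp D p g -> weak_family (J 0%N g) (J ^~ g),
  forall g, J m.+1 g = g,
  forall g k, (k <= m.+1)%N -> Lp D p g -> (Np p (J k g) <= C%:E * Np p g)%E &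
  forall g, is_psum s g -> is_psum s (J 0%N g)].
Proof.
have [J [iJ wJ fJ [C CJ] pJ]] := solution_operator ab s a0 p1.
exists (fun k g => if (k <= m)%N then J k g else g), (`|C| + 1).
have CP k g : (k <= m.+1)%N -> Lp D p g ->
    (Np p (if (k <= m)%N then J k g else g) <= (`|C| + 1)%:E * Np p g)%E.
  move=> km lg; have jg := LpW ab p1 lg; case: ifP => km'.
    apply: le_trans (CJ k g km' jg) _; apply: lee_wpmul2r; first exact: Np_ge0.
    by rewrite lee_fin (le_trans (ler_norm C))// lerDl.
  by rewrite -[leLHS]mul1e lee_wpmul2r ?Np_ge0// lee_fin lerDr.
have lJ k g : (k <= m.+1)%N -> Lp D p g -> Lp D p (if (k <= m)%N then J k g else g).
  move=> km lg; have jg := LpW ab p1 lg; apply/LqP; split.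
    by case: ifP => km'; apply: integrable_measurable => //; exact: iJ.
  apply: le_lt_trans (CP k g km lg) _; rewrite lte_mul_pinfty ?lee_fin ?addr_ge0//.
  by move/LqP : lg => [].
split => //.
- move=> g lg; have jg := LpW ab p1 lg; split; first exact: (lJ 0%N).
  move=> i im; split; first exact: lJ.
  move=> phi tphi; rewrite /dual_sign /dual_op; case: ifP => im'.
    by rewrite (minn_idPl im') wJ.
  have -> : minn i m = m by apply/minn_idPr; rewrite ltnW// ltnNge im'.
  exact: fJ.
- by move=> g; rewrite ltnn.
- by move=> g k km lg; exact: CP.
Qed.

Lemma weak_family0 : weak_family 0 0.
Proof.
have l0 : Lp D p 0 by apply/LqP; split; [exact: measurable_cst|exact: (Np_cst ab 0 p0)].
split => // i _; split => // phi _.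
by rewrite !Rintegral0_eq ?mulr0// => x _; rewrite -[X in X * _]/(0 : R) mul0r.
Qed.

Lemma weak_familyD u u' V V' : weak_family u V -> weak_family u' V' ->
  weak_family (u + u') (V + V').
Proof.
move=> uV uV'; have := weak_familyB ab a0 p1 weak_family0 uV'; rewrite !sub0r => uN.
by have := weak_familyB ab a0 p1 uV uN; rewrite !opprK.
Qed.

Lemma measurable_psum_D l : measurable_fun D (psum s l).
Proof. by apply: measurable_funTS; exact: measurable_psum. Qed.

(** Correcting w by [J 0 h] turns its fractional derivative into a power sum; such a function is
    itself a power sum up to a null set, and the correction is small in the full norm because J is
    bounded. *)
Lemma frac_sobolev_dense w (e : R) : T w -> 0 < e ->
  exists2 u, smooth_frac_sobolev s a b alpha p u & (N (u - w)%R < e%:E)%E.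
Proof.
move=> Tw e0; have wV := weak_derivsP ab p1 Tw; set V := weak_derivs w in wV.
have [J [C [C0 JW Jm JC Jp]]] := weak_solution_family.
pose v := V m.+1; have lv : Lp D p v := (wV.2 m.+1 (leqnn _)).1.
(* The m + 2 terms of the norm, each at most C times the error d, must add up to less than e^p; C +
   1 avoids dividing by 0. *)
pose d := e `^ p / (m.+2%:R * (C + 1)); have d0 : 0 < d.
  by rewrite divr_gt0 ?powR_gt0// mulr_gt0 ?ltr0n// ltr_wpDl.
have [l l0 vl] := psum_dense ab s p1 ((LqP _).1 lv).1 ((LqP _).1 lv).2 d0.
pose g := psum s l; pose h := g - v.
have lh' : Lp D p (v - g).
  apply/LqP; split; last by apply: lt_trans vl _; exact: ltry.
  by apply: measurable_funB; [move/LqP : lv => []|exact: measurable_psum_D].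
have lg : Lp D p g by have := LpB p1 lv lh'; rewrite opprB addrC subrK.
have lh : Lp D p h by exact: LpB.
have hd : (Np p h < d%:E)%E by have := vl; rewrite NpBC.
have Jh := JW h lh; have Jg := JW g lg.
(* Its fractional derivative is v + h = g, the same as that of [J 0 g]; the difference of the two
   therefore falls under [frac_kernel]. *)
pose w' := w + J 0%N h.
have w'W : weak_family w' (V + J ^~ h).
  exact: weak_familyD.
have kW := weak_familyB ab a0 p1 w'W Jg.
have [l1 kl1] : exists l, {ae mu, forall x, D x -> (w' - J 0%N g) x = psum s l x}.
  apply: (frac_kernel ab a0); first exact: (LpW ab p1 kW.1).
  move=> phi tphi; have := (kW.2 m.+1 (leqnn _)).2 phi tphi.
  rewrite Rintegral0_eq /dual_op ?ltnn; last first.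
    move=> x _; rewrite -[(V + J^~ h - J^~ g) m.+1 x]/(v x + J m.+1 h x - J m.+1 g x) !Jm -[h x]/(g x - v x).
    by rewrite addrCA subrr addr0 subrr mul0r.
  by move/esym/eqP; rewrite mulf_eq0 signr_eq0/= => /eqP.
have pg : is_psum s g by exists l.
have [l2 l20 Jl2] := Jp g pg.
(* The kernel element plus [J 0 g]: a representative of [w'] that is smooth at every point of
   (a,b). *)
pose u := psum s (l1 ++ l2).
have uw' : {ae mu, forall x, D x -> u x = w' x}.
  apply: (@filterS _ _ (ae_filter_ringOfSetsType mu)) kl1 => x /[swap] xD /(_ xD) kx.
  rewrite /u psum_cat -kx -Jl2//.
  by rewrite !fctE subrK.
have uW : weak_family u (V + J ^~ h) by apply: (weak_family_ae ab a0 p1 w'W) => //; exact: measurable_psum_D.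
exists u; first by split; [exact: smooth_psum|exact: (weak_family_sobolev ab p1 uW)].
have uwW := weak_familyB ab a0 p1 uW wV.
rewrite (frac_sobolev_norm_lt ab p1 uwW e0).
apply: (@le_lt_trans _ _ (\sum_(i < m.+2) (C%:E * Np p h))%E).
  apply: lee_sum => i _; have im : (i <= m.+1)%N by rewrite -ltnS.
  rewrite (@eq_Np _ _ _ _ _ (J i h)); first exact: JC.
  by move=> x xD; rewrite !fctE addrC addKr.
have hf : Np p h \is a fin_num by rewrite ge0_fin_numE ?Np_ge0//; apply: lt_trans hd _; exact: ltry.
move: hd; rewrite -(fineK hf) lte_fin => hd.
under eq_bigr do rewrite -EFinM.
rewrite sumEFin lte_fin sumr_const card_ord -mulr_natl.
apply: (@le_lt_trans _ _ (m.+2%:R * ((C + 1) * fine (Np p h)))).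
  by rewrite ler_wpM2l// ler_wpM2r ?fine_ge0 ?Np_ge0// lerDl.
rewrite mulrA mulrC -ltr_pdivlMr//.
by rewrite mulr_gt0 ?ltr0n// ltr_wpDl.
Qed.

End Density.

Theorem theorem5p1 (R : realType) (a b alpha p : R) (s : side)
    (hab : a < b) (halpha : 0 < alpha) (hp : 1 <= p) :
  is_completion (fun u v : R -> R => u = v %[ae (@lebesgue_measure R) in `]a, b[%classic])
    (frac_sobolev_norm s a b alpha p)
    (smooth_frac_sobolev s a b alpha p)
    (frac_sobolev s a b alpha p).
Proof.
split.
- by move=> u [].
- by move=> u v; exact: frac_sobolev_norm_eq0.
- by move=> u; exact: frac_sobolev_complete.
- move=> w Tw.
  have sub n : exists u, smooth_frac_sobolev s a b alpha p u /\
      (frac_sobolev_norm s a b alpha p (u - w)%R < (n.+1%:R^-1)%:E)%E.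
    have n0 : 0 < n.+1%:R^-1 :> R by rewrite invr_gt0 ltr0n.
    by have [u Su uw] := frac_sobolev_dense hab halpha hp Tw n0; exists u.
  have [u_ uP] := choice sub; exists u_; first by move=> k; have [] := uP k.
  apply: cvg_ereal_lt0 => [n|e e0]; first exact: poweR_ge0.
  have /cvgrPdist_lt/(_ _ e0)[k _ kP] := @cvg_harmonic R.
  exists k => n kn; apply: lt_trans (uP n).2 _; rewrite lte_fin.
  by have := kP n kn; rewrite /= sub0r normrN ger0_norm ?invr_ge0.
Qed.
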